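(* Let $\beta\in[0,1)\setminus\{\frac34\}$ and $e\in[0,1)$. Then $\gamma_{\beta,e}$ is linearly stable (i.e. the matrix $\gamma_{\beta,e}(2\pi)$ is linearly stable) if $$0\le e<\frac{1}{1+\sqrt{f(\beta,-1)}},\qquad \beta\in\left[0,\tfrac34\right),$$ or $$0\le e<\frac{1}{\sqrt{f(\beta,-1)}},\qquad \beta\in\left(\tfrac34,1\right).$$
   Context: For $\beta\in[0,1]$, $e\in[0,1)$ let $J=\begin{pmatrix}0&-1\\1&0\end{pmatrix}$, $B_{\beta,e}(t)=\begin{pmatrix}1&0\\0&1-\frac{\beta}{1+e\cos t}\end{pmatrix}$, and let $\gamma_{\beta,e}$ be the fundamental solution $\dot\gamma(t)=JB_{\beta,e}(t)\gamma(t)$, $\gamma(0)=I_2$, on $[0,2\pi]$ (the first order system associated with $\ddot x=-x+\frac{\beta}{1+e\cos t}x$, $z=(\dot x,x)^T$). A real symplectic $2\times 2$ matrix $M$ is linearly stable if $\|M^j\|\le C$ for some constant $C$ and all $j\in\mathbf N$. The function $f$: let $\cos^{\pm}(t)=(\cos t\pm|\cos t|)/2$, $K_\beta=\mathrm{diag}(0,\beta)$, $K_\beta^{\pm}=\cos^{\pm}(t)K_\beta$ (bounded self-adjoint multiplication operators on $L^2([0,2\pi],\mathbf C^2)$). For purely imaginary $\nu$ such that $-J\frac{d}{dt}-\nu J-B_{\beta,0}$, with periodic domain $\{z\in W^{1,2}([0,2\pi],\mathbf C^2): z(0)=z(2\pi)\}$, is invertible, put $$\mathcal F(\nu,B_{\beta,0},K_\beta^{\pm})=K_\beta^{\pm}\left(-J\tfrac{d}{dt}-\nu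 J-B_{\beta,0}\right)^{-1},$$ a Hilbert–Schmidt operator on $L^2([0,2\pi],\mathbf C^2)$, and for $\omega=e^{2\pi\nu}$ define $$f(\beta,\omega)=\mathrm{Tr}\left[\mathcal F(\nu,B_{\beta,0},K_\beta^{+})^2\right]=\mathrm{Tr}\left[\mathcal F(\nu,B_{\beta,0},K_\beta^{-})^2\right]$$ (the two traces coincide). For $\omega=-1$ one takes $\nu=\sqrt{-1}/2$; invertibility then holds for $\beta\in[0,1]\setminus\{\frac34\}$. *)

(* Defs.v *)
From mathcomp Require Import all_boot all_order all_algebra.
From mathcomp Require Import complex.
From mathcomp Require Import all_classical all_reals all_analysis.
Set Implicit Arguments.
Unset Strict Implicit.
Unset Printing Implicit Defensive.
Import Order.TTheory GRing.Theory Num.Theory.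
Import numFieldNormedType.Exports.
Local Open Scope classical_set_scope.
Local Open Scope ring_scope.

Definition mx2 (K : pzRingType) (a b c d : K) : 'M[K]_2 :=
  \matrix_(i < 2, j < 2) nth 0 (nth [::] [:: [:: a; b]; [:: c; d]] i) j.

Definition J (K : pzRingType) : 'M[K]_2 := mx2 0 (-1) 1 0.

Section Hamiltonian.
Variable R : realType.
Implicit Types (beta e t : R).

Definition period : set R := `[0, 2 * pi]%classic.

Definition B beta e t : 'M[R]_2 := mx2 1 0 0 (1 - beta / (1 + e * cos t)).

(* The derivative is only required in the interior; with continuity on the
   closed interval this is the same as one-sided derivatives at the ends. *)
Definition is_fundamental_solution beta e (gamma : R -> 'M[R]_2) : Prop :=
  [/\ gamma 0 = 1%:M,
      forall i j, {within period, continuous (fun t => gamma t i j)} &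
      forall t i j, 0 < t < 2 * pi ->
        is_derive t 1 (fun s => gamma s i j)
                      ((J R *m B beta e t *m gamma t) i j)].

(* [`| _ |] is the entrywise maximum norm; all norms on 2 x 2 matrices are
   equivalent, so the choice is immaterial. *)
Definition linearly_stable (M : 'M[R]_2) : Prop :=
  exists C : R, forall j : nat, `|M ^+ j| <= C.

End Hamiltonian.

(* Operators on L^2([0, 2 pi], C^2) act on representatives [R -> 'cV[R[i]]_2];
   values outside [0, 2 pi] play no role. *)
Section Operator.
Variable R : realType.
Implicit Types (beta t : R) (nu : R[i]).
Local Notation C := R[i].
Local Notation vfun := (R -> 'cV[C]_2).
Local Notation mu := (@lebesgue_measure R).
Local Notation toC := (map_mx (real_complex R)).
Implicit Types (g h z w : vfun).

Definition realL2 (h : R -> R) : Prop :=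
  measurable_fun (@period R) h /\
  mu.-integrable (@period R) (fun t => (h t ^+ 2)%:E).

Definition L2 g : Prop := forall i : 'I_2,
  realL2 (fun t => complex.Re (g t i 0)) /\
  realL2 (fun t => complex.Im (g t i 0)).

Definition Cintegral (a b : R) (h : R -> C) : C :=
  Complex (\int[mu]_(t in `[a, b]) complex.Re (h t))
          (\int[mu]_(t in `[a, b]) complex.Im (h t)).

(* [z] is (the continuous representative of) an element of W^{1,2} and [w] is
   its derivative. *)
Definition W12 z w : Prop :=
  L2 w /\
  forall t (i : 'I_2), period t ->
    z t i 0 = z 0 i 0 + Cintegral 0 t (fun s => w s i 0).

(* [z] lies in the periodic domain and
   (- J d/dt - nu J - B_{beta,0}) z = g in L^2. *)
Definition resolvent_graph nu beta g : set vfun := [set z |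
  exists w, [/\ W12 z w, z 0 = z (2 * pi) &
    {ae mu, forall t, period t ->
       - (J C *m w t) - nu *: (J C *m z t) - toC (B beta 0 t) *m z t = g t}]].

(* The inverse operator: when - J d/dt - nu J - B_{beta,0} is invertible the
   solution is unique on [0, 2 pi]; otherwise a junk value may be returned. *)
Definition resolvent nu beta g : vfun := xget 0 (resolvent_graph nu beta g).

Definition cos_plus t : R := (cos t + `|cos t|) / 2.

Definition K_plus beta t : 'M[R]_2 := cos_plus t *: mx2 0 0 0 beta.

Definition F_plus nu beta g : vfun :=
  fun t => toC (K_plus beta t) *m resolvent nu beta g t.

Definition inner g h : C :=
  Cintegral 0 (2 * pi) (fun t => \sum_(i < 2) g t i 0 * conjc (h t i 0)).

(* (2 pi)^{-1/2} e^{i k t} times the j-th standard basis vector of C^2; these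
   form an orthonormal basis of L^2([0, 2 pi], C^2). *)
Definition fourier (k : int) (j : 'I_2) : vfun := fun t =>
  Complex (cos (k%:~R * t) / Num.sqrt (2 * pi))
          (sin (k%:~R * t) / Num.sqrt (2 * pi)) *: delta_mx j 0.

(* Tr A is the sum of <A b, b> over an orthonormal basis; for a trace class
   operator the sum converges absolutely and depends neither on the basis nor
   on the order of summation. *)
Definition trace_partial (A : vfun -> vfun) (n : nat) : C :=
  \sum_(m < n.*2.+1) \sum_(j < 2)
    inner (A (fourier (m%:Z - n%:Z) j)) (fourier (m%:Z - n%:Z) j).

Definition trace (A : vfun -> vfun) : C :=
  Complex (limn (fun n => complex.Re (trace_partial A n)))
          (limn (fun n => complex.Im (trace_partial A n))).

(* The value f(beta, omega) at omega = e^{2 pi nu}.  The trace for cos^- in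
   place of cos^+ is the same: translating by pi exchanges cos^+ and - cos^-. *)
Definition trF2 beta nu : C := trace (F_plus nu beta \o F_plus nu beta).

(* f(beta, -1), with nu = i / 2.  For purely imaginary nu the operator
   - J d/dt - nu J - B_{beta,0} is self-adjoint, so the trace is a real number
   and taking the real part loses nothing. *)
Definition f_minus1 beta : R := complex.Re (trF2 beta (Complex 0 2^-1)).

End Operator.

(* Main.v *)
Require Import Defs.
From mathcomp Require Import all_boot all_order all_algebra.
From mathcomp Require Import complex.
From mathcomp Require Import all_classical all_reals all_analysis.
From mathcomp Require Import measurable_realfun ring lra.
Set Implicit Arguments.
Unset Strict Implicit.
Unset Printing Implicit Defensive.
Import Order.TTheory GRing.Theory Num.Theory.
Import numFieldNormedType.Exports.
Local Open Scope classical_set_scope.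
Local Open Scope ring_scope.

(* If [gamma (2 pi)] is not stable then [|tr| >= 2] and the Hill equation
   [x'' = - (1 - beta / (1 + e cos t)) x] has a solution with
   [x (t + 2 pi) = rho * x t] for a real [rho].  Sturm comparison with
   frequency [< 1] shows that [x] has at most one zero per period, and [rho > 0]
   is excluded because [1 + e cos t] satisfies [h'' + h = 1].

   For [rho < 0], put [l = sqrt (1 - beta)] and let [G] be the inverse of
   [- d^2/dt^2 - l^2] on [2 pi]-antiperiodic functions; its kernel is
   [green l (t - s)].  Computing the trace in the Fourier basis gives
   [f(beta, -1) = beta^2 * hs_norm l cos^+], where [hs_norm l q] is the squared
   Hilbert-Schmidt norm of [q^(1/2) G q^(1/2)].  With
   [1 - beta / (1 + e cos t) = l^2 + r t] we have [r <= beta e cos^+] and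
   [- r <= beta e / (1 - e) cos^-].

   - If [beta > 3/4], i.e. [l < 1/2], then [G] is positive.  Between consecutive
     zeros [t0] and [t0 + 2 pi], [x] rescaled is antiperiodic and is [G] applied to
     [r x] plus a point mass at [t0]; a Cauchy-Schwarz estimate for the form of [G]
     forces [e sqrt f >= 1].
   - If [beta < 3/4], i.e. [1/4 - l^2 < 0], let [q = beta e / (1 - e) cos^-].  The
     condition on [e] makes the Neumann series of [(1 + G q)^-1] converge; applied
     to the [v] in the span of [cos (t/2)] and [sin (t/2)] for which the sum
     vanishes at [t0], it produces a function on which the quadratic form of
     [- d^2/dt^2 - l^2 + q] is negative, whereas Jacobi's identity with [x] shows
     that this form is nonnegative on antiperiodic functions vanishing at [t0]. *)

(** * Derivatives and integrals of continuous functions *)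

Section Calculus.
Variable R : realType.
Implicit Types (f g h : R -> R) (a b c t x : R).
Local Notation mu := (@lebesgue_measure R).

(** Trace exactly [2] or [-2] falls on the side of real multipliers, so excluding these also
    excludes the parabolic case; only [beta = 0], where the monodromy is the identity, is separate.
    The two thresholds differ because [1 + e cos t] is at least [1] where the cosine is nonnegative
    but only at least [1 - e] elsewhere: [r] gets the factor [e] from above and [e / (1 - e)] from
    below, and [e / (1 - e) * sqrt f < 1] means [e < 1 / (1 + sqrt f)]. No spectral theory is
    invoked: the operator enters through its explicit kernel, and the bridge to the trace is a
    Fourier expansion of that kernel with uniform error [2 / (n + 1)], so limits under integrals
    become elementary estimates. As [rho] need not be [-1], the antiperiodic rescaling costs a kink,
    placed at a zero so that the function stays continuous. For [beta < 3/4] the eigenvalue [1/4] of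
    [- d^2/dt^2] on antiperiodic functions has multiplicity two, so the single condition of
    vanishing at [t0] still leaves a nonzero trial function. *)

Definition itg a b f : R := \int[mu]_(t in `[a, b]) f t.

Definition has_der f x l : Prop := is_derive x 1 f l.

Lemma der_ext f g x l : has_der f x l -> f =1 g -> has_der g x l.
Proof. by move=> fl /funext <-. Qed.

Lemma der_eq f x l m : has_der f x l -> l = m -> has_der f x m.
Proof. by move=> fl <-. Qed.

Lemma der_cst a x : has_der (fun _ => a) x 0.
Proof. exact: is_derive_cst. Qed.

Lemma der_id x : has_der (fun t => t) x 1.
Proof. exact: is_derive_id. Qed.

Lemma derD f g x l m : has_der f x l -> has_der g x m ->
  has_der (fun t => f t + g t) x (l + m).
Proof. by move=> fl gm; exact: is_deriveD. Qed.

Lemma derN f x l : has_der f x l -> has_der (fun t => - f t) x (- l).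
Proof. by move=> fl; exact: is_deriveN. Qed.

Lemma derM f g x l m : has_der f x l -> has_der g x m ->
  has_der (fun t => f t * g t) x (l * g x + f x * m).
Proof.
move=> fl gm; have := is_deriveM fl gm.
by move/der_eq; apply; rewrite /GRing.scale/=; ring.
Qed.

Lemma derX f x l : has_der f x l ->
  has_der (fun t => f t ^+ 2) x (2 * f x * l).
Proof. by move=> fl; apply: der_eq (derM fl fl) _; ring. Qed.

Lemma derV f x l : f x != 0 -> has_der f x l ->
  has_der (fun t => (f t)^-1) x (- l / f x ^+ 2).
Proof.
move=> f0 fl; have := is_deriveV f0 fl.
by move/der_eq; apply; rewrite /GRing.scale/=; field.
Qed.

Lemma der_sin f x l : has_der f x l ->
  has_der (fun t => sin (f t)) x (cos (f x) * l).
Proof. by move=> fl; exact: (@is_derive1_comp _ sin f). Qed.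

Lemma der_cos f x l : has_der f x l ->
  has_der (fun t => cos (f t)) x (- sin (f x) * l).
Proof. by move=> fl; exact: (@is_derive1_comp _ cos f). Qed.

Lemma der_cont f x l : has_der f x l -> {for x, continuous f}.
Proof.
by move=> [fl _]; apply: differentiable_continuous; exact/derivable1_diffP.
Qed.

Lemma cont_cst a : continuous (fun _ : R => a).
Proof. by move=> x; exact: cvg_cst. Qed.

Lemma cont_id : continuous (fun t : R => t).
Proof. by move=> x; exact: cvg_id. Qed.

Lemma contD f g : continuous f -> continuous g -> continuous (fun t => f t + g t).
Proof. by move=> cf cg x; apply: cvgD; [exact: cf|exact: cg]. Qed.

Lemma contN f : continuous f -> continuous (fun t => - f t).
Proof. by move=> cf x; apply: cvgN; exact: cf. Qed.

Lemma contM f g : continuous f -> continuous g -> continuous (fun t => f t * g t).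
Proof. by move=> cf cg x; apply: cvgM; [exact: cf|exact: cg]. Qed.

Lemma contX f n : continuous f -> continuous (fun t => f t ^+ n).
Proof.
move=> cf; elim: n => [|n ih]; first exact: cont_cst.
have -> : (fun t => f t ^+ n.+1) = (fun t => f t * f t ^+ n).
  by apply/funext => t; rewrite exprS.
exact: contM.
Qed.

Lemma contV f : (forall t, f t != 0) -> continuous f ->
  continuous (fun t => (f t)^-1).
Proof. by move=> f0 cf x; apply: cvgV => //; exact: cf. Qed.

Lemma cont_comp f g : continuous f -> continuous g -> continuous (fun t => f (g t)).
Proof. by move=> cf cg x; apply: (@continuous_comp _ _ _ g f); [exact: cg|exact: cf]. Qed.

Lemma cont_sin f : continuous f -> continuous (fun t => sin (f t)).
Proof. exact: (cont_comp (@continuous_sin R)). Qed.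

Lemma cont_cos f : continuous f -> continuous (fun t => cos (f t)).
Proof. exact: (cont_comp (@continuous_cos R)). Qed.

Lemma cont_norm f : continuous f -> continuous (fun t => `|f t|).
Proof. by move=> cf x; apply: cvg_norm; exact: cf. Qed.

Lemma cont_max f g : continuous f -> continuous g ->
  continuous (fun t => Num.max (f t) (g t)).
Proof. by move=> cf cg x; apply: continuous_max; [exact: cf|exact: cg]. Qed.

Lemma cont_min f g : continuous f -> continuous g ->
  continuous (fun t => Num.min (f t) (g t)).
Proof. by move=> cf cg x; apply: continuous_min; [exact: cf|exact: cg]. Qed.

Lemma cont_within f (A : set R) : continuous f -> {within A, continuous f}.
Proof. exact: continuous_subspaceT. Qed.

Lemma lipschitz_cont f (k : R) :
  (forall x y, `|f x - f y| <= k * `|x - y|) -> continuous f.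
Proof.
move=> fk x; apply/cvgrPdist_le => e e0.
have k1 : 0 < `|k| + 1 by rewrite ltr_wpDl.
near=> y.
apply: (le_trans (fk x y)); apply: (@le_trans _ _ ((`|k| + 1) * `|x - y|)).
  by rewrite ler_wpM2r// (le_trans (ler_norm k))// lerDl.
rewrite mulrC -ler_pdivlMr//; near: y.
by apply: (@cvgr_dist_le _ _ _ (nbhs x) _ idfun x) => //; rewrite divr_gt0.
Unshelve. all: by end_near. Qed.

Lemma cont_integrable f a b : continuous f -> mu.-integrable `[a, b] (EFin \o f).
Proof.
by move=> cf; apply: continuous_compact_integrable;
  [exact: segment_compact|exact: cont_within].
Qed.

Lemma itg_ext f g a b : (forall t, a <= t <= b -> f t = g t) -> itg a b f = itg a b g.
Proof.
move=> fg; apply: eq_Rintegral => t; rewrite inE/= in_itv/=; exact: fg.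
Qed.

Lemma itgD f g a b : continuous f -> continuous g ->
  itg a b (fun t => f t + g t) = itg a b f + itg a b g.
Proof. by move=> cf cg; apply: RintegralD => //; exact: cont_integrable. Qed.

Lemma itgZ f k a b : continuous f -> itg a b (fun t => k * f t) = k * itg a b f.
Proof. by move=> cf; apply: RintegralZl => //; exact: cont_integrable. Qed.

Lemma itgN f a b : continuous f -> itg a b (fun t => - f t) = - itg a b f.
Proof.
by move=> cf; rewrite -mulN1r -itgZ//; apply: itg_ext => t _; rewrite mulN1r.
Qed.

Lemma itgB f g a b : continuous f -> continuous g ->
  itg a b (fun t => f t - g t) = itg a b f - itg a b g.
Proof. by move=> cf cg; apply: RintegralB => //; exact: cont_integrable. Qed.

Lemma itg_le f g a b : continuous f -> continuous g ->
  (forall t, a <= t <= b -> f t <= g t) -> itg a b f <= itg a b g.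
Proof.
move=> cf cg fg; rewrite /itg; apply: (@le_Rintegral _ _ _ mu).
- by [].
- exact: cont_integrable.
- exact: cont_integrable.
- by move=> t /=; rewrite in_itv/=; exact: fg.
Qed.

Lemma itg_ge0 f a b : (forall t, a <= t <= b -> 0 <= f t) -> 0 <= itg a b f.
Proof. by move=> f0; apply: Rintegral_ge0 => t /=; rewrite in_itv/=; exact: f0. Qed.

Lemma itg_cst k a b : a <= b -> itg a b (fun _ => k) = k * (b - a).
Proof.
move=> ab; rewrite /itg Rintegral_cst//.
move: ab; have -> : fine (mu `[a, b]%classic) = if a < b then b - a else 0.
  by rewrite lebesgue_measure_itv/= lte_fin; case: ifP.
by case: ltgtP => // -> _; rewrite subrr.
Qed.

Lemma itg_norm_le f k a b : a <= b -> continuous f ->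
  (forall t, a <= t <= b -> `|f t| <= k) -> `|itg a b f| <= k * (b - a).
Proof.
move=> ab cf fk; rewrite -itg_cst// ler_norml -itgN; last exact: cont_cst.
apply/andP; split; apply: itg_le => //; try exact: cont_cst.
- by move=> t /fk; rewrite ler_norml => /andP[].
- by move=> t /fk; rewrite ler_norml => /andP[].
Qed.

Lemma itg_point f a : itg a a f = 0.
Proof. by rewrite /itg set_itv1 Rintegral_set1. Qed.

Lemma itg_split f c a b : a <= c <= b -> continuous f ->
  itg a b f = itg a c f + itg c b f.
Proof.
move=> /andP[ac cb] cf; have := @Rintegral_itvB R f (BLeft a) (BRight b) c.
move=> /(_ (cont_integrable _ _ cf)); rewrite !bnd_simp => /(_ ac cb) E.
rewrite /itg -(@Rintegral_itv_obnd_cbnd R c (BRight b)); first by rewrite -E addrC subrK.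
apply: integrableS (cont_integrable c b cf) => //.
by apply: subset_itvr; rewrite bnd_simp.
Qed.

Lemma FTC f F a b : a <= b -> continuous f -> continuous F ->
  (forall t, a < t < b -> has_der F t (f t)) -> itg a b f = F b - F a.
Proof.
rewrite le_eqVlt => /predU1P[<-|ab] cf cF dF.
  by rewrite itg_point subrr.
rewrite /itg /Rintegral (@continuous_FTC2 _ f F)//.
- exact: cont_within.
- split=> [t|/=|/=].
  + by rewrite in_itv/= => /dF[].
  + by apply: cvg_at_right_filter; exact: cF.
  + by apply: cvg_at_left_filter; exact: cF.
- by move=> t; rewrite in_itv/= derive1E => /dF[].
Qed.

Lemma primitive f : continuous f -> exists F : R -> R,
  [/\ continuous F, F 0 = 0 & forall t, 0 < t -> has_der F t (f t)].
Proof.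
(* The base point [-1] makes [0] interior, so [P] is differentiable there; freezing it at [P 0] for
   negative arguments gives a function continuous on the whole line. *)
move=> cf; pose P x := itg (-1) x f.
have dP x : -1 < x -> has_der P x (f x).
  move=> x1; have [] := @continuous_FTC1_closed R f (-1) x (x + 1).
  - by rewrite ltrDl.
  - exact: cont_integrable.
  - exact: x1.
  - exact: cf.
  by move=> dP vP; apply: (DeriveDef dP); rewrite -derive1E.
pose F t := P (Num.max t 0) - P 0.
exists F; split.
- apply: contD; last exact: cont_cst.
  move=> x; apply: (@continuous_comp _ _ _ (fun t => Num.max t 0) P).
    by apply: cont_max; [exact: cont_id|exact: cont_cst].
  apply: der_cont (dP _ _).
  by rewrite lt_max orbC ltrN10.
- by rewrite /F maxxx subrr.
- move=> t t0; have -> : f t = f t + 0 by rewrite addr0.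
  apply: (@derD (fun t => P (Num.max t 0)) (fun _ => - P 0)); last exact: der_cst.
  have := dP t (lt_trans (ltrN10 _) t0).
  move=> dPt; have E : \forall s \near t, P s = P (Num.max s 0).
    near=> s; congr P; apply/esym/max_l/ltW; near: s; exact: lt_nbhsr.
  exact: near_eq_is_derive E dPt.
Unshelve. all: by end_near. Qed.

Lemma cont_in_within f a b : (forall t, a <= t <= b -> {for t, continuous f}) ->
  {within `[a, b], continuous f}.
Proof.
move=> cf; apply: continuous_in_subspaceT => t; rewrite inE/= in_itv/=; exact: cf.
Qed.

(** The exceptional point [m] admits a singular derivative: in Jacobi's identity it is the zero of
    the denominator. Continuity across [m] lets the mean value theorem act on each side. *)
Lemma nondecr_except f df m a b : a <= b -> {within `[a, b], continuous f} ->
  (forall t, a < t < b -> t != m -> has_der f t (df t)) ->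
  (forall t, a < t < b -> t != m -> 0 <= df t) -> f a <= f b.
Proof.
have aux c d : c <= d -> {within `[c, d], continuous f} ->
    (forall t, c < t < d -> has_der f t (df t)) ->
    (forall t, c < t < d -> 0 <= df t) -> f c <= f d.
  rewrite le_eqVlt => /predU1P[-> //|cd] cf dF d0.
  have dF' t : t \in `]c, d[ -> is_derive t 1 f (df t) by rewrite in_itv/=; move/dF.
  have [s] := MVT cd dF' cf.
  rewrite in_itv/= => /d0 ds; rewrite -subr_ge0 => ->.
  by rewrite mulr_ge0// subr_ge0 ltW.
move=> ab cf dF d0; case: (boolP (a < m < b)) => [/andP[am mb]|nm].
  apply: (@le_trans _ _ (f m)); apply: aux; try exact: ltW.
  - by apply: continuous_subspaceW cf; apply: subset_itvl; rewrite bnd_simp ltW.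
  - move=> t /andP[at_ tm]; apply: dF; last by rewrite lt_eqF.
    by rewrite at_ (lt_trans tm).
  - move=> t /andP[at_ tm]; apply: d0; last by rewrite lt_eqF.
    by rewrite at_ (lt_trans tm).
  - by apply: continuous_subspaceW cf; apply: subset_itvr; rewrite bnd_simp ltW.
  - move=> t /andP[mt tb]; apply: dF; last by rewrite gt_eqF.
    by rewrite tb (lt_trans am).
  - move=> t /andP[mt tb]; apply: d0; last by rewrite gt_eqF.
    by rewrite tb (lt_trans am).
apply: aux => // t tab; [apply: dF|apply: d0] => //;
  by apply: contra nm => /eqP <-.
Qed.

Lemma itg_gt0 f a b c : a < c < b -> continuous f ->
  (forall t, a <= t <= b -> 0 <= f t) -> 0 < f c -> 0 < itg a b f.
Proof.
move=> /andP[ac cb] cf f0 fc.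
have /cvgrPdist_lt/(_ _ (divr_gt0 fc (ltr0n _ 2))) := cf c.
move=> /nbhs_ballP[d /= d0 fd].
pose r := Num.min (d / 2) (b - c).
have r0 : 0 < r by rewrite lt_min divr_gt0// subr_gt0.
have rd : r < d.
  rewrite gt_min; apply/orP; left.
  by rewrite ltr_pdivrMr// ltr_pMr// ltr1n.
have rb : c + r <= b by rewrite -lerBrDl ge_min lexx orbT.
clearbody r.
rewrite (@itg_split f c)// ?(ltW ac) ?(ltW cb)//.
rewrite (@itg_split f (c + r) c b) ?lerDl ?(ltW r0)//.
apply: ltr_wpDl.
  by apply: itg_ge0 => t /andP[at_ tc]; apply: f0; rewrite at_ (le_trans tc)// ltW.
apply: ltr_pwDl; last first.
  apply: itg_ge0 => t /andP[ct tb]; apply: f0; rewrite tb andbT.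
  by rewrite (le_trans _ ct)// (le_trans (ltW ac))// lerDl ltW.
apply: (@lt_le_trans _ _ (itg c (c + r) (fun _ => f c / 2))).
  by rewrite itg_cst ?lerDl ?(ltW r0)// addrAC subrr add0r mulr_gt0// divr_gt0.
apply: itg_le => //; first exact: cont_cst.
move=> t /andP[ct tr]; have /fd : ball c d t.
  by rewrite /ball/= ler0_norm ?subr_le0//; lra.
by rewrite /= ltr_norml => /andP[_]; lra.
Qed.

End Calculus.

(* [refine] without type class resolution, so that the shape of the derivative
   is the one given by the rules above and not by library instances. *)
Ltac der :=
  lazymatch goal with
  | |- has_der (fun _ => ?a) _ _ => exact: der_cst
  | |- has_der (fun t => @?f t + @?g t) _ _ =>
      notypeclasses refine (@derD _ f g _ _ _ _ _); [der|der]
  | |- has_der (fun t => - (@?f t)) _ _ =>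
      notypeclasses refine (@derN _ f _ _ _); der
  | |- has_der (fun t => @?f t * @?g t) _ _ =>
      notypeclasses refine (@derM _ f g _ _ _ _ _); [der|der]
  | |- has_der (fun t => (@?f t) ^+ 2) _ _ =>
      notypeclasses refine (@derX _ f _ _ _); der
  | |- has_der (fun t => (@?f t)^-1) _ _ =>
      notypeclasses refine (@derV _ f _ _ _ _); [|der]
  | |- has_der (fun t => sin (@?f t)) _ _ =>
      notypeclasses refine (@der_sin _ f _ _ _); der
  | |- has_der (fun t => cos (@?f t)) _ _ =>
      notypeclasses refine (@der_cos _ f _ _ _); der
  | |- has_der (fun t => t) _ _ => exact: der_id
  | |- _ => eassumption
  end.

Ltac cont :=
  lazymatch goal with
  | |- continuous (fun _ => ?a) => exact: cont_cst
  | |- continuous (fun t => @?f t + @?g t) => apply: (@contD _ f g); [cont|cont]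
  | |- continuous (fun t => - (@?f t)) => apply: (@contN _ f); cont
  | |- continuous (fun t => @?f t * @?g t) => apply: (@contM _ f g); [cont|cont]
  | |- continuous (fun t => (@?f t) ^+ ?n) => apply: (@contX _ f n); cont
  | |- continuous (fun t => (@?f t)^-1) => apply: (@contV _ f); [|cont]
  | |- continuous (fun t => sin (@?f t)) => apply: (@cont_sin _ f); cont
  | |- continuous (fun t => cos (@?f t)) => apply: (@cont_cos _ f); cont
  | |- continuous (fun t => `|@?f t|) => apply: (@cont_norm _ f); cont
  | |- continuous (fun t => t) => exact: cont_id
  | |- _ => try by []
  end.

(** * The antiperiodic Green operator *)

Section GreenOperator.
Variable R : realType.
Implicit Types (p r h : R -> R) (l t s : R).

(** For [t] and [s] in the period, [t - s] lies in [[-2 pi, 2 pi]]. There this even function solves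
    [g'' = - l^2 g] off [0], its slope drops by [1] at [0], and [g (t - 2 pi) = - g t] for
    [0 <= t <= 2 pi]. The factor [cos (l * pi)] vanishes exactly at the resonances [l] in
    [1/2 + Z]. *)
Definition green l t : R := sin (l * (pi - `|t|)) / (2 * l * cos (l * pi)).

Definition Green l h t : R := itg 0 (2 * pi) (fun s => green l (t - s) * h s).

Lemma twopi_gt0 : 0 < 2 * pi :> R.
Proof. by rewrite mulr_gt0// pi_gt0. Qed.

Lemma twopi_ge0 : 0 <= 2 * pi :> R.
Proof. exact/ltW/twopi_gt0. Qed.

Lemma cont_green l : continuous (fun t : R => green l t).
Proof. by rewrite /green; cont. Qed.

(** Two integrations by parts; with [w ^+ 2 = l ^+ 2] the integrals of [p] cancel. The phase [c] and
    the sign of [w] are free so that both branches of the Green kernel are covered. *)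
Lemma itg_sin_ode p r h l w c a b : a <= b -> w ^+ 2 = l ^+ 2 ->
  continuous p -> continuous r -> continuous h ->
  (forall s, a < s < b -> has_der p s (r s)) ->
  (forall s, a < s < b -> has_der r s (- l ^+ 2 * p s - h s)) ->
  itg a b (fun s => sin (c + w * s) * h s) =
    (r a * sin (c + w * a) - w * p a * cos (c + w * a))
    - (r b * sin (c + w * b) - w * p b * cos (c + w * b)).
Proof.
move=> ab wl cp cr ch dp dr.
pose F s := - (r s * sin (c + w * s) - w * p s * cos (c + w * s)).
have -> : itg a b (fun s => sin (c + w * s) * h s) = F b - F a.
  apply: FTC => //; [cont|by rewrite /F; cont|] => s sab.
  have dps := dp _ sab; have drs := dr _ sab.
  by apply: der_eq; [rewrite /F; der|rewrite -wl; ring].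
by rewrite /F; ring.
Qed.

(** Separate derivatives [r1] and [r2] on the two sides allow a corner at [t0], which acts as a
    point source of mass [r1 t0 - r2 t0]. Boundary terms at [0] and [2 pi] cancel by
    antiperiodicity; those at [t] reproduce [p t]. *)
Lemma green_repr_kink p r1 r2 h l t0 t : l != 0 -> cos (l * pi) != 0 ->
  continuous p -> continuous r1 -> continuous r2 -> continuous h ->
  0 <= t0 <= 2 * pi ->
  (forall s, 0 < s < t0 -> has_der p s (r1 s)) ->
  (forall s, 0 < s < t0 -> has_der r1 s (- l ^+ 2 * p s - h s)) ->
  (forall s, t0 < s < 2 * pi -> has_der p s (r2 s)) ->
  (forall s, t0 < s < 2 * pi -> has_der r2 s (- l ^+ 2 * p s - h s)) ->
  p (2 * pi) = - p 0 -> r2 (2 * pi) = - r1 0 ->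
  0 <= t <= 2 * pi ->
  p t = (r1 t0 - r2 t0) * green l (t - t0) + Green l h t.
Proof.
move=> l0 cl0 cp cr1 cr2 ch /andP[t00 t02] dp1 dr1 dp2 dr2 pA rA /andP[t_0 t_2].
pose D := 2 * l * cos (l * pi).
have D0 : D != 0 by rewrite !mulf_neq0// pnatr_eq0.
pose lt s := sin (l * (pi - t) + l * s).
pose rt s := sin (l * (pi + t) + (- l) * s).
have grt s : t <= s -> green l (t - s) = D^-1 * rt s.
  move=> ts; rewrite /green ler0_norm ?subr_le0// mulrC; congr (_ * sin _); ring.
have glt s : s <= t -> green l (t - s) = D^-1 * lt s.
  move=> st; rewrite /green ger0_norm ?subr_ge0// mulrC; congr (_ * sin _); ring.
have ckh : continuous (fun s => green l (t - s) * h s).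
  by apply: contM => //; apply: (@cont_comp _ _ (fun s => t - s) (@cont_green l)); cont.
have left a b : a <= b -> b <= t ->
    itg a b (fun s => green l (t - s) * h s) = D^-1 * itg a b (fun s => lt s * h s).
  move=> ab bt; rewrite -itgZ; last by rewrite /lt; cont.
  by apply: itg_ext => s /andP[_ sb]; rewrite glt ?mulrA// (le_trans sb).
have right a b : a <= b -> t <= a ->
    itg a b (fun s => green l (t - s) * h s) = D^-1 * itg a b (fun s => rt s * h s).
  move=> ab bt; rewrite -itgZ; last by rewrite /rt; cont.
  by apply: itg_ext => s /andP[sa _]; rewrite grt ?mulrA// (le_trans bt).
have ll : (- l) ^+ 2 = l ^+ 2 by rewrite sqrrN.
rewrite /Green.
have E2 : sin (l * (pi + t) + (- l) * (2 * pi)) = - sin (l * (pi - t)).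
  by rewrite -sinN; congr sin; ring.
have E3 : cos (l * (pi + t) + (- l) * (2 * pi)) = cos (l * (pi - t)).
  by rewrite -cosN; congr cos; ring.
have E4 : l * (pi - t) + l * t = l * pi by ring.
have E5 : l * (pi + t) + (- l) * t = l * pi by ring.
(* The points [t] and [t0] cut the period into three pieces, on each of which the branch of the
   kernel and the derivative of [p] are both fixed. *)
have [tt0|/ltW tt0] := leP t t0.
  rewrite (@itg_split _ _ t)// ?t_0// (@itg_split _ _ t0 t)// ?tt0//.
  rewrite left// right// right// grt//.
  rewrite (@itg_sin_ode p r1 h l l)//; first last.
  - by move=> s /andP[s0 st]; apply: dr1; rewrite s0 (lt_le_trans st).
  - by move=> s /andP[s0 st]; apply: dp1; rewrite s0 (lt_le_trans st).
  rewrite (@itg_sin_ode p r1 h l (- l))//; first last.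
  - by move=> s /andP[s0 st]; apply: dr1; rewrite st (le_lt_trans _ s0).
  - by move=> s /andP[s0 st]; apply: dp1; rewrite st (le_lt_trans _ s0).
  rewrite (@itg_sin_ode p r2 h l (- l))// rA pA E2 E3 E4 E5 !mulr0 !addr0.
  by rewrite /rt /D; field; rewrite cl0 l0.
rewrite (@itg_split _ _ t0)// ?t00// (@itg_split _ _ t t0)// ?tt0//.
rewrite left// left// right// glt//.
rewrite (@itg_sin_ode p r1 h l l)//.
rewrite (@itg_sin_ode p r2 h l l)//; first last.
- by move=> s /andP[s0 st]; apply: dr2; rewrite s0 (lt_le_trans st).
- by move=> s /andP[s0 st]; apply: dp2; rewrite s0 (lt_le_trans st).
rewrite (@itg_sin_ode p r2 h l (- l))//; first last.
- by move=> s /andP[s0 st]; apply: dr2; rewrite st (le_lt_trans _ s0).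
- by move=> s /andP[s0 st]; apply: dp2; rewrite st (le_lt_trans _ s0).
rewrite rA pA E2 E3 E4 E5 !mulr0 !addr0.
by rewrite /lt /D; field; rewrite cl0 l0.
Qed.

(* [p] is an antiperiodic solution of [- p'' - l^2 p = h], with [p' = r]. *)
Definition antiper_sol l h p r : Prop :=
  [/\ continuous p, continuous r,
      (forall s, 0 < s < 2 * pi -> has_der p s (r s)),
      (forall s, 0 < s < 2 * pi -> has_der r s (- l ^+ 2 * p s - h s)) &
      p (2 * pi) = - p 0 /\ r (2 * pi) = - r 0].

Lemma green_repr p r h l t : l != 0 -> cos (l * pi) != 0 -> continuous h ->
  antiper_sol l h p r -> 0 <= t <= 2 * pi -> p t = Green l h t.
Proof.
move=> l0 cl0 ch [cp cr dp dr [pA rA]] t02.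
rewrite (@green_repr_kink p r r h l 0)//.
- by rewrite subrr mul0r add0r.
- by rewrite lexx twopi_ge0.
- by move=> s /andP[s0 /(lt_trans s0)]; rewrite ltxx.
- by move=> s /andP[s0 /(lt_trans s0)]; rewrite ltxx.
Qed.

(** Variation of constants: [C] and [S] give a particular solution [p0] with derivative [r0], and a
    homogeneous part corrects its boundary values. The system for [A] and [B] has determinant
    [(1 + c)^2 + d^2 = 2 (1 + c)], nonzero because [1 + c = 2 cos^2 (l pi)]. *)
Lemma antiper_solvable h l : l != 0 -> cos (l * pi) != 0 -> continuous h ->
  exists p r, antiper_sol l h p r.
Proof.
move=> l0 cl0 ch.
have [|C [cC C0 dC]] := @primitive _ (fun s => cos (l * s) * h s); first by cont.
have [|S [cS S0 dS]] := @primitive _ (fun s => sin (l * s) * h s); first by cont.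
pose c := cos (l * (2 * pi)); pose d := sin (l * (2 * pi)).
pose p0 t : R := - (sin (l * t) * C t - cos (l * t) * S t) / l.
pose r0 t : R := - (cos (l * t) * C t + sin (l * t) * S t).
pose P : R := p0 (2 * pi); pose Q : R := r0 (2 * pi) / l.
have c1 : 1 + c != 0.
  have -> : 1 + c = 2 * cos (l * pi) ^+ 2.
    by rewrite /c (_ : l * (2 * pi) = (l * pi) *+ 2) ?cos_mulr2n; [ring|ring].
  by rewrite mulf_neq0 ?expf_neq0// pnatr_eq0.
have cd : c ^+ 2 + d ^+ 2 = 1 by exact: cos2Dsin2.
have d2 : d ^+ 2 = (1 + c) * (1 - c) by lra.
pose A : R := (- P * (1 + c) + Q * d) / (2 * (1 + c)).
pose B : R := (- Q * (1 + c) - P * d) / (2 * (1 + c)).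
have EA : A * (1 + c) + B * d + P = 0.
  have -> : A * (1 + c) + B * d + P =
    (P * ((1 + c) * (1 - c) - d ^+ 2)) / (2 * (1 + c)) by rewrite /A /B; field.
  by rewrite d2 subrr mulr0 mul0r.
have EB : - A * d + B * (1 + c) + Q = 0.
  have -> : - A * d + B * (1 + c) + Q =
    (Q * ((1 + c) * (1 - c) - d ^+ 2)) / (2 * (1 + c)) by rewrite /A /B; field.
  by rewrite d2 subrr mulr0 mul0r.
clearbody A B.
exists (fun t => A * cos (l * t) + B * sin (l * t) + p0 t).
exists (fun t => - l * A * sin (l * t) + l * B * cos (l * t) + r0 t).
split.
- by rewrite /p0; cont.
- by rewrite /r0; cont.
- move=> s /andP[s0 _]; have dCs := dC _ s0; have dSs := dS _ s0.
  by apply: der_eq; [rewrite /p0; der|rewrite /r0; field].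
- move=> s /andP[s0 _]; have dCs := dC _ s0; have dSs := dS _ s0.
  apply: der_eq; [rewrite /r0; der|rewrite /p0].
  transitivity (- l ^+ 2 * (A * cos (l * s) + B * sin (l * s) +
      - (sin (l * s) * C s - cos (l * s) * S s) / l)
    - (cos (l * s) ^+ 2 + sin (l * s) ^+ 2) * h s); first by field.
  by rewrite cos2Dsin2 mul1r.
- rewrite !mulr0 cos0 sin0 [p0 0]/p0 [r0 0]/r0 !mulr0 C0 S0 -/c -/d -/P.
  have -> : r0 (2 * pi) = Q * l by rewrite /Q divfK.
  split.
  + have -> : A * c + B * d + P = - A + (A * (1 + c) + B * d + P) by ring.
    by rewrite EA; ring.
  + have -> : - l * A * d + l * B * c + Q * l
        = - (l * B) + l * (- A * d + B * (1 + c) + Q) by ring.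
    by rewrite EB; ring.
Qed.

End GreenOperator.

(** * Fourier expansion of the Green kernel *)

Section GreenFourier.
Variable R : realType.
Implicit Types (t s : R) (k n m : nat).

Lemma mvt_bound (f df : R -> R) (M a b : R) : a <= b ->
  (forall t, a <= t <= b -> has_der f t (df t)) ->
  (forall t, a <= t <= b -> `|df t| <= M) -> `|f b - f a| <= M * (b - a).
Proof.
move=> ab dF dM.
have dF' t : t \in `]a, b[ -> is_derive t 1 f (df t).
  by rewrite in_itv/= => /andP[at_ tb]; apply: dF; rewrite !ltW.
have cf : {within `[a, b], continuous f}.
  by apply: derivable_within_continuous => t; rewrite in_itv/= => /dF[].
have [s] := MVT_segment ab dF' cf.
rewrite in_itv/= => /dM ds ->.
by rewrite normrM [`|b - a|]ger0_norm ?subr_ge0// ler_wpM2r// subr_ge0.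
Qed.

Lemma le_of_inv_rate (x y c : R) : (forall n, x <= y + c / n.+1%:R) -> x <= y.
Proof.
move=> xy; apply/ler_addgt0Pr => e e0.
have [n cn] : exists n : nat, c / e < n.+1%:R.
  exists (Num.bound `|c / e|); apply: (le_lt_trans (ler_norm _)).
  by apply: (lt_trans (archi_boundP (normr_ge0 _))); rewrite ltr_nat.
apply: (le_trans (xy n)); rewrite lerD2l ler_pdivrMr ?ltr0n// mulrC -ler_pdivrMr//.
exact: ltW.
Qed.

Lemma cauchy_rate (u : nat -> R) (c : R) :
  (forall n m, `|u (n + m) - u n| <= c / n.+1%:R) ->
  exists b, forall n, `|u n - b| <= c / n.+1%:R.
Proof.
move=> uc.
have cu : cvg (u @ \oo).
  apply: cauchy_cvg; apply: cauchy_exP => e e0.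
  have [n cn] : exists n : nat, c / n.+1%:R < e.
    exists (Num.bound `|c / e|); rewrite ltr_pdivrMr ?ltr0n// mulrC -ltr_pdivrMr//.
    apply: (le_lt_trans (ler_norm _)).
    by apply: (lt_trans (archi_boundP (normr_ge0 _))); rewrite ltr_nat.
  exists (u n); exists n => // m /= nm; rewrite /ball/= distrC.
  by rewrite -(subnKC nm); exact: le_lt_trans (uc _ _) cn.
exists (lim (u @ \oo)) => n; apply/ler_addgt0Pr => e e0.
have /cvgrPdist_lt/(_ _ e0)[N _ Nu] := cu.
have := Nu (n + N)%N (leq_addl _ _); rewrite /= distrC => /ltW ub.
have -> : u n - lim (u @ \oo) = - (u (n + N)%N - u n) + (u (n + N)%N - lim (u @ \oo)).
  by ring.
by apply: (le_trans (ler_normD _ _)); rewrite normrN lerD.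
Qed.

Lemma cont_le_at0 (f : R -> R) (b c : R) : 0 < b -> continuous f ->
  (forall t, 0 < t <= b -> f t <= c) -> f 0 <= c.
Proof.
move=> b0 cf fc; rewrite leNgt; apply/negP => cf0.
have e0 : 0 < f 0 - c by rewrite subr_gt0.
have /cvgrPdist_lt/(_ _ e0)/nbhs_ballP[d /= d0 fd] := cf 0.
pose r := Num.min (d / 2) b.
have r0 : 0 < r by rewrite lt_min divr_gt0.
have rd : r < d.
  rewrite gt_min; apply/orP; left.
  by rewrite ltr_pdivrMr// ltr_pMr// ltr1n.
have /fc : 0 < r <= b by rewrite r0 ge_min lexx orbT.
have : ball 0 d r by rewrite /ball/= sub0r normrN gtr0_norm.
by move=> /fd/=; rewrite ltr_norml => /andP[_]; lra.
Qed.

(** * Half-integer cosine series of the Green kernel *)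

Definition kap k : R := k%:R + 2^-1.

Variable l : R.
Hypothesis l0 : 0 < l.
Hypothesis l1 : l <= 1.
Hypothesis l12 : l != 2^-1.

(** The eigenvalue of the antiperiodic Green operator at frequency [kap k]. *)
Definition gcoef k : R := (kap k ^+ 2 - l ^+ 2)^-1.

Definition gsum n t : R := \sum_(k < n) gcoef k * cos (kap k * t).
Definition dgsum n t : R := \sum_(k < n) - gcoef k * kap k * sin (kap k * t).

Lemma kap_gt0 k : 0 < kap k.
Proof. by rewrite /kap ltr_wpDl// invr_gt0. Qed.

Lemma gcoef_den0 k : kap k ^+ 2 - l ^+ 2 != 0.
Proof.
rewrite subr_eq0 eqf_sqr negb_or; apply/andP; split; last first.
  by rewrite gt_eqF// (@lt_trans _ _ 0) ?oppr_lt0// kap_gt0.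
case: k => [|k]; first by rewrite /kap add0r eq_sym.
rewrite gt_eqF// /kap -natr1; apply: (le_lt_trans l1).
by have := ler0n R k; lra.
Qed.

Lemma coslpi_neq0 : cos (l * pi) != 0.
Proof.
have p0 := @pi_gt0 R.
have [lt12|gt12|/eqP] := ltgtP l 2^-1; last by rewrite (negPf l12).
  rewrite gt_eqF// cos_gt0_pihalf//; apply/andP; split.
    by apply: lt_trans (mulr_gt0 l0 p0); rewrite oppr_lt0 divr_gt0.
  by rewrite mulrC ltr_pM2l.
have -> : l * pi = - (pi - l * pi) + pi by ring.
rewrite cosDpi oppr_eq0 cosN gt_eqF// cos_gt0_pihalf//.
apply/andP; split.
  apply: (@lt_le_trans _ _ 0); first by rewrite oppr_lt0 divr_gt0.
  by rewrite subr_ge0 ler_piMl// ltW.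
rewrite ltrBlDl -ltrBlDr; have -> : pi - pi / 2 = 2^-1 * pi :> R by field.
by rewrite ltr_pM2r.
Qed.

(** The telescoping majorant makes the tail of the series of order [1 / n], uniformly in [t]. The
    first coefficient is left out: it may be large and of either sign. *)
Lemma gcoef_bound k : `|gcoef k.+1| <= 2 * (k.+1%:R^-1 - k.+2%:R^-1).
Proof.
have kS : k.+1%:R = k%:R + 1 :> R by rewrite -natr1.
have kSS : k.+2%:R = k%:R + 2 :> R by rewrite -addn2 natrD.
have k0 := ler0n R k.
have l2 : l ^+ 2 <= 1 by rewrite expr_le1// ltW.
have -> : 2 * (k.+1%:R^-1 - k.+2%:R^-1) = (((k%:R + 1) * (k%:R + 2)) / 2)^-1 :> R.
  rewrite kS kSS; field.
  by rewrite !gt_eqF.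
have D : (k%:R + 1) * (k%:R + 2) / 2 <= kap k.+1 ^+ 2 - l ^+ 2.
  by rewrite /kap kS; nra.
have D0 : 0 < (k%:R + 1) * (k%:R + 2) / 2 :> R by nra.
have D1 := lt_le_trans D0 D.
by rewrite /gcoef normfV gtr0_norm// lef_pV2.
Qed.

Lemma gsum_tail n m t : `|gsum (n.+1 + m) t - gsum n.+1 t| <= 2 / n.+1%:R.
Proof.
suff : `|gsum (n.+1 + m) t - gsum n.+1 t| <= 2 * (n.+1%:R^-1 - (n.+1 + m)%:R^-1).
  move=> /le_trans; apply; rewrite ler_wpM2l// gerBl invr_ge0//.
elim: m => [|m ih]; first by rewrite addn0 !subrr normr0 mulr0.
rewrite addnS /gsum big_ord_recr/= -/(gsum _ _) addrAC.
apply: (le_trans (ler_normD _ _)).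
apply: (le_trans (lerD ih (_ : _ <= 2 * ((n.+1 + m)%:R^-1 - (n.+1 + m).+1%:R^-1)))).
  rewrite normrM; apply: (@le_trans _ _ `|gcoef (n.+1 + m)|).
    by rewrite ler_piMr// cos_max.
  by rewrite addSn; exact: gcoef_bound.
by rewrite -mulrDr addrA subrK.
Qed.

Lemma gsum_der n t : has_der (gsum n) t (dgsum n t).
Proof.
elim: n => [|n ih].
  rewrite /dgsum big_ord0; apply: der_ext (der_cst 0 t) _ => s.
  by rewrite /gsum big_ord0.
rewrite /dgsum big_ord_recr/= -/(dgsum _ _).
have E : (fun s => gsum n s + gcoef n * cos (kap n * s)) =1 gsum n.+1.
  by move=> s; rewrite {2}/gsum big_ord_recr.
apply: der_ext E; apply: der_eq; first by der.
by cbv beta; ring.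
Qed.

(** Since [kap^2 * gcoef = 1 + l^2 * gcoef], the partial sum solves the oscillator equation up to a
    Dirichlet sum. *)
Lemma dgsum_der n t : has_der (dgsum n) t
  (- l ^+ 2 * gsum n t - \sum_(k < n) cos (kap k * t)).
Proof.
elim: n => [|n ih].
  rewrite /gsum !big_ord0 mulr0 subrr; apply: der_ext (der_cst 0 t) _ => s.
  by rewrite /dgsum big_ord0.
rewrite /gsum !big_ord_recr/= -/(gsum _ _).
have E : (fun s => dgsum n s + - gcoef n * kap n * sin (kap n * s)) =1 dgsum n.+1.
  by move=> s; rewrite {2}/dgsum big_ord_recr.
apply: der_ext E; apply: der_eq; first by der.
have D := gcoef_den0 n.
by cbv beta; rewrite /gcoef; field.
Qed.

Lemma dirichlet n t : 2 * sin (t / 2) * \sum_(k < n) cos (kap k * t) = sin (n%:R * t).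
Proof.
elim: n => [|n ih]; first by rewrite big_ord0 mulr0 mul0r sin0.
rewrite big_ord_recr/= mulrDr ih.
have -> : n.+1%:R * t = kap n * t + t / 2.
  by rewrite /kap -natr1; field.
have -> : n%:R * t = kap n * t - t / 2 by rewrite /kap; field.
by rewrite !sinD cosN sinN; ring.
Qed.

Lemma gsum_pi n : gsum n pi = 0.
Proof.
rewrite /gsum big1// => k _; suff -> : cos (kap k * pi) = 0 by rewrite mulr0.
have -> : kap k * pi = pi / 2 + pi *+ k by rewrite /kap -mulr_natl; field.
by rewrite (alternatingn (@cosDpi R)) cos_pihalf mulr0.
Qed.

(** The equation [g'' = - l^2 g - D], with Dirichlet sum [D = sin (N s) / (2 sin (s / 2))], is
    integrated from [t] to [pi] against a solution of the homogeneous equation; integrating the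
    oscillating factor by parts gains [1 / N]. The constant depends on [t] because [1 / sin (s / 2)]
    blows up at [0]. *)
Lemma gsum_near_sin t : 0 < t <= pi -> exists2 C : R, 0 <= C &
  forall n, `|l * gsum n.+1 t - dgsum n.+1 pi * sin (l * (t - pi))| <= C / n.+1%:R.
Proof.
move=> /andP[t0 tpi].
pose phi s : R := (2 * sin (s / 2))^-1.
(* This phase makes [w t = 0] and the accompanying sine equal to [1], so that [al t] below is
   [l * gsum N t]; at [pi], where [gsum] vanishes, only the derivative term survives. *)
pose th : R := pi / 2 - l * (t - pi).
have hp : pi / 2 = pi * 2^-1 :> R by [].
have sin_le s : t <= s <= pi -> sin (t / 2) <= sin (s / 2).
  move=> /andP[ts sp]; have [->//|st] := eqVneq s t.
  have pp := @pi_gt0 R.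
  by apply: ltW; rewrite ltr_sin ?in_itv/= ?ltr_pM2r ?invr_gt0// ?lt_neqAle ?(eq_sym t) ?st//;
    apply/andP; split; lra.
have m0 : 0 < sin (t / 2) by apply: sin_gt0_pi; have pp := @pi_gt0 R; lra.
pose M : R := (2 * sin (t / 2))^-1.
have M0 : 0 < M by rewrite invr_gt0 mulr_gt0.
have s0 s : t <= s <= pi -> 0 < sin (s / 2).
  by move=> /sin_le; exact: lt_le_trans.
have phi0 u : t <= u <= pi -> 0 <= phi u.
  by move=> /s0 ss; rewrite invr_ge0 mulr_ge0// ltW.
have phiM s : t <= s <= pi -> phi s <= M.
  move=> ts; have ss := s0 _ ts.
  by rewrite /phi /M lef_pV2 ?posrE ?mulr_gt0// ler_pM2l// sin_le.
pose w (s : R) : R := cos (l * (s - pi) + th).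
pose dpsi (s : R) : R := - l * sin (l * (s - pi) + th) * phi s
   - w s * cos (s / 2) * phi s ^+ 2.
pose C : R := M + M + (l * M + M ^+ 2) * (pi - t).
have dpsiM : forall s, t <= s <= pi -> `|dpsi s| <= l * M + M ^+ 2.
  move=> s ts; rewrite /dpsi; apply: (le_trans (ler_normB _ _)); apply: lerD.
    rewrite !normrM normrN (gtr0_norm l0) [`|phi s|]ger0_norm ?phi0//.
    rewrite -mulrA ler_pM2l//; apply: le_trans (phiM _ ts).
    by rewrite ler_piMl ?phi0// sin_max.
  rewrite normrM; apply: (@le_trans _ _ `|phi s ^+ 2|).
    by rewrite ler_piMl// normrM mulr_ile1// cos_max.
  by rewrite ger0_norm ?sqr_ge0// lerXn2r ?nnegrE ?(phi0 _ ts) ?(ltW M0) ?phiM.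
exists C.
  have := sqr_ge0 M; have := mulr_gt0 l0 M0; rewrite /C => lM MM.
  apply: addr_ge0; first by rewrite addr_ge0 ?ltW.
  by rewrite mulr_ge0 ?subr_ge0// addr_ge0// ltW.
move=> n; set N := n.+1.
have N0 : 0 < N%:R :> R by rewrite ltr0n.
pose al (s : R) : R := dgsum N s * w s + l * gsum N s * sin (l * (s - pi) + th).
(* The subtracted term performs the integration by parts: its derivative cancels [al' = - w D] and
   leaves [- dpsi cos (N s) / N], where [dpsi = (w phi)']. *)
pose F (s : R) : R := al s - (w s * phi s) * cos (N%:R * s) / N%:R.
have dF s : t <= s <= pi -> has_der F s (- dpsi s * cos (N%:R * s) / N%:R).
  move=> ts; have dA := gsum_der N s; have ddA := dgsum_der N s.
  have sn0 := s0 _ ts.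
  have sn1 : 2 * sin (s / 2) != 0 by rewrite mulf_neq0 ?gt_eqF.
  apply: der_eq; first by rewrite /F /al /w /phi; der.
  have := dirichlet N s; set D := \sum_(k < N) _ => HD.
  have -> : D = sin (N%:R * s) / (2 * sin (s / 2)) by rewrite -HD mulrC mulKf.
  rewrite /dpsi /w /phi; field.
  by rewrite !gt_eqF.
have FF : `|F pi - F t| <= (l * M + M ^+ 2) / N%:R * (pi - t).
  apply: (mvt_bound tpi dF) => s ts; rewrite !normrM normrN normfV.
  rewrite [`|N%:R|]gtr0_norm// ler_pM2r ?invr_gt0//.
  by apply: le_trans (dpsiM _ ts); rewrite ler_piMr// cos_max.
have alE : al t = l * gsum N t.
  rewrite /al /w; have -> : l * (t - pi) + th = pi / 2 by rewrite /th; ring.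
  by rewrite cos_pihalf sin_pihalf mulr0 add0r mulr1.
have alpi : al pi = dgsum N pi * sin (l * (t - pi)).
  rewrite /al gsum_pi mulr0 mul0r addr0 /w subrr mulr0 add0r /th.
  by rewrite cosB cos_pihalf sin_pihalf mul0r add0r mul1r.
rewrite -alE -alpi.
have -> : al t - al pi = - (F pi - F t)
    + (w t * phi t * cos (N%:R * t) - w pi * phi pi * cos (N%:R * pi)) / N%:R.
  by rewrite /F; field; rewrite gt_eqF.
apply: (le_trans (ler_normD _ _)); rewrite normrN.
have wM s c : t <= s <= pi -> `|w s * phi s * cos c| <= M.
  move=> ts; rewrite !normrM [`|phi s|]ger0_norm ?phi0//.
  apply: le_trans (phiM _ ts); rewrite -mulrA mulrCA ler_piMr ?phi0//.
  by rewrite mulr_ile1// cos_max.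
have -> : C / N%:R = (l * M + M ^+ 2) / N%:R * (pi - t) + (M + M) / N%:R.
  by rewrite /C; field; rewrite gt_eqF.
apply: lerD => //.
rewrite normrM normfV [`|N%:R|]gtr0_norm// ler_pM2r ?invr_gt0//.
by apply: (le_trans (ler_normB _ _)); apply: lerD; apply: wM; rewrite lexx tpi.
Qed.


Lemma cont_gsum n : continuous (gsum n).
Proof. by move=> t; exact: der_cont (gsum_der n t). Qed.

(** * Identification of the limit of the cosine sums *)

Lemma itg_cos_half k : itg 0 pi (fun t => cos (kap k * t) * cos (t / 2)) =
  if k == 0%N then pi / 2 else 0.
Proof.
have pi0 := @pi_ge0 R.
case: k => [|k] /=.
  pose F t : R := t / 2 + sin t / 2.
  have -> : itg 0 pi (fun t => cos (kap 0 * t) * cos (t / 2)) = F pi - F 0.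
    apply: FTC => //; [by cont|by rewrite /F; cont|] => t _.
    apply: der_eq; first by rewrite /F; der.
    rewrite /kap add0r [2^-1 * t]mulrC.
    have -> : cos t = cos (t / 2) ^+ 2 - sin (t / 2) ^+ 2.
      by rewrite [in LHS](splitr t) cosD !expr2.
    by rewrite sin2cos2; field.
  by rewrite /F sinpi sin0; ring.
have kS : k.+1%:R = k%:R + 1 :> R by rewrite -natr1.
have k0 := ler0n R k.
pose F t : R := sin (k.+2%:R * t) / (2 * k.+2%:R) + sin (k.+1%:R * t) / (2 * k.+1%:R).
have -> : itg 0 pi (fun t => cos (kap k.+1 * t) * cos (t / 2)) = F pi - F 0.
  apply: FTC => //; [by cont|by rewrite /F; cont|] => t _.
  apply: der_eq; first by rewrite /F; der.
  have -> : k.+2%:R * t = kap k.+1 * t + t / 2 by rewrite /kap -[k.+2%:R]natr1; field.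
  have -> : k.+1%:R * t = kap k.+1 * t - t / 2 by rewrite /kap; field.
  by rewrite !cosD cosN sinN; field; rewrite !gt_eqF// ?kS//; lra.
have sk n : sin (n%:R * pi) = 0 :> R.
  by rewrite mulr_natl -[_ *+ n]add0r (alternatingn (@sinDpi R)) sin0 mulr0.
by rewrite /F !sk !mulr0 sin0 !mul0r subrr.
Qed.

(** Testing against [cos (t / 2)] sees only the term of index [0]; the same test applied to
    [sin (l (pi - t))] then fixes the constant in the limit. *)
Lemma itg_gsum_half n : itg 0 pi (fun t => gsum n.+1 t * cos (t / 2)) =
  gcoef 0 * (pi / 2).
Proof.
elim: n => [|n ih].
  transitivity (itg 0 pi (fun t => gcoef 0 * (cos (kap 0 * t) * cos (t / 2)))).
    by apply: itg_ext => t _; rewrite /gsum big_ord1 mulrA.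
  by rewrite itgZ ?itg_cos_half//; cont.
transitivity (itg 0 pi (fun t => gsum n.+1 t * cos (t / 2)
    + gcoef n.+1 * (cos (kap n.+1 * t) * cos (t / 2)))).
  by apply: itg_ext => t _; rewrite /gsum big_ord_recr/= mulrDl mulrA.
rewrite itgD ?itgZ ?itg_cos_half ?ih ?mulr0 ?addr0//; cont; exact: cont_gsum.
Qed.

Lemma itg_sin_half : itg 0 pi (fun t => sin (l * (pi - t)) * cos (t / 2)) =
  l * cos (l * pi) * gcoef 0.
Proof.
have D := gcoef_den0 0.
have l2 : l + 2^-1 != 0 by rewrite gt_eqF// addr_gt0.
have l3 : l - 2^-1 != 0 by rewrite subr_eq0.
pose F t : R := cos (l * (pi - t) - t / 2) / (2 * (l + 2^-1)) +
  cos (l * (pi - t) + t / 2) / (2 * (l - 2^-1)).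
have -> : itg 0 pi (fun t => sin (l * (pi - t)) * cos (t / 2)) = F pi - F 0.
  apply: FTC; [exact: pi_ge0|by cont|by rewrite /F; cont|] => t _.
  apply: der_eq; first by rewrite /F; der.
  rewrite !sinD cosN sinN; field.
  by apply/andP; split; apply: contra_neq l3 || apply: contra_neq l2; lra.
rewrite /F subrr mulr0 sub0r add0r cosN cos_pihalf !mul0r !subr0 !addr0.
rewrite /gcoef; move: D; rewrite /kap add0r => D; field.
apply/and3P; split.
- by apply: contra_neq D; lra.
- by apply: contra_neq l3; lra.
- by apply: contra_neq l2; lra.
Qed.

(** The unknown slope [dgsum pi] is eliminated between [t] and the reference point [pi / 2], where
    the sums have a limit [b]. The resulting rate depends on [t]; the uniform tail bound upgrades it
    to [2 / n.+1]. *)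
Lemma gsum_cvg_sin : exists a : R, forall t, 0 < t <= pi -> forall n,
  `|gsum n.+1 t - a * sin (l * (pi - t))| <= 2 / n.+1%:R.
Proof.
have [b hb] := cauchy_rate (fun n m => @gsum_tail n m (pi / 2)).
have pi0 := @pi_gt0 R.
have sg0 : 0 < sin (l * (pi / 2)).
  apply: sin_gt0_pi; rewrite mulr_gt0 ?divr_gt0//=.
  apply: (@le_lt_trans _ _ (pi / 2)); last by lra.
  by rewrite ler_piMl// ltW// divr_gt0.
exists (b / sin (l * (pi / 2))) => t tpi n.
have [C1 C10 h1] := gsum_near_sin tpi.
have [|C2 C20 h2] := @gsum_near_sin (pi / 2); first by rewrite divr_gt0//=; lra.
set sg := sin (l * (pi / 2)) in sg0 *.
have sE : sin (l * (pi / 2 - pi)) = - sg by rewrite -sinN; congr sin; field.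
have stE : sin (l * (t - pi)) = - sin (l * (pi - t)) by rewrite -sinN; congr sin; ring.
set st := sin (l * (pi - t)) in stE *.
have st1 : `|st| <= 1 by exact: sin_max.
have sg1 : `|sg| <= 1 by exact: sin_max.
have key N : `|gsum N.+1 t - b / sg * st| <= ((C1 + C2) / l + 2) / sg / N.+1%:R.
  have -> : gsum N.+1 t - b / sg * st =
    ((l * gsum N.+1 t - dgsum N.+1 pi * sin (l * (t - pi))) * sg / l
    - (l * gsum N.+1 (pi / 2) - dgsum N.+1 pi * sin (l * (pi / 2 - pi))) * st / l
    + (gsum N.+1 (pi / 2) - b) * st) / sg.
    by rewrite sE stE; field; rewrite !gt_eqF.
  rewrite normrM normfV (gtr0_norm sg0) [leRHS]mulrAC ler_pM2r ?invr_gt0//.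
  have -> : ((C1 + C2) / l + 2) / N.+1%:R = C1 / N.+1%:R / l + C2 / N.+1%:R / l + 2 / N.+1%:R.
    by field; rewrite gt_eqF ?ltr0n// gt_eqF.
  apply: (le_trans (ler_normD _ _)); apply: lerD; last first.
    by rewrite normrM; apply: le_trans (hb N); rewrite ler_piMr.
  apply: (le_trans (ler_normB _ _)); apply: lerD;
    rewrite !normrM normfV (gtr0_norm l0) ler_pM2r ?invr_gt0//.
    by apply: le_trans (h1 N); rewrite ler_piMr.
  by apply: le_trans (h2 N); rewrite ler_piMr.
apply: (@le_of_inv_rate _ _ (((C1 + C2) / l + 2) / sg)) => m.
have -> : gsum n.+1 t - b / sg * st =
  - (gsum (n.+1 + m) t - gsum n.+1 t) + (gsum (n + m).+1 t - b / sg * st).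
  by rewrite addSn; ring.
apply: (le_trans (ler_normD _ _)); rewrite normrN lerD ?gsum_tail//.
apply: (le_trans (key _)); rewrite ler_wpM2l//.
  by rewrite divr_ge0 ?(ltW sg0)// addr_ge0// divr_ge0 ?(ltW l0)// addr_ge0.
by rewrite lef_pV2 ?posrE ?ltr0n// ler_nat ltnS leq_addl.
Qed.

Lemma gsum_cvg_green0 t n : 0 <= t <= pi ->
  `|gsum n.+1 t - pi * green l t| <= 2 / n.+1%:R.
Proof.
have [a ha] := gsum_cvg_sin.
have pi0 := @pi_gt0 R.
(* The rate being independent of [s], continuity carries the estimate to the endpoint [0]. *)
have ha' m s : 0 <= s <= pi -> `|gsum m.+1 s - a * sin (l * (pi - s))| <= 2 / m.+1%:R.
  rewrite le_eqVlt => /andP[/predU1P[<- _|s0 sp]]; last by apply: ha; rewrite s0.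
  apply: (@cont_le_at0 (fun s => `|gsum m.+1 s - a * sin (l * (pi - s))|) pi) => //.
  - by cont; exact: cont_gsum.
  - by move=> u up; exact: ha.
have aE : a * (l * cos (l * pi)) = pi / 2.
  have g0 : gcoef 0 != 0 by rewrite invr_neq0// gcoef_den0.
  apply: (mulIf g0); apply/eqP; rewrite -subr_eq0 -normr_le0; apply: (@le_of_inv_rate _ _ (2 * pi)) => m.
  have -> : a * (l * cos (l * pi)) * gcoef 0 - pi / 2 * gcoef 0 =
    - itg 0 pi (fun s => (gsum m.+1 s - a * sin (l * (pi - s))) * cos (s / 2)).
    transitivity (- itg 0 pi (fun s => gsum m.+1 s * cos (s / 2)
        - a * (sin (l * (pi - s)) * cos (s / 2)))); last first.
      by congr (- _); apply: itg_ext => s _; ring.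
    rewrite itgB; [|by cont; exact: cont_gsum|by cont].
    by rewrite itgZ; [rewrite itg_gsum_half itg_sin_half; ring|cont].
  rewrite normrN add0r mulrAC -[X in _ * X]subr0; apply: itg_norm_le; first exact: ltW.
  - by cont; exact: cont_gsum.
  - move=> s sp; rewrite normrM; apply: le_trans (ha' m s sp).
    by rewrite ler_piMr// cos_max.
move=> tp; have := ha' n t tp; congr (`|_ - _| <= _).
have cl := coslpi_neq0.
rewrite /green ger0_norm; last by case/andP: tp.
have -> : a = pi / 2 / (l * cos (l * pi)) by rewrite -aE mulfK// mulf_neq0// gt_eqF.
by field; rewrite cl gt_eqF.
Qed.

(** Both functions are even and change sign under [t -> 2 pi - t], which reduces everything to
    [[0, pi]]. *)
Lemma gsum_cvg_green t n : `|t| <= 2 * pi ->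
  `|gsum n.+1 t - pi * green l t| <= 2 / n.+1%:R.
Proof.
wlog t0 : t / 0 <= t.
  move=> wl; have [|t0] := leP 0 t; first exact: wl.
  have gN : gsum n.+1 t = gsum n.+1 (- t).
    by apply: eq_bigr => k _; rewrite mulrN cosN.
  have -> : green l t = green l (- t) by rewrite /green normrN.
  by rewrite gN -normrN => /wl; apply; rewrite oppr_ge0 ltW.
rewrite ger0_norm// => t2.
have [tp|/ltW tp] := leP t pi; first by apply: gsum_cvg_green0; rewrite t0.
have gA : gsum n.+1 t = - gsum n.+1 (2 * pi - t).
  rewrite /gsum -sumrN; apply: eq_bigr => k _; rewrite -mulrN; congr (_ * _).
  have -> : kap k * (2 * pi - t) = - (kap k * t) + pi + pi *+ (k.*2).
    by rewrite -[pi *+ _]mulr_natl -mul2n natrM /kap; field.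
  rewrite (alternatingn (@cosDpi R)) cosDpi cosN mulrN opprK.
  by rewrite -signr_odd odd_double mul1r.
have -> : green l t = - green l (2 * pi - t).
  rewrite /green !ger0_norm ?subr_ge0// -mulNr -sinN; congr (sin _ / _); ring.
rewrite gA mulrN -opprD normrN; apply: gsum_cvg_green0.
by rewrite subr_ge0 t2; lra.
Qed.

Definition gcoefz (k : int) : R := ((k%:~R + 2^-1) ^+ 2 - l ^+ 2)^-1.

(** The window [-n .. n] of integers is that of [trace_partial]. After the shift by [1/2] it is no
    longer symmetric: [k] pairs with [- k - 1], and the term of index [n] is left alone. *)
Definition fsum n t : R := (2 * pi)^-1 *
  \sum_(m < n.*2.+1) gcoefz (m%:Z - n%:Z) * cos (((m%:Z - n%:Z)%:~R + 2^-1) * t).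

Lemma sum_int_sym (F : int -> R) n : (forall k, F (Negz k) = F (Posz k)) ->
  \sum_(m < n.*2.+1) F (m%:Z - n%:Z) = 2 * (\sum_(k < n) F k%:Z) + F n%:Z.
Proof.
move=> FN; elim: n => [|n ih].
  by rewrite big_ord1 big_ord0 mulr0 !add0r oppr0.
rewrite doubleS big_ord_recr big_ord_recl/= [in RHS]big_ord_recr/=.
have -> : F (0%:Z - n.+1%:Z) = F n%:Z by rewrite sub0r -FN NegzE.
have -> : F (n.*2.+2%:Z - n.+1%:Z) = F n.+1%:Z.
  by congr F; rewrite -addnn -addnS -addSn PoszD addrK.
have -> : \sum_(i < n.*2.+1) F ((bump 0 i)%:Z - n.+1%:Z) =
    \sum_(m < n.*2.+1) F (m%:Z - n%:Z).
  by apply: eq_bigr => m _; congr F; rewrite /bump leq0n add1n !intS; ring.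
rewrite ih; ring.
Qed.

Lemma fsumE n t : fsum n t = (2 * pi)^-1 * (2 * gsum n t + gcoef n * cos (kap n * t)).
Proof.
congr (_ * _); rewrite (@sum_int_sym
  (fun k : int => gcoefz k * cos ((k%:~R + 2^-1) * t))); first by [].
move=> k; rewrite NegzE.
have E : (- k.+1%:Z)%:~R + 2^-1 = - (k%:~R + 2^-1) :> R.
  rewrite rmorphN/= -[k.+1%:Z%:~R]/(k.+1%:R : R) -natr1 -[k%:Z%:~R]/(k%:R : R).
  by field.
by rewrite /gcoefz E sqrrN mulNr cosN.
Qed.

Lemma fsum_cvg_green t n : `|t| <= 2 * pi -> `|fsum n.+1 t - green l t| <= 2 / n.+1%:R.
Proof.
move=> t2; have pi2 := @pi_ge2 R; have pi0 := @pi_gt0 R.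
have p0 : 0 < 2 * pi :> R by rewrite mulr_gt0.
have -> : fsum n.+1 t - green l t = (2 * pi)^-1 *
   (2 * (gsum n.+1 t - pi * green l t) + gcoef n.+1 * cos (kap n.+1 * t)).
  rewrite fsumE; move: (green l t) => G; move: (@pi R) pi0 => P P0; field.
  by rewrite gt_eqF.
rewrite normrM gtr0_norm ?invr_gt0// mulrC ler_pdivrMr//.
apply: (le_trans (ler_normD _ _)).
have A := gsum_cvg_green n t2.
have B : `|gcoef n.+1 * cos (kap n.+1 * t)| <= 2 / n.+1%:R.
  rewrite normrM; apply: (@le_trans _ _ `|gcoef n.+1|).
    by rewrite ler_piMr// cos_max.
  apply: (le_trans (gcoef_bound n)).
  by rewrite ler_wpM2l// gerBl invr_ge0.
have X0 : 0 <= 2 / n.+1%:R :> R by rewrite divr_ge0.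
rewrite normrM [`|2|]gtr0_norm//; set X := 2 / n.+1%:R in A B X0 *.
have : 0 <= X * (pi - 2) by rewrite mulr_ge0// subr_ge0.
by clearbody X; lra.
Qed.

End GreenFourier.

(** * Hilbert-Schmidt estimates *)

Section HilbertSchmidt.
Variable R : realType.
Implicit Types (f g h p q u K : R -> R) (a b c t s : R).
Local Notation T := (2 * pi : R).

Lemma itg_norm_dom f g a b : continuous f -> continuous g ->
  (forall t, a <= t <= b -> `|f t| <= g t) -> `|itg a b f| <= itg a b g.
Proof.
move=> cf cg fg; rewrite ler_norml -itgN//.
apply/andP; split; apply: itg_le => //; try by cont.
- by move=> t /fg; rewrite ler_norml => /andP[].
- by move=> t /fg; rewrite ler_norml => /andP[].
Qed.

Lemma itg_sum (F : nat -> R -> R) n a b : (forall k, continuous (F k)) ->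
  itg a b (fun t => \sum_(k < n) F k t) = \sum_(k < n) itg a b (F k).
Proof.
move=> cF; elim: n => [|n ih].
  rewrite big_ord0 -[RHS](mul0r (itg a b (F 0%N))) -itgZ//.
  by apply: itg_ext => t _; rewrite big_ord0 mul0r.
rewrite big_ord_recr/= -ih -itgD//; last first.
  elim: n {ih} => [|n ih].
    by have -> : (fun t => \sum_(k < 0) F k t) = (fun _ => 0);
      [apply/funext => t; rewrite big_ord0|cont].
  have -> : (fun t => \sum_(k < n.+1) F k t) = (fun t => \sum_(k < n) F k t + F n t).
    by apply/funext => t; rewrite big_ord_recr.
  by cont.
by apply: itg_ext => t _; rewrite big_ord_recr.
Qed.

Lemma cont_sum (F : nat -> R -> R) n : (forall k, continuous (F k)) ->
  continuous (fun t => \sum_(k < n) F k t).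
Proof.
move=> cF; elim: n => [|n ih].
  by have -> : (fun t => \sum_(k < 0) F k t) = (fun _ => 0);
    [apply/funext => t; rewrite big_ord0|cont].
have -> : (fun t => \sum_(k < n.+1) F k t) = (fun t => \sum_(k < n) F k t + F n t).
  by apply/funext => t; rewrite big_ord_recr.
by cont.
Qed.

Lemma itg_shift f c a b : a <= b -> 0 <= a + c -> continuous f ->
  itg a b (fun t => f (t + c)) = itg (a + c) (b + c) f.
Proof.
move=> ab ac cf; have [P [cP _ dP]] := primitive cf.
have -> : itg (a + c) (b + c) f = P (b + c) - P (a + c).
  apply: FTC; rewrite ?lerD2r// => t /andP[act _]; apply: dP.
  exact: le_lt_trans act.
apply: (@FTC _ _ (fun t => P (t + c))) => //.
- by apply: (cont_comp cf); cont.
- by apply: (cont_comp cP); cont.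
- move=> t /andP[at_ _]; have tc : 0 < t + c by rewrite (le_lt_trans ac)// ltrD2r.
  have dc : has_der (fun s => s + c) t (1 + 0) by der.
  have := @is_derive1_comp _ P _ t _ _ (dP _ tc) dc.
  by rewrite addr0 mulr1.
Qed.

Lemma cauchy_schwarz q f g a b : continuous q -> continuous f -> continuous g ->
  (forall t, a <= t <= b -> 0 <= q t) ->
  (itg a b (fun t => q t * (f t * g t))) ^+ 2 <=
  itg a b (fun t => q t * f t ^+ 2) * itg a b (fun t => q t * g t ^+ 2).
Proof.
move=> cq cf cg q0.
set A := itg a b (fun t => q t * f t ^+ 2).
set C := itg a b (fun t => q t * g t ^+ 2).
set B := itg a b (fun t => q t * (f t * g t)).
have quad x y : 0 <= x ^+ 2 * A + 2 * x * y * B + y ^+ 2 * C.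
  rewrite /A /B /C -!itgZ; [|by cont..].
  rewrite -!itgD; [|by cont..].
  apply: itg_ge0 => t /q0 qt.
  have -> : x ^+ 2 * (q t * f t ^+ 2) + 2 * x * y * (q t * (f t * g t)) +
     y ^+ 2 * (q t * g t ^+ 2) = q t * (x * f t + y * g t) ^+ 2 by ring.
  by rewrite mulr_ge0// sqr_ge0.
have A0 : 0 <= A by apply: itg_ge0 => t /q0 qt; rewrite mulr_ge0// sqr_ge0.
have [A1|A1] := eqVneq A 0.
  have [C1|C1] := eqVneq C 0.
    have := quad 1 1; have := quad 1 (-1); rewrite A1 C1; nra.
  have C0 : 0 < C.
    rewrite lt_neqAle eq_sym C1/=.
    by apply: itg_ge0 => t /q0 qt; rewrite mulr_ge0// sqr_ge0.
  have := quad C (- B); rewrite A1; nra.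
have {A1}A0 : 0 < A by rewrite lt_neqAle eq_sym A1.
have := quad (- B) A.
have -> : (- B) ^+ 2 * A + 2 * (- B) * A * B + A ^+ 2 * C = A * (A * C - B ^+ 2) by ring.
by rewrite pmulr_rge0// subr_ge0.
Qed.

(** A class closed under sums and products that admits the corner of [green] at [0] and whose
    convolutions with continuous functions are continuous. *)
Definition bounded_lipschitz K : Prop := exists M : R, exists k : R,
  [/\ 0 <= M, 0 <= k, forall x, `|K x| <= M & forall x y, `|K x - K y| <= k * `|x - y|].

Lemma bounded_lipschitzM K L : bounded_lipschitz K -> bounded_lipschitz L ->
  bounded_lipschitz (fun t => K t * L t).
Proof.
move=> [M [k [M0 k0 KM Kk]]] [N [m [N0 m0 LN Lm]]].
exists (M * N), (k * N + M * m); split; first exact: mulr_ge0.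
- by rewrite addr_ge0// mulr_ge0.
- by move=> x; rewrite normrM ler_pM.
- move=> x y; have -> : K x * L x - K y * L y =
    (K x - K y) * L x + K y * (L x - L y) by ring.
  apply: (le_trans (ler_normD _ _)); rewrite !normrM mulrDl lerD//.
    by rewrite mulrAC ler_pM.
  by rewrite -mulrA ler_pM.
Qed.

Lemma bounded_lipschitzD K L : bounded_lipschitz K -> bounded_lipschitz L ->
  bounded_lipschitz (fun t => K t + L t).
Proof.
move=> [M [k [M0 k0 KM Kk]]] [N [m [N0 m0 LN Lm]]].
exists (M + N), (k + m); split; rewrite ?addr_ge0//.
- by move=> x; apply: (le_trans (ler_normD _ _)); rewrite lerD.
- move=> x y; have -> : K x + L x - (K y + L y) = (K x - K y) + (L x - L y) by ring.
  by apply: (le_trans (ler_normD _ _)); rewrite mulrDl lerD.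
Qed.

Lemma bounded_lipschitz_cst a : bounded_lipschitz (fun=> a).
Proof.
by exists `|a|, 0; split => // x y; rewrite subrr normr0 mul0r.
Qed.

Lemma sin_lipschitz x y : `|sin x - sin y| <= `|x - y| :> R.
Proof.
wlog xy : x y / y <= x.
  move=> wl; have [/wl//|/ltW/wl] := leP y x.
  by rewrite distrC [leRHS]distrC.
rewrite [leRHS]ger0_norm ?subr_ge0// -[leRHS]mul1r.
apply: (@mvt_bound R sin cos) => // t _; first exact: is_derive_sin.
exact: cos_max.
Qed.

Lemma bounded_lipschitz_cos c : bounded_lipschitz (fun t => cos (c * t)).
Proof.
exists 1, `|c|; split => // x; first exact: cos_max.
move=> y; have cs z : cos (c * z) = sin (c * z + pi / 2) by rewrite sinDpihalf.
rewrite !cs; apply: (le_trans (sin_lipschitz _ _)).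
rewrite opprD addrACA subrr addr0 -mulrBr normrM//.
Qed.

Lemma bounded_lipschitz_green l : bounded_lipschitz (fun t : R => green l t).
Proof.
rewrite /green; set D := _^-1.
apply: (@bounded_lipschitzM (fun t : R => sin (l * (pi - `|t|))) (fun=> D));
  last exact: bounded_lipschitz_cst.
exists 1, `|l|; split => // x; first exact: sin_max.
move=> y; apply: (le_trans (sin_lipschitz _ _)).
rewrite -mulrBr normrM ler_wpM2l//.
have -> : pi - `|x| - (pi - `|y|) = - (`|x| - `|y|) by ring.
by rewrite normrN ler_dist_dist.
Qed.

Lemma bounded_lipschitz_cont K : bounded_lipschitz K -> continuous K.
Proof. by move=> [M [k [_ _ _]]]; exact: lipschitz_cont. Qed.

Definition conv K h t : R := itg 0 T (fun s => K (t - s) * h s).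

Lemma cont_conv_in K h t : continuous K -> continuous h ->
  continuous (fun s => K (t - s) * h s).
Proof.
by move=> cK ch; apply: contM => //; apply: (cont_comp cK); cont.
Qed.

Lemma cont_conv K h : bounded_lipschitz K -> continuous h -> continuous (conv K h).
Proof.
move=> bK ch; have cK := bounded_lipschitz_cont bK.
have [M [k [M0 k0 KM Kk]]] := bK.
apply: (@lipschitz_cont _ _ (k * itg 0 T (fun s => `|h s|))) => x y.
rewrite /conv -itgB; [|exact: cont_conv_in..].
rewrite mulrAC -itgZ; last by cont.
apply: itg_norm_dom; [|by cont|] => [|s _].
  by apply: contD; [|apply: contN]; exact: cont_conv_in.
rewrite -mulrBl normrM ler_wpM2r//; apply: (le_trans (Kk _ _)).
by rewrite opprB addrA subrK.
Qed.

Lemma conv_bound K L h t d : continuous K -> continuous L -> continuous h ->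
  (forall x, `|x| <= T -> `|K x - L x| <= d) -> 0 <= t <= T ->
  `|conv K h t - conv L h t| <= d * itg 0 T (fun s => `|h s|).
Proof.
move=> cK cL ch KL /andP[t0 tT]; rewrite /conv -itgB; [|exact: cont_conv_in..].
rewrite -itgZ; last by cont.
apply: itg_norm_dom; [|by cont|] => [|s /andP[s0 sT]].
  by apply: contD; [|apply: contN]; exact: cont_conv_in.
rewrite -mulrBl normrM ler_wpM2r//; apply: KL.
by rewrite ler_norml; apply/andP; split; lra.
Qed.

Lemma cont_Green l h : continuous h -> continuous (Green l h).
Proof. exact: cont_conv (bounded_lipschitz_green l). Qed.

Definition hs_norm l q : R :=
  itg 0 T (fun t => q t * conv (fun x => green l x * green l x) q t).

Lemma cont_hs_conv l q : continuous q ->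
  continuous (conv (fun x => green l x * green l x) q).
Proof.
by move=> cq; apply: cont_conv => //; apply: bounded_lipschitzM;
  exact: bounded_lipschitz_green.
Qed.

Lemma hs_norm_ge0 l q : (forall t, 0 <= t <= T -> 0 <= q t) -> 0 <= hs_norm l q.
Proof.
move=> q0; apply: itg_ge0 => t tT; apply: mulr_ge0; first exact: q0.
by apply: itg_ge0 => s sT; rewrite mulr_ge0 ?q0// -expr2 sqr_ge0.
Qed.

Lemma hs_normZ l q a : continuous q ->
  hs_norm l (fun t => a * q t) = a ^+ 2 * hs_norm l q.
Proof.
move=> cq; rewrite /hs_norm -itgZ; last by apply: contM => //; exact: cont_hs_conv.
apply: itg_ext => t _.
have -> : conv (fun x => green l x * green l x) (fun t0 => a * q t0) t
    = a * conv (fun x => green l x * green l x) q t.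
  rewrite /conv -itgZ; last first.
    apply: (@cont_conv_in (fun x => green l x * green l x)) => //.
    by apply: (@contM R (green l) (green l)); exact: cont_green.
  by apply: itg_ext => s _; rewrite mulrCA.
by ring.
Qed.

(** The usual comparison of operator norm and Hilbert-Schmidt norm: Cauchy-Schwarz in [s] for fixed
    [t], then integration in [t]. Keeping [q] as a weight avoids [q^(1/2)]. *)
Lemma Green_hs_bound l q u : continuous q -> continuous u ->
  (forall t, 0 <= t <= T -> 0 <= q t) ->
  itg 0 T (fun t => q t * (Green l (fun s => q s * u s) t) ^+ 2) <=
  hs_norm l q * itg 0 T (fun t => q t * u t ^+ 2).
Proof.
move=> cq cu q0; have cG := @cont_green R l.
rewrite [leRHS]mulrC /hs_norm -itgZ; last by apply: contM => //; exact: cont_hs_conv.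
apply: itg_le.
- by cont; apply: cont_Green; cont.
- by cont; exact: cont_hs_conv.
move=> t tT; rewrite [leRHS]mulrCA; apply: ler_wpM2l; first exact: q0.
have cGt : continuous (fun s => green l (t - s)) by apply: (cont_comp cG); cont.
have := @cauchy_schwarz q (fun s => green l (t - s)) u 0 T cq cGt cu q0.
have -> : itg 0 T (fun s => q s * (green l (t - s) * u s)) =
    Green l (fun s => q s * u s) t by apply: itg_ext => s _; ring.
have -> : itg 0 T (fun s => q s * green l (t - s) ^+ 2) =
    conv (fun x => green l x * green l x) q t by apply: itg_ext => s _; ring.
by rewrite [leRHS]mulrC.
Qed.

Lemma Green_form_bound l q u k : continuous q -> continuous u ->
  (forall t, 0 <= t <= T -> 0 <= q t) -> 0 <= k -> hs_norm l q <= k ^+ 2 ->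
  `|itg 0 T (fun t => q t * (u t * Green l (fun s => q s * u s) t))| <=
  k * itg 0 T (fun t => q t * u t ^+ 2).
Proof.
move=> cq cu q0 k0 hk.
have cG : continuous (Green l (fun s => q s * u s)) by apply: cont_Green; cont.
have N0 : 0 <= itg 0 T (fun t => q t * u t ^+ 2).
  by apply: itg_ge0 => t /q0 qt; rewrite mulr_ge0// sqr_ge0.
rewrite -[leRHS]ger0_norm ?mulr_ge0// -ler_sqr ?nnegrE//.
rewrite !real_normK ?num_real//; apply: (le_trans (cauchy_schwarz cq cu cG q0)).
have := Green_hs_bound l cq cu q0; set N := itg _ _ _ in N0 *; set H := itg _ _ _ => HN.
by nra.
Qed.

End HilbertSchmidt.

(** * Positivity of the Green kernel *)

Section CosParts.
Variable R : realType.
Implicit Types (l t s a : R) (h p : R -> R) (n : nat).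
Local Notation T := (2 * pi : R).

Definition cos_minus t : R := (`|cos t| - cos t) / 2.

Lemma cont_cos_plus : continuous (@cos_plus R).
Proof. by rewrite /cos_plus; cont. Qed.

Lemma cont_cos_minus : continuous cos_minus.
Proof. by rewrite /cos_minus; cont. Qed.

Lemma cos_plus_ge0 t : 0 <= cos_plus t.
Proof.
by rewrite divr_ge0// -lerBlDl sub0r -normrN ler_norm.
Qed.

Lemma cos_minus_ge0 t : 0 <= cos_minus t.
Proof. by rewrite divr_ge0// subr_ge0 ler_norm. Qed.

Lemma cos_minusDpi t : cos_minus (t + pi) = cos_plus t.
Proof. by rewrite /cos_minus /cos_plus cosDpi normrN opprK addrC. Qed.

Lemma cos_plusDpi t : cos_minus t = cos_plus (t + pi).
Proof. by rewrite /cos_minus /cos_plus cosDpi normrN addrC. Qed.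

Lemma green_antiper l t : 0 <= t <= T -> green l (t - T) = - green l t.
Proof.
move=> /andP[t0 tT]; rewrite /green ler0_norm ?subr_le0// ger0_norm//.
by rewrite -[RHS]mulNr -sinN; congr (sin _ / _); ring.
Qed.

(* Translating by [pi] turns [cos_minus] into [cos_plus]; modulo the period the
   translation is [t + pi] on the first half and [t - pi] on the second one. *)
Lemma hs_norm_cos_minus l : hs_norm l cos_minus = hs_norm l (@cos_plus R).
Proof.
have pi0 := @pi_ge0 R.
have cp := cont_cos_plus; have cm := cont_cos_minus.
pose K x : R := green l x * green l x.
have bK : bounded_lipschitz K.
  by apply: bounded_lipschitzM; exact: bounded_lipschitz_green.
have cK := bounded_lipschitz_cont bK.
have KT x : 0 <= x <= T -> K (x - T) = K x.
  by move=> xT; rewrite /K green_antiper// mulrNN.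
pose H := conv K (@cos_plus R).
have cH : continuous H by exact: cont_conv.
have pipi : pi + pi = T by ring.
have piT : 0 <= (pi : R) <= T by apply/andP; split; lra.
have half1 f : continuous f ->
    itg 0 pi (fun t => f (t + pi)) = itg pi T f.
  by move=> cf; rewrite itg_shift// add0r ?pipi.
have half2 f : continuous f ->
    itg pi T f = itg 0 pi (fun t => f (t + pi)).
  by move=> cf; rewrite itg_shift// add0r ?pipi.
have convE t : conv K cos_minus t =
    itg pi T (fun s => K (t + pi - s) * cos_plus s)
    + itg 0 pi (fun s => K (t - pi - s) * cos_plus s).
  rewrite /conv (itg_split piT); last exact: cont_conv_in.
  congr (_ + _).
    rewrite half2; last exact: cont_conv_in.
    by apply: itg_ext => s _; rewrite -cos_plusDpi; congr (K _ * _); ring.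
  rewrite half2; last exact: cont_conv_in.
  by apply: itg_ext => s _; rewrite cos_minusDpi; congr (K _ * _); ring.
have HE t : H t = itg pi T (fun s => K (t - s) * cos_plus s)
    + itg 0 pi (fun s => K (t - s) * cos_plus s).
  by rewrite addrC /H /conv (itg_split piT)//; exact: cont_conv_in.
have lo t : 0 <= t <= pi -> conv K cos_minus t = H (t + pi).
  move=> /andP[t0 tp]; rewrite convE HE; congr (_ + _).
  apply: itg_ext => s /andP[s0 sp]; congr (_ * _).
  rewrite -[RHS]KT; first by congr K; ring.
  by apply/andP; split; lra.
have hi t : pi <= t <= T -> conv K cos_minus t = H (t - pi).
  move=> /andP[t0 tp]; rewrite convE HE; congr (_ + _).
  apply: itg_ext => s /andP[s0 sp]; congr (_ * _).
  rewrite -[LHS]KT; first by congr K; ring.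
  by apply/andP; split; lra.
rewrite /hs_norm -/K -/H [RHS](itg_split piT); last by cont.
rewrite (itg_split piT); last by cont; exact: cont_conv.
have -> : itg 0 pi (fun t => cos_minus t * conv K cos_minus t) =
    itg pi T (fun t => cos_plus t * H t).
  rewrite half2; last by cont.
  by apply: itg_ext => s sp; rewrite lo// -cos_plusDpi.
have -> : itg pi T (fun t => cos_minus t * conv K cos_minus t) =
    itg 0 pi (fun t => cos_plus t * H t).
  rewrite half2; last by cont; exact: cont_conv.
  apply: itg_ext => s /andP[s0 sp]; rewrite cos_minusDpi hi ?addrK//.
  by apply/andP; split; lra.
by rewrite addrC.
Qed.

Variable l : R.
Hypothesis l0 : 0 < l.
Hypothesis l12 : l < 2^-1.

Let l1 : l <= 1.
Proof. by apply: ltW; apply: (lt_trans l12); rewrite invf_lt1// ltr1n. Qed.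

Let ln12 : l != 2^-1. Proof. by rewrite lt_eqF. Qed.

(** Here [l < 1/2] enters: all eigenvalues of the Green operator are nonnegative. *)
Lemma gcoef_ge0 k : 0 <= gcoef l k.
Proof.
have k0 := ler0n R k; rewrite /gcoef /kap invr_ge0 subr_sqr.
apply: mulr_ge0; last by rewrite !addr_ge0// ltW.
by rewrite subr_ge0 (le_trans (ltW l12))// lerDr.
Qed.

Lemma conv_gsum h n t : continuous h -> conv (gsum l n) h t =
  \sum_(k < n) gcoef l k * (cos (kap R k * t) * itg 0 T (fun s => cos (kap R k * s) * h s)
                        + sin (kap R k * t) * itg 0 T (fun s => sin (kap R k * s) * h s)).
Proof.
move=> ch.
transitivity (itg 0 T (fun s => \sum_(k < n) gcoef l k *
    (cos (kap R k * t) * (cos (kap R k * s) * h s)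
     + sin (kap R k * t) * (sin (kap R k * s) * h s)))).
  apply: itg_ext => s _; rewrite /gsum mulr_suml; apply: eq_bigr => k _.
  by rewrite mulrBr cosB; ring.
rewrite (@itg_sum _ (fun k s => gcoef l k *
    (cos (kap R k * t) * (cos (kap R k * s) * h s)
     + sin (kap R k * t) * (sin (kap R k * s) * h s)))); last by move=> k; cont.
by apply: eq_bigr => k _; rewrite itgZ ?itgD ?itgZ//; cont.
Qed.

Lemma bounded_lipschitz_gsum n : bounded_lipschitz (gsum l n).
Proof.
rewrite /gsum; elim: n => [|n ih].
  have -> : (fun t => \sum_(k < 0) gcoef l k * cos (kap R k * t)) = fun=> 0.
    by apply/funext => t; rewrite big_ord0.
  exact: bounded_lipschitz_cst.
have -> : (fun t => \sum_(k < n.+1) gcoef l k * cos (kap R k * t)) =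
   (fun t => \sum_(k < n) gcoef l k * cos (kap R k * t) + gcoef l n * cos (kap R n * t)).
  by apply/funext => t; rewrite big_ord_recr.
apply: bounded_lipschitzD => //.
apply: (@bounded_lipschitzM _ (fun=> gcoef l n)); first exact: bounded_lipschitz_cst.
exact: bounded_lipschitz_cos.
Qed.

(* Positivity of the Green kernel on the measure [a * delta_t + h(s) ds]. *)
Lemma green_positive a h t : continuous h -> 0 <= t <= T ->
  0 <= a ^+ 2 * green l 0 + 2 * a * Green l h t
       + itg 0 T (fun s => h s * Green l h s).
Proof.
move=> ch tT; have pi0 := @pi_gt0 R.
rewrite -(pmulr_rge0 _ pi0).
pose I := itg 0 T (fun s => `|h s|).
have I0 : 0 <= I by exact: itg_ge0.
have cg := @cont_green R l.
(* The partial sum [S] replaces [pi * green] at an error of order [1 / n.+1], which disappears in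
   the limit. *)
apply: (@le_of_inv_rate _ _ _ (2 * (a ^+ 2 + 2 * `|a| * I + I ^+ 2))) => n.
have bS := bounded_lipschitz_gsum n.+1; set S := gsum l n.+1 in bS *.
have cS := bounded_lipschitz_cont bS.
have Sg x : `|x| <= T -> `|S x - pi * green l x| <= 2 / n.+1%:R.
  exact: gsum_cvg_green.
have cpg : continuous (fun x => pi * green l x) by cont.
have convpi s : conv (fun x => pi * green l x) h s = pi * Green l h s.
  rewrite /conv /Green -itgZ; last by apply: (@cont_conv_in R (green l)).
  by apply: itg_ext => u _; rewrite mulrA.
have Sc s : 0 <= s <= T -> `|conv S h s - pi * Green l h s| <= 2 / n.+1%:R * I.
  by move=> sT; rewrite -convpi; apply: conv_bound.
(* Each frequency contributes [gcoef] times the squared modulus of a Fourier coefficient of the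
   measure [a * delta_t + h(s) ds]. *)
have QS : 0 <= a ^+ 2 * S 0 + 2 * a * conv S h t + itg 0 T (fun s => h s * conv S h s).
  pose C k := itg 0 T (fun s => cos (kap R k * s) * h s).
  pose D k := itg 0 T (fun s => sin (kap R k * s) * h s).
  have -> : itg 0 T (fun s => h s * conv S h s) =
      \sum_(k < n.+1) gcoef l k * (C k ^+ 2 + D k ^+ 2).
    transitivity (itg 0 T (fun s => \sum_(k < n.+1) gcoef l k *
       (C k * (cos (kap R k * s) * h s) + D k * (sin (kap R k * s) * h s)))).
      apply: itg_ext => s _; rewrite conv_gsum// mulr_sumr; apply: eq_bigr => k _.
      by rewrite /C /D; ring.
    rewrite (@itg_sum _ (fun k s => gcoef l k *
       (C k * (cos (kap R k * s) * h s) + D k * (sin (kap R k * s) * h s))));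
      last by move=> k; cont.
    apply: eq_bigr => k _; rewrite itgZ ?itgD ?itgZ//; cont.
  rewrite conv_gsum// /S /gsum !mulr_sumr -!big_split/=; apply: sumr_ge0 => k _.
  rewrite mulr0 cos0 -/(C k) -/(D k).
  have -> : a ^+ 2 * (gcoef l k * 1) +
    2 * a * (gcoef l k * (cos (kap R k * t) * C k + sin (kap R k * t) * D k)) +
    gcoef l k * (C k ^+ 2 + D k ^+ 2) =
    gcoef l k * ((a * cos (kap R k * t) + C k) ^+ 2 + (a * sin (kap R k * t) + D k) ^+ 2).
    have -> : gcoef l k * 1 = gcoef l k * (cos (kap R k * t) ^+ 2 + sin (kap R k * t) ^+ 2).
      by rewrite cos2Dsin2.
    move: (cos _) (sin _) (C k) (D k) (gcoef l k) => u v Ck Dk gk.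
    by ring.
  by rewrite mulr_ge0 ?gcoef_ge0// addr_ge0// sqr_ge0.
apply: (le_trans QS); rewrite -lerBlDl.
have -> : a ^+ 2 * S 0 + 2 * a * conv S h t + itg 0 T (fun s => h s * conv S h s)
  - pi * (a ^+ 2 * green l 0 + 2 * a * Green l h t
       + itg 0 T (fun s => h s * Green l h s)) =
  a ^+ 2 * (S 0 - pi * green l 0) + 2 * a * (conv S h t - pi * Green l h t) +
  (itg 0 T (fun s => h s * conv S h s) - pi * itg 0 T (fun s => h s * Green l h s)).
  by ring.
have -> : 2 * (a ^+ 2 + 2 * `|a| * I + I ^+ 2) / n.+1%:R =
   a ^+ 2 * (2 / n.+1%:R) + 2 * `|a| * (2 / n.+1%:R * I) + 2 / n.+1%:R * I * I.
  by ring.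
apply: lerD; first apply: lerD.
- rewrite ler_wpM2l ?sqr_ge0//; apply: (le_trans (ler_norm _)); apply: Sg.
  by rewrite normr0 mulr_ge0// ltW.
- apply: (le_trans (ler_norm _)); rewrite !normrM [`|2|]gtr0_norm//.
  by rewrite ler_wpM2l ?mulr_ge0// Sc.
have cGh := @cont_Green R l h ch; have cSh := cont_conv bS ch.
rewrite -itgZ; last by cont.
rewrite -itgB; [|by cont..].
rewrite /I -itgZ; last by cont.
apply: (le_trans (ler_norm _)); apply: itg_norm_dom; [by cont..|] => s sT.
have -> : h s * conv S h s - pi * (h s * Green l h s) =
  (conv S h s - pi * Green l h s) * h s by ring.
by rewrite normrM ler_wpM2r// Sc.
Qed.

End CosParts.

(** * Representatives in [W^{1,2}] *)

Section AbsolutelyContinuous.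
Variable R : realType.
Implicit Types (a f k h Z : R -> R) (t s : R).
Local Notation T := (2 * pi : R).
Local Notation mu := (@lebesgue_measure R).

(** Clamping to the period; globally continuous functions keep the calculus lemmas free of domain
    conditions. *)
Lemma extend_cont f : {within @period R, continuous f} ->
  exists g : R -> R, continuous g /\ forall t, 0 <= t <= T -> g t = f t.
Proof.
move=> /subspace_continuousP cf.
pose clamp t : R := Num.max 0 (Num.min t T).
have clampT t : period (clamp t).
  by rewrite /period/= in_itv/= /clamp le_max lexx ge_max twopi_ge0 ge_min lexx orbT.
exists (fun t => f (clamp t)); split; last first.
  move=> t /andP[t0 tT]; rewrite /clamp; congr f.
  by rewrite (min_idPl tT); exact/max_idPr.
have cc : continuous clamp.
  by apply: cont_max; [cont|apply: cont_min; cont].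
move=> x U /(cf _ (clampT x)); rewrite /within/= => fU.
have := cc x _ fU; rewrite !nbhs_simpl/= => cU.
change (\forall y \near x, U (f (clamp y))).
near=> y; have := clampT y; near: y; exact: cU.
Unshelve. all: by end_near. Qed.

Lemma realL2_integrable a : realL2 a -> mu.-integrable (@period R) (EFin \o a).
Proof.
move=> [ma ia]; have mp : measurable (@period R) by exact: measurable_itv.
have i1 : mu.-integrable (@period R) (EFin \o (fun _ : R => 1 : R)).
  exact: (@cont_integrable R (fun _ => 1) 0 T (@cont_cst R 1)).
have i2 : mu.-integrable (@period R) (EFin \o (fun t => 1 + a t ^+ 2)).
  rewrite (_ : EFin \o _ = (EFin \o (fun _ : R => 1 : R)) \+ (fun t => (a t ^+ 2)%:E)).
    by apply: integrableD.
  by apply/funext => t /=; rewrite EFinD.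
apply: le_integrable i2 => //; first exact/measurable_EFinP.
move=> t _ /=; rewrite lee_fin [leRHS]ger0_norm ?addr_ge0 ?sqr_ge0//.
have := sqr_ge0 (`|a t| - 1); rewrite sqrrB real_normK ?num_real// expr1n.
by have := normr_ge0 (a t); lra.
Qed.

Lemma ae_impl (P Q : R -> Prop) : (forall s, P s -> Q s) ->
  {ae mu, forall s, P s} -> {ae mu, forall s, Q s}.
Proof.
by move=> PQ; apply: (@filterS _ (almost_everywhere mu) (ae_filter_ringOfSetsType mu)).
Qed.

Lemma itg_ae a k t : 0 <= t <= T -> measurable_fun (@period R) a -> continuous k ->
  {ae mu, forall s, period s -> a s = k s} -> itg 0 t a = itg 0 t k.
Proof.
move=> /andP[t0 tT] ma ck ak; rewrite /itg /Rintegral; congr fine.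
have sub : `[0, t]%classic `<=` @period R.
  by apply: subset_itvl; rewrite bnd_simp.
apply: ae_eq_integral => //.
- apply/measurable_EFinP; apply: (measurable_funS _ sub ma); exact: measurable_itv.
- by apply/measurable_EFinP; apply: measurable_funTS; exact: continuous_measurable_fun.
- by apply: ae_impl ak => s ks /sub /ks /= ->.
Qed.

Lemma W12_cont Z a : realL2 a -> (forall t, period t -> Z t = Z 0 + itg 0 t a) ->
  exists P : R -> R, continuous P /\ forall t, 0 <= t <= T -> P t = Z t.
Proof.
move=> La Za; apply: extend_cont.
have := @parameterized_integral_continuous R 0 T a (twopi_ge0 R) (realL2_integrable La).
move=> /subspace_continuousP cI; apply/subspace_continuousP => x px.
have H : (Z 0 + itg 0 y a) @[y --> within (@period R) (nbhs x)] --> Z 0 + itg 0 x a.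
  by apply: cvgD; [exact: cvg_cst|exact: cI].
rewrite [from_subspace _ Z x](Za _ px); apply: cvg_trans H.
apply: near_eq_cvg; near=> y.
by rewrite [RHS]Za//; near: y; exact: withinT.
Unshelve. all: by end_near. Qed.

(** Bootstrapping: once the weak derivative agrees almost everywhere with a continuous function, the
    representative is a classical antiderivative of it inside the period. *)
Lemma W12_smooth Z a k : realL2 a -> (forall t, period t -> Z t = Z 0 + itg 0 t a) ->
  continuous k -> {ae mu, forall s, period s -> a s = k s} ->
  exists P : R -> R, [/\ continuous P, forall t, 0 <= t <= T -> P t = Z t &
    forall t, 0 < t < T -> has_der P t (k t)].
Proof.
move=> [ma _] Za ck ak; have [P [cP P0 dP]] := primitive ck.
exists (fun t => Z 0 + P t); split.
- by cont.
- move=> t tT; rewrite [RHS]Za; last by rewrite /period/= in_itv/= tT.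
  rewrite (itg_ae tT ma ck ak); congr (_ + _).
  have -> : itg 0 t k = P t - P 0.
    apply: FTC => //; first by case/andP: tT.
    by move=> s /andP[s0 _]; exact: dP.
  by rewrite P0 subr0.
- move=> t /andP[t0 _]; have dPt := dP _ t0.
  by apply: der_eq; [der|rewrite add0r].
Qed.

Lemma cont_realL2 k : continuous k -> realL2 k.
Proof.
move=> ck; split; first by apply: measurable_funTS; exact: continuous_measurable_fun.
by apply: (@cont_integrable R (fun t => k t ^+ 2)); cont.
Qed.

End AbsolutelyContinuous.

(** * The resolvent at [nu = i / 2] *)

Section Resolvent.
Variable R : realType.
Implicit Types (h : R -> R) (t s : R).
Local Notation T := (2 * pi : R).
Local Notation C := R[i].
Local Notation mu := (@lebesgue_measure R).
Local Notation nu := (Complex 0 2^-1 : C).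

Definition col2 (a b : C) : 'cV[C]_2 := \col_i (if i == 0 then a else b).

Lemma col2_0 a b : col2 a b 0 0 = a. Proof. by rewrite mxE. Qed.
Lemma col2_1 a b : col2 a b 1 0 = b. Proof. by rewrite mxE. Qed.

Lemma ord2P (i : 'I_2) : i = 0 \/ i = 1.
Proof.
by case: i => -[|[|//]] p; [left|right]; exact/val_inj.
Qed.

Lemma cV2P (u v : 'cV[C]_2) : u 0 0 = v 0 0 -> u 1 0 = v 1 0 -> u = v.
Proof.
by move=> e0 e1; apply/matrixP => i j; rewrite (ord1 j); case: (ord2P i) => ->.
Qed.

Lemma mx2_mul (K : pzRingType) (a b c d : K) n (v : 'M[K]_(2, n)) j :
  ((mx2 a b c d *m v) 0 j = a * v 0 j + b * v 1 j) *
  ((mx2 a b c d *m v) 1 j = c * v 0 j + d * v 1 j).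
Proof.
by split; rewrite mxE big_ord_recl big_ord1 !mxE/=; congr (_ * v _ _ + _ * v _ _);
  exact/val_inj.
Qed.

Lemma map_mx2 (K L : pzRingType) (f : K -> L) a b c d :
  map_mx f (mx2 a b c d) = mx2 (f a) (f b) (f c) (f d).
Proof.
apply/matrixP => i j; rewrite !mxE.
by case: (ord2P i) => ->; case: (ord2P j) => ->.
Qed.

Lemma resolvent_eqE (beta t : R) (z w g : 'cV[C]_2) :
  - (J C *m w) - nu *: (J C *m z)
    - map_mx (real_complex R) (B beta 0 t) *m z = g <->
  [/\ complex.Re (w 1 0) = complex.Re (z 0 0) + complex.Im (z 1 0) / 2 + complex.Re (g 0 0),
      complex.Im (w 1 0) = complex.Im (z 0 0) - complex.Re (z 1 0) / 2 + complex.Im (g 0 0),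
      complex.Re (w 0 0) = complex.Im (z 0 0) / 2 - (1 - beta) * complex.Re (z 1 0)
                            - complex.Re (g 1 0) &
      complex.Im (w 0 0) = - complex.Re (z 0 0) / 2 - (1 - beta) * complex.Im (z 1 0)
                            - complex.Im (g 1 0)].
Proof.
have B1 : 1 - beta / (1 + 0 * cos t) = 1 - beta :> R by rewrite mul0r addr0 divr1.
have comb (u v x : 'cV[C]_2) i :
    (- u - nu *: v - x) i 0 = - u i 0 - nu * v i 0 - x i 0 by rewrite !mxE.
rewrite /B B1 map_mx2 /J rmorph0 rmorph1.
set lhs := (X in X = g <-> _).
have L0 : lhs 0 0 = w 1 0 + nu * z 1 0 - z 0 0.
  by rewrite /lhs comb !mx2_mul; ring.
have L1 : lhs 1 0 = - w 0 0 - nu * z 0 0 - (real_complex R (1 - beta)) * z 1 0.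
  by rewrite /lhs comb !mx2_mul; ring.
have -> : lhs = g <-> lhs 0 0 = g 0 0 /\ lhs 1 0 = g 1 0.
  by split => [->//|[]]; exact: cV2P.
rewrite L0 L1.
case: (w 1 0) (w 0 0) (z 1 0) (z 0 0) (g 0 0) (g 1 0)
  => [a1 a2] [b1 b2] [c1 c2] [d1 d2] [e1 e2] [f1 f2] /=.
split.
  by move=> [[h1 h2] [h3 h4]]; split; lra.
by move=> [h1 h2 h3 h4]; split; apply/eqP; rewrite eq_complex/=; apply/andP;
  split; apply/eqP; lra.
Qed.

(** With [rot_im], the real and imaginary parts of [e^{i t / 2} (h1 + i h2)]. *)
Definition rot_re h1 h2 : R -> R := fun t => cos (t / 2) * h1 t - sin (t / 2) * h2 t.
Definition rot_im h1 h2 : R -> R := fun t => sin (t / 2) * h1 t + cos (t / 2) * h2 t.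

Lemma cont_rot_re h1 h2 : continuous h1 -> continuous h2 -> continuous (rot_re h1 h2).
Proof. by move=> c1 c2; rewrite /rot_re; cont. Qed.

Lemma cont_rot_im h1 h2 : continuous h1 -> continuous h2 -> continuous (rot_im h1 h2).
Proof. by move=> c1 c2; rewrite /rot_im; cont. Qed.

Lemma twopi_half : T / 2 = pi.
Proof. by rewrite mulrC mulKf// pnatr_eq0. Qed.

Variables (beta l : R).
Hypothesis lE : l ^+ 2 = 1 - beta.
Hypothesis l0 : l != 0.
Hypothesis cl0 : cos (l * pi) != 0.

(* Multiplication by [e^{i t / 2}] turns the periodic problem with [nu = i / 2]
   into the antiperiodic one with [nu = 0]. *)
Lemma resolvent_graphE h1 h2 (g z : R -> 'cV[C]_2) : continuous h1 -> continuous h2 ->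
  (forall t, period t -> g t = col2 0 (Complex (h1 t) (h2 t))) ->
  resolvent_graph nu beta g z -> forall t, period t ->
  z t 1 0 = Complex
    (cos (t / 2) * Green l (rot_re h1 h2) t + sin (t / 2) * Green l (rot_im h1 h2) t)
    (cos (t / 2) * Green l (rot_im h1 h2) t - sin (t / 2) * Green l (rot_re h1 h2) t).
Proof.
move=> ch1 ch2 gh [w [[Lw Wz] zper zw]].
have Wre i t : period t -> complex.Re (z t i 0) =
    complex.Re (z 0 i 0) + itg 0 t (fun s => complex.Re (w s i 0)).
  by move=> /(Wz _ i) ->; case: (z 0 i 0).
have Wim i t : period t -> complex.Im (z t i 0) =
    complex.Im (z 0 i 0) + itg 0 t (fun s => complex.Im (w s i 0)).
  by move=> /(Wz _ i) ->; case: (z 0 i 0).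
(* Regularity is gained in two passes: continuous representatives make the right-hand sides of the
   system continuous, and then the same functions are classically differentiable. *)
have [Y1c [cY1c Y1cE]] := W12_cont (Lw 0).1 (Wre 0).
have [Y2c [cY2c Y2cE]] := W12_cont (Lw 0).2 (Wim 0).
have [X1c [cX1c X1cE]] := W12_cont (Lw 1).1 (Wre 1).
have [X2c [cX2c X2cE]] := W12_cont (Lw 1).2 (Wim 1).
have ode : {ae mu, forall s, period s ->
   [/\ complex.Re (w s 1 0) = Y1c s + X2c s / 2,
      complex.Im (w s 1 0) = Y2c s - X1c s / 2,
      complex.Re (w s 0 0) = Y2c s / 2 - l ^+ 2 * X1c s - h1 s &
      complex.Im (w s 0 0) = - Y1c s / 2 - l ^+ 2 * X2c s - h2 s]}.
  apply: ae_impl zw => s zws ps.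
  have ps' : 0 <= s <= T by move: ps; rewrite /period/= in_itv.
  have := zws ps; rewrite gh// => /resolvent_eqE.
  rewrite col2_0 col2_1 lE Y1cE// Y2cE// X1cE// X2cE//= => -[-> -> -> ->].
  by rewrite !addr0.
have a1 := ae_impl (fun s H ps => let: And4 a _ _ _ := H ps in a) ode.
have a2 := ae_impl (fun s H ps => let: And4 _ a _ _ := H ps in a) ode.
have a3 := ae_impl (fun s H ps => let: And4 _ _ a _ := H ps in a) ode.
have a4 := ae_impl (fun s H ps => let: And4 _ _ _ a := H ps in a) ode.
have k1 : continuous (fun s => Y1c s + X2c s / 2) by cont.
have k2 : continuous (fun s => Y2c s - X1c s / 2) by cont.
have k3 : continuous (fun s => Y2c s / 2 - l ^+ 2 * X1c s - h1 s) by cont.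
have k4 : continuous (fun s => - Y1c s / 2 - l ^+ 2 * X2c s - h2 s) by cont.
have [X1 [cX1 X1E dX1]] := W12_smooth (Lw 1).1 (Wre 1) k1 a1.
have [X2 [cX2 X2E dX2]] := W12_smooth (Lw 1).2 (Wim 1) k2 a2.
have [Y1 [cY1 Y1E dY1]] := W12_smooth (Lw 0).1 (Wre 0) k3 a3.
have [Y2 [cY2 Y2E dY2]] := W12_smooth (Lw 0).2 (Wim 0) k4 a4.
have T0 := twopi_ge0 R.
have t00 : 0 <= (0 : R) <= T by apply/andP.
have tTT : 0 <= T <= T by apply/andP.
have zp i : z T i 0 = z 0 i 0 by rewrite zper.
(* Over one period the rotation contributes [e^{i pi} = -1], so the periodic [z] becomes
   antiperiodic; its real and imaginary parts now decouple. *)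
have sre : antiper_sol l (rot_re h1 h2) (rot_re X1 X2) (rot_re Y1 Y2).
  split; [exact: cont_rot_re|exact: cont_rot_re|move=> s sT..|].
  - have dX1s := dX1 s sT; have dX2s := dX2 s sT.
    move: sT => /andP[/ltW s0 /ltW sT]; have sT' : 0 <= s <= T by rewrite s0 sT.
    apply: der_eq; first by rewrite /rot_re; der.
    by rewrite Y1cE// Y2cE// X1cE// X2cE// -Y1E// -Y2E// -X1E// -X2E// /rot_re; field.
  - have dY1s := dY1 s sT; have dY2s := dY2 s sT.
    move: sT => /andP[/ltW s0 /ltW sT]; have sT' : 0 <= s <= T by rewrite s0 sT.
    apply: der_eq; first by rewrite /rot_re; der.
    by rewrite Y1cE// Y2cE// X1cE// X2cE// -Y1E// -Y2E// -X1E// -X2E// /rot_re; field.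
  - rewrite /rot_re twopi_half cospi sinpi !mul0r cos0 sin0.
    by rewrite X1E// Y1E// X1E// Y1E// !zp; split; ring.
have sim : antiper_sol l (rot_im h1 h2) (rot_im X1 X2) (rot_im Y1 Y2).
  split; [exact: cont_rot_im|exact: cont_rot_im|move=> s sT..|].
  - have dX1s := dX1 s sT; have dX2s := dX2 s sT.
    move: sT => /andP[/ltW s0 /ltW sT]; have sT' : 0 <= s <= T by rewrite s0 sT.
    apply: der_eq; first by rewrite /rot_im; der.
    by rewrite Y1cE// Y2cE// X1cE// X2cE// -Y1E// -Y2E// -X1E// -X2E// /rot_im; field.
  - have dY1s := dY1 s sT; have dY2s := dY2 s sT.
    move: sT => /andP[/ltW s0 /ltW sT]; have sT' : 0 <= s <= T by rewrite s0 sT.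
    apply: der_eq; first by rewrite /rot_im; der.
    by rewrite Y1cE// Y2cE// X1cE// X2cE// -Y1E// -Y2E// -X1E// -X2E// /rot_im; field.
  - rewrite /rot_im twopi_half cospi sinpi !mul0r cos0 sin0.
    by rewrite X2E// Y2E// X2E// Y2E// !zp; split; ring.
move=> t; rewrite /period/= in_itv/= => tT.
rewrite -(green_repr l0 cl0 (cont_rot_re ch1 ch2) sre tT).
rewrite -(green_repr l0 cl0 (cont_rot_im ch1 ch2) sim tT).
apply/eqP; rewrite eq_complex/= -X1E// -X2E// /rot_re /rot_im.
have cs := cos2Dsin2 (t / 2).
apply/andP; split; apply/eqP.
- transitivity ((cos (t / 2) ^+ 2 + sin (t / 2) ^+ 2) * X1 t); last by ring.
  by rewrite cs mul1r.
- transitivity ((cos (t / 2) ^+ 2 + sin (t / 2) ^+ 2) * X2 t); last by ring.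
  by rewrite cs mul1r.
Qed.

(** Needed because [xget] returns its default on an empty graph. The solution comes from the two
    antiperiodic problems, rotated back by [e^{- i t / 2}]. *)
Lemma resolvent_graph_ex h1 h2 (g : R -> 'cV[C]_2) : continuous h1 -> continuous h2 ->
  (forall t, period t -> g t = col2 0 (Complex (h1 t) (h2 t))) ->
  exists z, resolvent_graph nu beta g z.
Proof.
move=> ch1 ch2 gh.
have [P [Py [cP cPy dP dPy [PA PyA]]]] := antiper_solvable l0 cl0 (cont_rot_re ch1 ch2).
have [Q [Qy [cQ cQy dQ dQy [QA QyA]]]] := antiper_solvable l0 cl0 (cont_rot_im ch1 ch2).
pose X1 t : R := cos (t / 2) * P t + sin (t / 2) * Q t.
pose X2 t : R := cos (t / 2) * Q t - sin (t / 2) * P t.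
pose Y1 t : R := cos (t / 2) * Py t + sin (t / 2) * Qy t.
pose Y2 t : R := cos (t / 2) * Qy t - sin (t / 2) * Py t.
pose dX1 t : R := Y1 t + X2 t / 2.
pose dX2 t : R := Y2 t - X1 t / 2.
pose dY1 t : R := Y2 t / 2 - l ^+ 2 * X1 t - h1 t.
pose dY2 t : R := - Y1 t / 2 - l ^+ 2 * X2 t - h2 t.
have cX1 : continuous X1 by rewrite /X1; cont.
have cX2 : continuous X2 by rewrite /X2; cont.
have cY1 : continuous Y1 by rewrite /Y1; cont.
have cY2 : continuous Y2 by rewrite /Y2; cont.
have cdX1 : continuous dX1 by rewrite /dX1; cont.
have cdX2 : continuous dX2 by rewrite /dX2; cont.
have cdY1 : continuous dY1 by rewrite /dY1; cont.
have cdY2 : continuous dY2 by rewrite /dY2; cont.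
have ftc F dF t : continuous F -> continuous dF ->
    (forall s, 0 < s < T -> has_der F s (dF s)) -> period t ->
    F t = F 0 + itg 0 t dF.
  move=> cF cdF dFF; rewrite /period/= in_itv/= => /andP[t0 tT].
  have -> : itg 0 t dF = F t - F 0.
    apply: FTC => // s /andP[s0 st]; apply: dFF.
    by rewrite s0 (lt_le_trans st).
  by rewrite addrC subrK.
have hX1 t : 0 < t < T -> has_der X1 t (dX1 t).
  move=> tT; have d1 := dP t tT; have d2 := dQ t tT.
  by apply: der_eq; [rewrite /X1; der|rewrite /dX1 /X2 /Y1; field].
have hX2 t : 0 < t < T -> has_der X2 t (dX2 t).
  move=> tT; have d1 := dP t tT; have d2 := dQ t tT.
  by apply: der_eq; [rewrite /X2; der|rewrite /dX2 /X1 /Y2; field].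
have hh1 t : h1 t = cos (t / 2) * rot_re h1 h2 t + sin (t / 2) * rot_im h1 h2 t.
  rewrite /rot_re /rot_im; transitivity ((cos (t / 2) ^+ 2 + sin (t / 2) ^+ 2) * h1 t).
    by rewrite cos2Dsin2 mul1r.
  by ring.
have hh2 t : h2 t = cos (t / 2) * rot_im h1 h2 t - sin (t / 2) * rot_re h1 h2 t.
  rewrite /rot_re /rot_im; transitivity ((cos (t / 2) ^+ 2 + sin (t / 2) ^+ 2) * h2 t).
    by rewrite cos2Dsin2 mul1r.
  by ring.
have hY1 t : 0 < t < T -> has_der Y1 t (dY1 t).
  move=> tT; have d1 := dPy t tT; have d2 := dQy t tT.
  by apply: der_eq; [rewrite /Y1; der|rewrite /dY1 /X1 /Y2 hh1; field].
have hY2 t : 0 < t < T -> has_der Y2 t (dY2 t).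
  move=> tT; have d1 := dPy t tT; have d2 := dQy t tT.
  by apply: der_eq; [rewrite /Y2; der|rewrite /dY2 /X2 /Y1 hh2; field].
exists (fun t => col2 (Complex (Y1 t) (Y2 t)) (Complex (X1 t) (X2 t))).
exists (fun t => col2 (Complex (dY1 t) (dY2 t)) (Complex (dX1 t) (dX2 t))).
split.
- split.
    move=> i; case: (ord2P i) => ->; split.
    + by under eq_fun do rewrite col2_0/=; exact: cont_realL2.
    + by under eq_fun do rewrite col2_0/=; exact: cont_realL2.
    + by under eq_fun do rewrite col2_1/=; exact: cont_realL2.
    + by under eq_fun do rewrite col2_1/=; exact: cont_realL2.
  move=> t i pt; apply/eqP; rewrite eq_complex.
  case: (ord2P i) => -> /=; rewrite ?(col2_0, col2_1)/= -!/(itg _ _ _).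
    under [X in _ == _ + itg 0 t X]eq_fun do rewrite col2_0/=.
    under [X in _ && (_ == _ + itg 0 t X)]eq_fun do rewrite col2_0/=.
    by apply/andP; split; apply/eqP; apply: ftc.
  under [X in _ == _ + itg 0 t X]eq_fun do rewrite col2_1/=.
  under [X in _ && (_ == _ + itg 0 t X)]eq_fun do rewrite col2_1/=.
  by apply/andP; split; apply/eqP; apply: ftc.
- rewrite /X1 /X2 /Y1 /Y2 twopi_half cospi sinpi !mul0r cos0 sin0 PA QA PyA QyA.
  by apply: cV2P; rewrite ?(col2_0, col2_1); congr Complex; ring.
- apply: (@ae_impl _ (fun=> True)) => [s _ ps|]; last exact: aeW.
  rewrite gh//; apply/resolvent_eqE; rewrite !col2_0 !col2_1 -lE /=.
  by rewrite !addr0.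
Qed.

(** Only the second component is recorded, the one that [F_plus] reads. *)
Lemma resolventE h1 h2 (g : R -> 'cV[C]_2) : continuous h1 -> continuous h2 ->
  (forall t, period t -> g t = col2 0 (Complex (h1 t) (h2 t))) ->
  forall t, period t -> resolvent nu beta g t 1 0 = Complex
    (cos (t / 2) * Green l (rot_re h1 h2) t + sin (t / 2) * Green l (rot_im h1 h2) t)
    (cos (t / 2) * Green l (rot_im h1 h2) t - sin (t / 2) * Green l (rot_re h1 h2) t).
Proof.
move=> c1 c2 gh; apply: (resolvent_graphE c1 c2 gh).
exact: xgetPex (resolvent_graph_ex c1 c2 gh).
Qed.

End Resolvent.

(** * The trace as a Hilbert-Schmidt norm *)

Section TraceFormula.
Variable R : realType.
Implicit Types (h : R -> R) (t s : R) (k : int).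
Local Notation T := (2 * pi : R).
Local Notation C := R[i].
Local Notation nu := (Complex 0 2^-1 : C).
Local Notation N := (Num.sqrt T).

Definition kapz k : R := k%:~R + 2^-1.

Lemma cos_int_period k : cos (k%:~R * T) = 1 :> R.
Proof.
have pos n : cos (n%:R * T) = 1 :> R.
  have -> : n%:R * T = 0 + pi *+ n.*2 :> R.
    by rewrite add0r -[pi *+ _]mulr_natl -mul2n natrM; ring.
  by rewrite (alternatingn (@cosDpi R)) cos0 -signr_odd odd_double mulr1.
case: k => n; first exact: pos.
by rewrite NegzE rmorphN/= mulNr cosN; exact: pos.
Qed.

Lemma sin_int_period k : sin (k%:~R * T) = 0 :> R.
Proof.
have pos n : sin (n%:R * T) = 0 :> R.
  have -> : n%:R * T = 0 + pi *+ n.*2 :> R.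
    by rewrite add0r -[pi *+ _]mulr_natl -mul2n natrM; ring.
  by rewrite (alternatingn (@sinDpi R)) sin0 mulr0.
case: k => n; first exact: pos.
by rewrite NegzE rmorphN/= mulNr sinN [sin _]pos oppr0.
Qed.

Lemma cos_kapz k : cos (kapz k * T) = -1 /\ sin (kapz k * T) = 0.
Proof.
have -> : kapz k * T = k%:~R * T + pi by rewrite /kapz; field.
by rewrite cosDpi sinDpi cos_int_period sin_int_period oppr0.
Qed.

Lemma N_gt0 : 0 < N.
Proof. by rewrite sqrtr_gt0 twopi_gt0. Qed.

Lemma N_sqr : N ^+ 2 = T.
Proof. by rewrite sqr_sqrtr// twopi_ge0. Qed.

Lemma ReD (x y : C) : complex.Re (x + y) = complex.Re x + complex.Re y.
Proof. by case: x; case: y. Qed.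

Lemma Re_sum (I : Type) (r : seq I) (F : I -> C) :
  complex.Re (\sum_(i <- r) F i) = \sum_(i <- r) complex.Re (F i).
Proof. exact: (big_morph _ ReD). Qed.

Variables (beta l : R).
Hypothesis lE : l ^+ 2 = 1 - beta.
Hypothesis l0 : 0 < l.
Hypothesis l1 : l <= 1.
Hypothesis l12 : l != 2^-1.

Let ln0 : l != 0. Proof. by rewrite gt_eqF. Qed.
Let cl0 : cos (l * pi) != 0. Proof. exact: coslpi_neq0. Qed.

Lemma gcoefz_den0 k : kapz k ^+ 2 - l ^+ 2 != 0.
Proof.
case: k => n; first exact: gcoef_den0.
rewrite NegzE /kapz; have -> : (- n.+1%:Z)%:~R + 2^-1 = - kap R n :> R.
  by rewrite rmorphN/= -[n.+1%:Z%:~R]/(n.+1%:R : R) -natr1 /kap; field.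
by rewrite sqrrN; exact: gcoef_den0.
Qed.

Lemma Green_cos k t : 0 <= t <= T ->
  Green l (fun s => cos (kapz k * s)) t = gcoefz l k * cos (kapz k * t).
Proof.
move=> tT; have D := gcoefz_den0 k; have [cT sT] := cos_kapz k.
rewrite -(@green_repr _ (fun s => gcoefz l k * cos (kapz k * s))
  (fun s => - gcoefz l k * kapz k * sin (kapz k * s)) _ l t)//; first by cont.
split; [by cont|by cont|move=> s _..|].
- by apply: der_eq; [der|cbv beta; ring].
- by apply: der_eq; [der|cbv beta; rewrite /gcoefz -/(kapz k); field].
- by rewrite cT sT !mulr0 cos0 sin0; split; ring.
Qed.

Lemma Green_sin k t : 0 <= t <= T ->
  Green l (fun s => sin (kapz k * s)) t = gcoefz l k * sin (kapz k * t).
Proof.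
move=> tT; have D := gcoefz_den0 k; have [cT sT] := cos_kapz k.
rewrite -(@green_repr _ (fun s => gcoefz l k * sin (kapz k * s))
  (fun s => gcoefz l k * kapz k * cos (kapz k * s)) _ l t)//; first by cont.
split; [by cont|by cont|move=> s _..|].
- by apply: der_eq; [der|cbv beta; ring].
- by apply: der_eq; [der|cbv beta; rewrite /gcoefz -/(kapz k); field].
- by rewrite cT sT !mulr0 cos0 sin0; split; ring.
Qed.

Lemma GreenZ a h t : continuous h -> Green l (fun s => a * h s) t = a * Green l h t.
Proof.
move=> ch; rewrite /Green -itgZ.
  by apply: itg_ext => s _; rewrite mulrCA.
by apply: (@cont_conv_in R (green l)) => //; exact: cont_green.
Qed.

Lemma F_plusE (g : R -> 'cV[C]_2) t : F_plus nu beta g t =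
  col2 0 (real_complex R (cos_plus t * beta) * resolvent nu beta g t 1 0).
Proof.
rewrite /F_plus; have -> : K_plus beta t = mx2 0 0 0 (cos_plus t * beta).
  apply/matrixP => i j; rewrite !mxE.
  by case: (ord2P i) => ->; case: (ord2P j) => ->; rewrite /= ?mulr0.
rewrite map_mx2 rmorph0; apply: cV2P; rewrite ?(col2_0, col2_1) mx2_mul; ring.
Qed.

Lemma sum_ord2 (G : 'I_2 -> R) : \sum_(j < 2) G j = G 0 + G 1.
Proof.
by rewrite big_ord_recl big_ord1; congr (G _ + G _); exact/val_inj.
Qed.

Lemma fourier0E k t : fourier k 0 t 1 0 = 0 :> C.
Proof. by rewrite !mxE/= mulr0. Qed.

Lemma fourier1E k t : fourier k 1 t = col2 0 (Complex (cos (k%:~R * t) / N) (sin (k%:~R * t) / N)).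
Proof. by apply: cV2P; rewrite ?(col2_0, col2_1) !mxE/= ?mulr0 ?mulr1. Qed.

Lemma innerE0 (f g : R -> 'cV[C]_2) : (forall t, f t 0 0 = 0) -> (forall t, g t 1 0 = 0) ->
  complex.Re (inner f g) = 0.
Proof.
move=> f0 g0; rewrite /inner/= -/(itg 0 T _).
transitivity (itg 0 T (fun _ : R => 0 : R)).
  apply: itg_ext => t _; rewrite big_ord_recl big_ord1.
  have -> : lift ord0 ord0 = 1 :> 'I_2 by exact/val_inj.
  by rewrite f0 g0 mul0r conjc0 mulr0 addr0.
by rewrite itg_cst ?twopi_ge0// mul0r.
Qed.

(** The half-angle rotation moves the frequency [k] to [k + 1/2]. *)
Lemma rot_fourier a b k : (forall t, b t = a t * sin (k%:~R * t)) ->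
  (rot_re (fun t => a t * cos (k%:~R * t)) b = fun t => a t * cos (kapz k * t)) /\
  (rot_im (fun t => a t * cos (k%:~R * t)) b = fun t => a t * sin (kapz k * t)).
Proof.
move=> bE; have E t : kapz k * t = k%:~R * t + t / 2 by rewrite /kapz; field.
split; apply/funext => t; rewrite /rot_re /rot_im bE E ?cosD ?sinD; ring.
Qed.

Lemma F_plus_fourier k t : period t -> F_plus nu beta (fourier k 1) t =
  col2 0 (Complex (beta * gcoefz l k / N * cos_plus t * cos (k%:~R * t))
                  (beta * gcoefz l k / N * cos_plus t * sin (k%:~R * t))).
Proof.
move=> pt; have tT : 0 <= t <= T by move: pt; rewrite /period/= in_itv.
have [rre rim] := @rot_fourier (fun=> N^-1) (fun t => N^-1 * sin (k%:~R * t)) k (fun=> erefl).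
rewrite F_plusE; congr col2.
rewrite (@resolventE _ beta l lE ln0 cl0 (fun t => N^-1 * cos (k%:~R * t))
  (fun t => N^-1 * sin (k%:~R * t))) //; first last.
- by move=> s _; rewrite fourier1E mulrC [_ / N]mulrC.
- by cont.
- by cont.
rewrite rre rim !GreenZ; [|by cont..].
rewrite Green_cos// Green_sin//.
have E : k%:~R * t = kapz k * t - t / 2 by rewrite /kapz; field.
by apply/eqP; rewrite eq_complex/= E cosB sinB; apply/andP; split; apply/eqP; ring.
Qed.

(** Only the resolvent acting directly on the Fourier mode is evaluated, giving the eigenvalue
    [gcoefz l k]; the other stays an integral against [green]. Summation over [k] turns the
    eigenvalues into [fsum], an approximation of [green], so the trace tends to a double integral of
    [green ^+ 2]. *)
Lemma inner_F_plus2 k :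
  complex.Re (inner ((F_plus nu beta \o F_plus nu beta) (fourier k 1)) (fourier k 1)) =
  beta ^+ 2 * (T^-1 * (gcoefz l k * itg 0 T (fun t => cos_plus t *
     conv (fun x => green l x * cos (kapz k * x)) (@cos_plus R) t))).
Proof.
have cp := @cont_cos_plus R; have N0 := N_gt0.
pose a t : R := beta * gcoefz l k / N * cos_plus t.
have ca : continuous a by rewrite /a; cont.
have [rre rim] := @rot_fourier a (fun t => a t * sin (k%:~R * t)) k (fun=> erefl).
pose Gc := Green l (fun t => cos_plus t * cos (kapz k * t)).
pose Gs := Green l (fun t => cos_plus t * sin (kapz k * t)).
have cGc : continuous Gc by apply: cont_Green; cont.
have cGs : continuous Gs by apply: cont_Green; cont.
have reE t : Green l (rot_re (fun t => a t * cos (k%:~R * t)) (fun t => a t * sin (k%:~R * t))) t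
    = beta * gcoefz l k / N * Gc t.
  by rewrite rre /Gc -GreenZ; [apply: itg_ext => s _; rewrite /a; ring|cont].
have imE t : Green l (rot_im (fun t => a t * cos (k%:~R * t)) (fun t => a t * sin (k%:~R * t))) t
    = beta * gcoefz l k / N * Gs t.
  by rewrite rim /Gs -GreenZ; [apply: itg_ext => s _; rewrite /a; ring|cont].
have cc : continuous (conv (fun x => green l x * cos (kapz k * x)) (@cos_plus R)).
  apply: cont_conv => //; apply: bounded_lipschitzM;
    [exact: bounded_lipschitz_green|exact: bounded_lipschitz_cos].
rewrite /inner/= -/(itg 0 T _).
transitivity (itg 0 T (fun t => beta ^+ 2 * (T^-1 * (gcoefz l k * (cos_plus t *
     conv (fun x => green l x * cos (kapz k * x)) (@cos_plus R) t))))); last first.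
  by rewrite !itgZ//; cont.
apply: itg_ext => t tT; rewrite big_ord_recl big_ord1.
have pt : period t by rewrite /period/= in_itv.
have -> : lift ord0 ord0 = 1 :> 'I_2 by exact/val_inj.
rewrite F_plusE col2_0 col2_1 mul0r add0r fourier1E col2_1.
rewrite (@resolventE _ beta l lE ln0 cl0 (fun t => a t * cos (k%:~R * t))
  (fun t => a t * sin (k%:~R * t))) //; first last.
- by move=> s ps; rewrite F_plus_fourier.
- by cont.
- by cont.
rewrite reE imE /=.
have -> : conv (fun x => green l x * cos (kapz k * x)) (@cos_plus R) t =
    cos (kapz k * t) * Gc t + sin (kapz k * t) * Gs t.
  have cg := @cont_green R l.
  rewrite /Gc /Gs /Green -!itgZ; [|by apply: (@cont_conv_in R (green l)); cont..].
  rewrite -itgD; first last.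
  - by apply: contM; [cont|apply: (@cont_conv_in R (green l)); cont].
  - by apply: contM; [cont|apply: (@cont_conv_in R (green l)); cont].
  by apply: itg_ext => s _; rewrite mulrBr cosB; ring.
have E : kapz k * t = k%:~R * t + t / 2 by rewrite /kapz; field.
have := N_sqr; move: N0; set n := N => n0 nn.
rewrite E cosD sinD -nn; field.
by rewrite gt_eqF.
Qed.

Lemma inner_F_plus2_0 k : complex.Re (inner
  ((F_plus nu beta \o F_plus nu beta) (fourier k 0)) (fourier k 0)) = 0.
Proof.
apply: innerE0 => t; last exact: fourier0E.
by rewrite [LHS](_ : _ = F_plus nu beta (F_plus nu beta (fourier k 0)) t 0 0)// F_plusE col2_0.
Qed.

Lemma Re_trace_partial n :
  complex.Re (trace_partial (F_plus nu beta \o F_plus nu beta) n) =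
  beta ^+ 2 * itg 0 T (fun t => cos_plus t *
     conv (fun x => green l x * fsum l n x) (@cos_plus R) t).
Proof.
have cp := @cont_cos_plus R; have cg := @cont_green R l.
have bK k : bounded_lipschitz (fun x : R => green l x * cos (kapz k * x)).
  apply: bounded_lipschitzM; first exact: bounded_lipschitz_green.
  exact: bounded_lipschitz_cos.
rewrite /trace_partial Re_sum.
transitivity (\sum_(m < n.*2.+1) beta ^+ 2 * (T^-1 * (gcoefz l (m%:Z - n%:Z) *
    itg 0 T (fun t => cos_plus t *
     conv (fun x => green l x * cos (kapz (m%:Z - n%:Z) * x)) (@cos_plus R) t)))).
  apply: eq_bigr => m _; rewrite Re_sum; move: (m%:Z - n%:Z) => k.
  rewrite (sum_ord2 (fun j => complex.Re (inner
    ((F_plus nu beta \o F_plus nu beta) (fourier k j)) (fourier k j)))).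
  exact: etrans (f_equal2 +%R (inner_F_plus2_0 k) (inner_F_plus2 k)) (add0r _).
rewrite -!mulr_sumr; congr (_ * _).
pose G (m : nat) t := gcoefz l (m%:Z - n%:Z) * (cos_plus t *
     conv (fun x => green l x * cos (kapz (m%:Z - n%:Z) * x)) (@cos_plus R) t).
have cG m : continuous (G m) by rewrite /G; cont; apply: cont_conv.
transitivity (T^-1 * itg 0 T (fun t => \sum_(m < n.*2.+1) G m t)).
  rewrite itg_sum//; congr (_ * _); apply: eq_bigr => m _; rewrite -itgZ//.
  by cont; apply: cont_conv.
rewrite -itgZ; last exact: cont_sum.
apply: itg_ext => t _; rewrite mulr_sumr.
pose H (m : nat) s := T^-1 * (gcoefz l (m%:Z - n%:Z) *
  (green l (t - s) * cos (kapz (m%:Z - n%:Z) * (t - s)) * cos_plus s)).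
have cgt : continuous (fun s => green l (t - s)).
  by apply: (cont_comp cg); cont.
have cH m : continuous (H m) by rewrite /H; cont.
transitivity (cos_plus t * itg 0 T (fun s => \sum_(m < n.*2.+1) H m s)); last first.
  congr (_ * _); apply: itg_ext => s _.
  rewrite /fsum !mulr_sumr !mulr_suml; apply: eq_bigr => m _.
  by rewrite /H /kapz; ring.
rewrite itg_sum// mulr_sumr; apply: eq_bigr => m _.
rewrite /G /H !itgZ//; [|by cont..].
by rewrite /conv; ring.
Qed.

Lemma f_minus1E : f_minus1 beta = beta ^+ 2 * hs_norm l (@cos_plus R).
Proof.
have cp := @cont_cos_plus R; have cg := @cont_green R l.
rewrite /f_minus1 /trF2 /trace/=; apply/cvg_lim => //.
pose I : R := itg 0 T (fun t => `|cos_plus t|).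
have [M [k [M0 _ gM _]]] := @bounded_lipschitz_green R l.
have I0 : 0 <= I by exact: itg_ge0.
have bS n : bounded_lipschitz (fun x => green l x * fsum l n x).
  apply: bounded_lipschitzM; first exact: bounded_lipschitz_green.
  apply: bounded_lipschitzM; first exact: bounded_lipschitz_cst.
  elim: (n.*2.+1) => [|m ih].
    have -> : (fun t => \sum_(m < 0) gcoefz l (m%:Z - n%:Z) *
       cos (((m%:Z - n%:Z)%:~R + 2^-1) * t)) = fun=> 0.
      by apply/funext => t; rewrite big_ord0.
    exact: bounded_lipschitz_cst.
  have -> : (fun t => \sum_(j < m.+1) gcoefz l (j%:Z - n%:Z) *
       cos (((j%:Z - n%:Z)%:~R + 2^-1) * t)) = (fun t => \sum_(j < m)
    gcoefz l (j%:Z - n%:Z) * cos (((j%:Z - n%:Z)%:~R + 2^-1) * t) +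
    gcoefz l (m%:Z - n%:Z) * cos (((m%:Z - n%:Z)%:~R + 2^-1) * t)).
    by apply/funext => t; rewrite big_ord_recr.
  apply: bounded_lipschitzD => //.
  apply: (@bounded_lipschitzM _ (fun=> gcoefz l (m%:Z - n%:Z)));
    [exact: bounded_lipschitz_cst|exact: bounded_lipschitz_cos].
have bG : bounded_lipschitz (fun x : R => green l x * green l x).
  by apply: bounded_lipschitzM; exact: bounded_lipschitz_green.
(* The kernel error [2 / n.+1] is multiplied by the bound [M] of [green] and integrated against
   [cos_plus] in both variables. *)
have key n : `|complex.Re (trace_partial (F_plus nu beta \o F_plus nu beta) n.+1) -
    beta ^+ 2 * hs_norm l (@cos_plus R)| <= beta ^+ 2 * (I * (M * 2 * I)) / n.+1%:R.
  rewrite Re_trace_partial -mulrBr normrM ger0_norm ?sqr_ge0// -mulrA.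
  rewrite ler_wpM2l ?sqr_ge0//.
  rewrite /hs_norm -itgB; [|by apply: contM => //; exact: cont_conv..].
  have -> : I * (M * 2 * I) / n.+1%:R = (M * (2 / n.+1%:R) * I) * I by ring.
  rewrite {2}/I -itgZ; last by cont.
  apply: itg_norm_dom; [|by cont|] => [|t tT].
    by apply: contD; [|apply: contN]; apply: contM => //; exact: cont_conv.
  rewrite -mulrBr normrM mulrC ler_wpM2r//.
  apply: conv_bound => //; try exact: bounded_lipschitz_cont.
  by move=> x xT; rewrite -mulrBr normrM ler_pM// ?fsum_cvg_green.
apply/cvgrPdist_lt => e e0.
pose c := beta ^+ 2 * (I * (M * 2 * I)).
exists (Num.bound `|c / e|).+1 => // m /= bm.
case: m bm => // m bm; rewrite distrC; apply: (le_lt_trans (key m)); rewrite -/c.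
rewrite ltr_pdivrMr ?ltr0n// mulrC -ltr_pdivrMr//.
apply: (le_lt_trans (ler_norm _)).
apply: (lt_le_trans (archi_boundP (normr_ge0 _))); rewrite ler_nat.
by rewrite (leq_trans (leqnSn _)).
Qed.

End TraceFormula.

(** * Exclusion of real multipliers *)

Section Jacobi.
Variable R : realType.
Implicit Types (h x y : R -> R) (s t a b : R).
Local Notation T := (2 * pi : R).

(* Jacobi's substitution: completing the square in [h'^2 - Q h^2] by means of a
   solution [s] of [s'' = - Q s]. *)
Lemma jacobi_der h h1 (s s1 : R -> R) t (Q h2 : R) : s t != 0 ->
  has_der h t (h1 t) -> has_der h1 t h2 ->
  has_der s t (s1 t) -> has_der s1 t (- Q * s t) ->
  has_der (fun t => h t * h1 t - h t ^+ 2 * s1 t / s t) t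
    ((h1 t - h t * s1 t / s t) ^+ 2 + (h2 + Q * h t) * h t).
Proof.
move=> s0 dh dh1 ds ds1.
by apply: der_eq; [der|cbv beta; field].
Qed.

Lemma intermediate_zero x a b : continuous x -> a <= b -> x a * x b <= 0 ->
  exists2 c, a <= c <= b & x c = 0.
Proof.
move=> cx ab xab; have [|c] := @IVT R x a b 0 ab (cont_within cx).
  rewrite ge_min le_max.
  have [xa|xa] := leP (x a) 0; have [xb|xb] := leP (x b) 0 => /=.
  - have [//|xa'] := leP 0 (x a).
    by move: xab; rewrite nmulr_rle0.
  - by rewrite (ltW xb) orbT.
  - by rewrite (ltW xa).
  - by move: xab; rewrite leNgt mulr_gt0.
by rewrite in_itv/= => cab xc; exists c.
Qed.

Lemma pos_right_of_zero x y t0 b : continuous x -> continuous y -> t0 < b ->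
  (forall t, t0 < t < b -> has_der x t (y t)) -> x t0 = 0 -> 0 < y t0 ->
  (forall t, t0 < t <= b -> x t <> 0) -> 0 < x b.
Proof.
move=> cx cy tb dx xt0 yt0 xnz; rewrite ltNge; apply/negP => xb.
have /cvgrPdist_lt/(_ _ yt0)/nbhs_ballP[d /= d0 yd] := cy t0.
pose r := Num.min (d / 2) ((b - t0) / 2).
have r0 : 0 < r by rewrite lt_min !divr_gt0// subr_gt0.
have rd : r <= d / 2 by rewrite ge_min lexx.
have rb : r <= (b - t0) / 2 by rewrite ge_min lexx orbT.
clearbody r.
have dx' t : t \in `]t0, t0 + r[ -> is_derive t 1 x (y t).
  by rewrite in_itv/= => /andP[? ?]; apply: dx; apply/andP; split; lra.
have tr : t0 < t0 + r by rewrite ltrDl.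
have [s] := MVT tr dx' (cont_within cx).
rewrite in_itv/= xt0 subr0 addrAC subrr add0r => /andP[s1 s2] xc.
have ys : 0 < y s.
  have : ball t0 d s by rewrite /ball/= ltr0_norm ?subr_lt0//; lra.
  by move=> /yd/=; rewrite ltr_norml => /andP[_]; lra.
have xc0 : 0 < x (t0 + r) by rewrite xc mulr_gt0.
have [||c /andP[c1 c2]] := @intermediate_zero x (t0 + r) b cx.
- by lra.
- by rewrite pmulr_rle0.
- by apply: xnz; rewrite c2 andbT; lra.
Qed.

Lemma neg_left_of_zero x y a t0 : continuous x -> continuous y -> a < t0 ->
  (forall t, a < t < t0 -> has_der x t (y t)) -> x t0 = 0 -> 0 < y t0 ->
  (forall t, a <= t < t0 -> x t <> 0) -> x a < 0.
Proof.
move=> cx cy at0 dx xt0 yt0 xnz.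
suff : 0 < - x (- - a) by rewrite opprK oppr_gt0.
apply: (@pos_right_of_zero (fun t => - x (- t)) (fun t => y (- t)) (- t0)).
- apply: (@contN _ (fun t => x (- t))).
  by apply: (@cont_comp _ x (fun t => - t)) => //; cont.
- by apply: (@cont_comp _ y (fun t => - t)) => //; cont.
- by rewrite ltrN2.
- move=> t tt; have tt' : a < - t < t0 by rewrite ltrNr andbC ltrNl.
  have dn : has_der (fun u : R => - u) t (- 1) by der.
  have := @is_derive1_comp _ x (fun u => - u) t _ _ (dx _ tt') dn.
  by move=> D; apply: der_eq (derN D) _; ring.
- by rewrite opprK xt0 oppr0.
- by rewrite opprK.
- move=> t /andP[t1 t2] /eqP; rewrite oppr_eq0 => /eqP; apply: xnz.
  by rewrite lerNr t2/= ltrNl.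
Qed.

Variables (beta e : R).
Hypothesis b0 : 0 < beta.
Hypothesis b1 : beta < 1.
Hypothesis e0 : 0 <= e.
Hypothesis e1 : e < 1.

Definition ecc t : R := 1 + e * cos t.
Definition pot t : R := 1 - beta / ecc t.

Lemma ecc_ge t : 1 - e <= ecc t.
Proof. by rewrite /ecc lerD2l lerNl -mulrN ler_piMr// lerNl cos_geN1. Qed.

Lemma ecc_gt0 t : 0 < ecc t.
Proof. by apply: lt_le_trans (ecc_ge t); rewrite subr_gt0. Qed.

Lemma ecc_lt2 t : ecc t < 2.
Proof.
rewrite /ecc (natrD R 1 1) ltrD2l (le_lt_trans _ e1)//.
by rewrite ler_piMr// cos_le1.
Qed.

Lemma cont_ecc : continuous ecc.
Proof. by rewrite /ecc; cont. Qed.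

Lemma cont_pot : continuous pot.
Proof.
have c := cont_ecc; rewrite /pot; cont.
by move=> t; rewrite gt_eqF// ecc_gt0.
Qed.

Lemma pot_lt t : pot t < 1 - beta / 2.
Proof.
rewrite /pot ltrD2l ltrN2 ltr_pM2l// ltf_pV2 ?posrE ?ecc_gt0//.
exact: ecc_lt2.
Qed.

(** * Floquet solutions and Sturm comparison *)

Variables (x y : R -> R) (rho : R).
Hypothesis cx : continuous x.
Hypothesis cy : continuous y.
Hypothesis dx : forall t, 0 < t < T -> has_der x t (y t).
Hypothesis dy : forall t, 0 < t < T -> has_der y t (- pot t * x t).
Hypothesis xy0 : forall t, 0 <= t <= T -> x t = 0 -> y t <> 0.
Hypothesis rho0 : rho != 0.
Hypothesis xT : x T = rho * x 0.
Hypothesis yT : y T = rho * y 0.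

(** On an interval of zeros the derivative [y] would vanish too, contrary to [xy0]. *)
Lemma nonzero_in a b : 0 <= a -> a < b -> b <= T -> exists2 c, a < c < b & x c != 0.
Proof.
move=> a0 ab bT; apply: contrapT => nz.
have xz t : a < t < b -> x t = 0.
  move=> tab; apply/eqP; apply: contrapT => /negP xt; apply: nz; by exists t.
pose c := (a + b) / 2.
have cab : a < c < b by rewrite /c; apply/andP; split; lra.
have c0T : 0 < c < T.
  by case/andP: cab => ac cb; rewrite (le_lt_trans a0)// (lt_le_trans cb).
have dc := dx c0T.
have : has_der x c 0.
  apply: (@near_eq_is_derive _ _ _ (fun=> 0)) (der_cst 0 c).
  have : \forall t \near c, t \in `]a, b[ by apply: near_in_itvoo; rewrite in_itv.
  by apply: filterS => t; rewrite in_itv/= => /xz ->.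
move=> [_ d0]; case: dc => _ dc; have yc : y c = 0 by rewrite -dc d0.
apply: (xy0 _ (xz _ cab)) yc.
by case/andP: c0T => /ltW -> /ltW ->.
Qed.

(** The frequency comes from [ecc < 2], which gives [pot < 1 - beta / 2]; it is below [1] because
    [beta] is positive. *)
Let om : R := Num.sqrt (1 - beta / 2).

Let om2 : om ^+ 2 = 1 - beta / 2.
Proof. by have b := b1; rewrite sqr_sqrtr//; lra. Qed.

Let om_gt0 : 0 < om.
Proof. by have b := b1; rewrite sqrtr_gt0; lra. Qed.

Let om_lt1 : om < 1.
Proof. by have b := b0; rewrite -sqrtr1 ltr_sqrt//; lra. Qed.

(** The boundary term of Jacobi's identity for [h = x] and the comparison solution
    [sin (om t + th)]. *)
Let psi th t : R := x t * y t - x t ^+ 2 * (om * cos (om * t + th)) / sin (om * t + th).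

(** The derivative of [psi] is a square plus [(om^2 - pot) x^2], whose integral is positive because
    [x] vanishes on no interval. *)
Lemma psi_lt th a b : 0 <= a -> a < b -> b <= T ->
  (forall t, a <= t <= b -> 0 < om * t + th < pi) -> psi th a < psi th b.
Proof.
move=> a0 ab bT thp.
have s0 t : a <= t <= b -> sin (om * t + th) != 0.
  by move=> /thp/sin_gt0_pi; rewrite lt_neqAle eq_sym => /andP[].
have cp := cont_pot.
pose g t : R := (om ^+ 2 - pot t) * x t ^+ 2.
have cg : continuous g by rewrite /g; cont.
have g0 t : 0 <= g t.
  by rewrite /g mulr_ge0 ?sqr_ge0// om2 subr_ge0 ltW// pot_lt.
have [G [cG G0 dG]] := primitive cg.
have : 0 < itg a b g.
  have [c cab xc] := nonzero_in a0 ab bT.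
  apply: (itg_gt0 cab cg) => //.
  rewrite /g mulr_gt0 ?exprn_even_gt0//= om2 subr_gt0; exact: pot_lt.
have -> : itg a b g = G b - G a.
  apply: FTC => //; first exact: ltW.
  by move=> t /andP[at_ _]; apply: dG; exact: le_lt_trans at_.
have : psi th a - G a <= psi th b - G b.
  apply: (@nondecr_except R (fun t => psi th t - G t)
    (fun t => (y t - x t * (om * cos (om * t + th)) / sin (om * t + th)) ^+ 2) a a b).
  - exact: ltW.
  - apply: cont_in_within => t /s0 st; rewrite /psi.
    apply: continuousB; last exact: cG.
    apply: continuousB; first by apply: continuousM; [exact: cx|exact: cy].
    apply: continuousM; last first.
      apply: continuousV => //; apply: (_ : continuous (fun t => sin (om * t + th))).
      by cont.
    by apply: (_ : continuous (fun t => x t ^+ 2 * (om * cos (om * t + th)))); cont.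
  - move=> t /andP[at_ tb] _.
    have tT : 0 < t < T by rewrite (le_lt_trans a0)// (lt_le_trans tb).
    have st : sin (om * t + th) != 0 by apply: s0; rewrite !ltW.
    have dGt : has_der G t (g t) by apply: dG; case/andP: tT.
    have ds : has_der (fun t => sin (om * t + th)) t (om * cos (om * t + th)).
      by apply: der_eq; [der|cbv beta; ring].
    have ds1 : has_der (fun t => om * cos (om * t + th)) t
        (- om ^+ 2 * sin (om * t + th)).
      by apply: der_eq; [der|cbv beta; ring].
    have J := jacobi_der st (dx tT) (dy tT) ds ds1.
    apply: der_eq (derD J (derN dGt)) _.
    by rewrite /g; ring.
  - by move=> t _ _; exact: sqr_ge0.
by lra.
Qed.

(** As [psi] vanishes at zeros of [x], two zeros cannot be joined by an arc of length at most [pi],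
    on which a suitable comparison sine stays positive. One of the two arcs around the circle is
    that short; across [T], with matching phases, [psi] only acquires the factor [rho^2]. *)
Lemma zero_unique t0 t1 : 0 <= t0 -> t0 < t1 -> t1 < T -> x t0 = 0 -> x t1 = 0 -> False.
Proof.
move=> t00 t01 t1T x0 x1; have pi0 := @pi_gt0 R.
(* A phase starting at [eta] and moving at speed [om < 1] reaches [pi - eta] after time [pi], so the
   sine stays positive throughout. *)
pose eta : R := (1 - om) * pi / 2.
have eta0 : 0 < eta by rewrite divr_gt0// mulr_gt0// subr_gt0.
have opi : om * pi + eta = pi - eta by rewrite /eta; field.
have arg c : 0 <= c <= pi -> 0 < om * c + eta < pi.
  move=> /andP[c0 cp]; apply/andP; split.
    by rewrite ltr_wpDl// mulr_ge0// ltW.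
  apply: (@le_lt_trans _ _ (om * pi + eta)); last by rewrite opi ltrBlDr ltrDl.
  by rewrite lerD2r ler_pM2l.
have [tp|tp] := leP (t1 - t0) pi.
  suff : psi (- om * t0 + eta) t0 < psi (- om * t0 + eta) t1.
    by rewrite /psi x0 x1 !mul0r expr0n/= !mul0r subrr ltxx.
  apply: psi_lt => //; first exact: ltW.
  move=> t /andP[ta tb].
  have -> : om * t + (- om * t0 + eta) = om * (t - t0) + eta by ring.
  by apply: arg; apply/andP; split; lra.
have : 0 < psi (- om * t1 + eta) T.
  have -> : 0 = psi (- om * t1 + eta) t1 by rewrite /psi x1 mul0r expr0n/= !mul0r subrr.
  apply: psi_lt => //; first exact: ltW (le_lt_trans t00 t01).
  move=> t /andP[ta tb].
  have -> : om * t + (- om * t1 + eta) = om * (t - t1) + eta by ring.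
  by apply: arg; apply/andP; split; lra.
have -> : psi (- om * t1 + eta) T = rho ^+ 2 * psi (om * T - om * t1 + eta) 0.
  rewrite /psi xT yT.
  have -> : om * T + (- om * t1 + eta) = om * 0 + (om * T - om * t1 + eta) by ring.
  by ring.
have : psi (om * T - om * t1 + eta) 0 <= 0.
  move: t00; rewrite le_eqVlt => /predU1P[t0E|t00].
    move: x0; rewrite -t0E => x0.
    by rewrite /psi x0 mul0r expr0n/= !mul0r subrr.
  have E : psi (om * T - om * t1 + eta) t0 = 0.
    by rewrite /psi x0 mul0r expr0n/= !mul0r subrr.
  rewrite -[leRHS]E.
  apply/ltW/psi_lt => //; first exact: ltW (lt_trans t01 t1T).
  move=> t /andP[ta tb].
  have -> : om * t + (om * T - om * t1 + eta) = om * (t + T - t1) + eta by ring.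
  by apply: arg; apply/andP; split; lra.
by move=> P2; apply/negP; rewrite -leNgt mulr_ge0_le0// sqr_ge0.
Qed.

(** With a zero, normalized to cross upwards at its only zero, the solution is negative before and
    positive after it, so it cannot keep its sign over a period. Without one, Jacobi's identity with
    [h = ecc] and denominator [x] yields a square plus [(1 - beta) ecc > 0], while its boundary term
    takes the same value at both ends. *)
Lemma no_pos_multiplier : 0 < rho -> False.
Proof.
move=> rp; have pi0 := @pi_gt0 R; have T0 := twopi_gt0 R.
have [[t0 /andP[t00 t0T] xt0]|nz] := pselect (exists2 t0, 0 <= t0 < T & x t0 = 0).
  have yt0 : y t0 <> 0 by apply: xy0 => //; rewrite t00 ltW.
  pose X t := y t0 * x t; pose Y t := y t0 * y t.
  have cX : continuous X by rewrite /X; cont.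
  have cY : continuous Y by rewrite /Y; cont.
  have dX t : 0 < t < T -> has_der X t (Y t).
    by move=> tT; have d := dx tT; apply: der_eq; [rewrite /X; der|rewrite /Y; ring].
  have Xt0 : X t0 = 0 by rewrite /X xt0 mulr0.
  have Yt0 : 0 < Y t0 by rewrite /Y -expr2 exprn_even_gt0//=; exact/eqP.
  have Xnz t : x t <> 0 -> X t <> 0.
    by move=> xt /eqP; rewrite mulf_eq0 => /orP[/eqP/yt0|/eqP/xt].
  have nzr t : t0 < t < T -> x t <> 0.
    by move=> /andP[t1 t2]; exact: zero_unique t00 t1 t2 xt0.
  (* A zero at [0] reappears at [T], again with upward slope, and the signs at [pi] predicted from
     the two ends disagree. *)
  move: t00; rewrite le_eqVlt => /predU1P[t0E|t00].
    have XT : X T = 0 by rewrite /X xT t0E xt0 !mulr0.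
    have YT : 0 < Y T.
      by rewrite /Y yT mulrCA mulr_gt0//; move: Yt0; rewrite /Y -t0E.
    have : 0 < X pi.
      apply: (@pos_right_of_zero X Y t0) => //; first by rewrite -t0E.
      - by move=> t /andP[t1 t2]; apply: dX; rewrite -t0E in t1; apply/andP; split; lra.
      - by move=> t /andP[t1 t2]; apply/Xnz/nzr; rewrite t1/=; lra.
    have : X pi < 0.
      apply: (@neg_left_of_zero X Y pi T) => //; first by lra.
      - by move=> t /andP[t1 t2]; apply: dX; apply/andP; split; lra.
      - by move=> t /andP[t1 t2]; apply/Xnz/nzr; rewrite -t0E t2 andbT; lra.
    by move=> /lt_trans /[apply]; rewrite ltxx.
  have x0 : x 0 <> 0 by move=> x0; exact: (zero_unique (lexx 0) t00 t0T x0 xt0).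
  have XT : 0 < X T.
    apply: (@pos_right_of_zero X Y t0) => //.
    - by move=> t /andP[t1 t2]; apply: dX; rewrite (lt_trans t00).
    - move=> t /andP[t1]; rewrite le_eqVlt => /predU1P[->|t2].
        apply: Xnz; rewrite xT => /eqP; rewrite mulf_eq0 (negPf rho0)/=.
        by move/eqP.
      by apply/Xnz/nzr; rewrite t1.
  have X0 : X 0 < 0.
    apply: (@neg_left_of_zero X Y 0 t0) => //.
    - by move=> t /andP[t1 t2]; apply: dX; rewrite t1 (lt_trans t2).
    - move=> t /andP[t1 t2]; apply: Xnz => xt.
      exact: (zero_unique t1 t2 t0T xt xt0).
  have : X T = rho * X 0 by rewrite /X xT; ring.
  move=> E; move: XT; rewrite E pmulr_rgt0// => /(lt_trans X0).
  by rewrite ltxx.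
have xnz t : 0 <= t <= T -> x t != 0.
  move=> /andP[t0 tT]; apply/eqP => xt; apply: nz.
  move: tT; rewrite le_eqVlt => /predU1P[tE|tT]; last by exists t; rewrite ?t0.
  exists 0; first by rewrite lexx.
  by move: xt; rewrite tE xT => /eqP; rewrite mulf_eq0 (negPf rho0) => /eqP.
pose k : R := (1 - beta) * (1 - e).
have k0 : 0 < k by rewrite mulr_gt0// subr_gt0.
pose psi0 t : R := ecc t * (- e * sin t) - ecc t ^+ 2 * y t / x t.
have : psi0 0 - k * 0 <= psi0 T - k * T.
  apply: (@nondecr_except R (fun t => psi0 t - k * t)
    (fun t => (- e * sin t - ecc t * y t / x t) ^+ 2
      + (- e * cos t + pot t * ecc t) * ecc t - k) 0 0 T).
  - exact: ltW.
  - apply: cont_in_within => t /xnz xt; rewrite /psi0; have ce := cont_ecc.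
    apply: continuousB; last by apply: (_ : continuous (fun t => k * t)); cont.
    apply: continuousB.
      by apply: (_ : continuous (fun t => ecc t * (- e * sin t))); cont.
    apply: continuousM; last by apply: continuousV => //; exact: cx.
    by apply: (_ : continuous (fun t => ecc t ^+ 2 * y t)); cont.
  - move=> t tT _; have xt : x t != 0 by apply: xnz; case/andP: tT => /ltW -> /ltW ->.
    have de : has_der ecc t (- e * sin t).
      by apply: der_eq; [rewrite /ecc; der|cbv beta; ring].
    have de1 : has_der (fun t => - e * sin t) t (- e * cos t).
      by apply: der_eq; [der|cbv beta; ring].
    have J := @jacobi_der ecc (fun t => - e * sin t) x y t (pot t) (- e * cos t)
      xt de de1 (dx tT) (dy tT).
    have dk : has_der (fun t => k * t) t k by apply: der_eq; [der|cbv beta; ring].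
    by apply: der_eq (derD J (derN dk)) _.
  - move=> t _ _; rewrite -addrA; apply: addr_ge0; first exact: sqr_ge0.
    have et := ecc_gt0 t.
    have -> : - e * cos t + pot t * ecc t = 1 - beta.
      by rewrite /pot mulrBl divfK ?gt_eqF// /ecc; ring.
    by rewrite subr_ge0 /k ler_pM2l ?subr_gt0// ecc_ge.
have -> : psi0 T = psi0 0.
  have cT : cos T = 1 :> R by rewrite mulr_natl cos2pi.
  have sT : sin T = 0 :> R by rewrite mulr_natl sin2pi.
  rewrite /psi0 /ecc cT sT cos0 sin0 xT yT; field.
  by rewrite rho0 xnz// lexx ltW.
rewrite mulr0 subr0 lerBrDr gerDl leNgt => /negP; apply.
by rewrite mulr_gt0.
Qed.

Lemma neg_multiplier_zero : rho < 0 -> exists2 t0, 0 <= t0 < T & x t0 = 0.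
Proof.
move=> rn; have T0 := twopi_gt0 R.
have [x0|x0] := eqVneq (x 0) 0; first by exists 0; rewrite ?lexx.
have [||t /andP[t0 tT] xt] := @intermediate_zero x 0 T cx.
- exact: ltW.
- by rewrite xT mulrCA -expr2 mulr_le0_ge0 ?sqr_ge0// ltW.
exists t => //; rewrite t0/= lt_neqAle tT andbT; apply/eqP => tE.
move: xt; rewrite tE xT => /eqP; rewrite mulf_eq0 (negPf rho0) (negPf x0).
by [].
Qed.

(** * Negative multipliers: the potential as a perturbation of a constant *)

Definition pot_diff t : R := beta * e * cos t / ecc t.

Lemma cont_pot_diff : continuous pot_diff.
Proof.
have c := cont_ecc; rewrite /pot_diff; cont.
by move=> t; rewrite gt_eqF// ecc_gt0.
Qed.

Lemma potE t : pot t = 1 - beta + pot_diff t.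
Proof.
have := ecc_gt0 t; rewrite /pot /pot_diff /ecc => u0; field.
by rewrite gt_eqF.
Qed.

Lemma pot_diff_le t : pot_diff t <= beta * e * cos_plus t.
Proof.
have u0 := ecc_gt0 t; rewrite /pot_diff /cos_plus -mulrA ler_wpM2l ?mulr_ge0 ?(ltW b0)//.
rewrite ler_pdivrMr//; have [c0|c0] := leP 0 (cos t).
  rewrite (ger0_norm c0); have -> : (cos t + cos t) / 2 = cos t by field.
  by rewrite ler_peMr// /ecc lerDl mulr_ge0.
by rewrite (ltr0_norm c0) subrr !mul0r ltW.
Qed.

Lemma pot_diff_ge t : - pot_diff t <= beta * (e / (1 - e)) * cos_minus t.
Proof.
have u0 := ecc_gt0 t; have e1' : 0 < 1 - e by rewrite subr_gt0.
rewrite /pot_diff /cos_minus; have [c0|c0] := leP 0 (cos t).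
  rewrite (ger0_norm c0) subrr mul0r mulr0 oppr_le0.
  by rewrite divr_ge0 ?mulr_ge0// ltW.
rewrite (ltr0_norm c0); have -> : beta * (e / (1 - e)) * ((- cos t - cos t) / 2) =
  beta * e * (- cos t) * (1 - e)^-1 by field; rewrite gt_eqF.
rewrite -mulNr -mulrN ler_wpM2l ?mulr_ge0 ?oppr_ge0 ?(ltW b0) ?(ltW c0)// lef_pV2 ?posrE//.
exact: ecc_ge.
Qed.

Variable l : R.
Hypothesis lE : l ^+ 2 = 1 - beta.
Hypothesis l0 : 0 < l.
Hypothesis l12 : l != 2^-1.

Let l1 : l <= 1.
Proof. by rewrite -(@expr_le1 _ 2 l isT (ltW l0)) lE gerBl ltW. Qed.

Let ln0 : l != 0. Proof. by rewrite gt_eqF. Qed.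
Let cl0 : cos (l * pi) != 0. Proof. exact: coslpi_neq0. Qed.

(** The Wronskian of the two solutions has equal values at both ends, being bilinear in antiperiodic
    functions; this replaces an interchange of integrals. *)
Lemma Green_sym h k : continuous h -> continuous k ->
  itg 0 T (fun t => h t * Green l k t) = itg 0 T (fun t => k t * Green l h t).
Proof.
move=> ch ck.
have [p [p1 sp]] := antiper_solvable ln0 cl0 ch.
have [g [g1 sg]] := antiper_solvable ln0 cl0 ck.
have pE t := green_repr (t := t) ln0 cl0 ch sp.
have gE t := green_repr (t := t) ln0 cl0 ck sg.
have [cp cp1 dp dp1 [pA p1A]] := sp; have [cg cg1 dg dg1 [gA g1A]] := sg.
have cGh := @cont_Green R l h ch; have cGk := @cont_Green R l k ck.
apply/eqP; rewrite -subr_eq0 -itgB; [|by cont..].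
pose W t := g1 t * p t - g t * p1 t.
have -> : itg 0 T (fun t => h t * Green l k t - k t * Green l h t) = W T - W 0.
  transitivity (itg 0 T (fun t => h t * g t - k t * p t)).
    by apply: itg_ext => t tT; rewrite pE// gE.
  apply: FTC; [exact: twopi_ge0|by cont|by rewrite /W; cont|] => t tT.
  have a1 := dp t tT; have a2 := dp1 t tT; have a3 := dg t tT; have a4 := dg1 t tT.
  by apply: der_eq; [rewrite /W; der|cbv beta; ring].
by rewrite /W pA p1A gA g1A; apply/eqP; ring.
Qed.

Section Kink.
Hypothesis rn : rho < 0.
Variable t0 : R.
Hypothesis t00 : 0 <= t0.
Hypothesis t0T : t0 < T.
Hypothesis xt0 : x t0 = 0.

(* Antiperiodic rescaling of the Floquet solution between its zeros [t0] and
   [t0 + 2 pi]: continuous, but its derivative jumps at [t0]. *)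
Definition kinked t : R := - rho * x (Num.min t t0) + x (Num.max t t0).
Definition jump : R := (- rho - 1) * y t0.
Let src t : R := pot_diff t * kinked t.

Lemma cont_kinked : continuous kinked.
Proof.
have cm : continuous (fun t => Num.min t t0) by apply: cont_min; cont.
have cM : continuous (fun t => Num.max t t0) by apply: cont_max; cont.
apply: contD; first (apply: contM; first by cont).
  exact: (cont_comp cx cm).
exact: (cont_comp cx cM).
Qed.

Lemma kinked_le t : t <= t0 -> kinked t = - rho * x t.
Proof. by move=> tt; rewrite /kinked min_l// max_r// xt0 addr0. Qed.

Lemma kinked_ge t : t0 <= t -> kinked t = x t.
Proof. by move=> tt; rewrite /kinked min_r// max_l// xt0 mulr0 add0r. Qed.

Let cont_src : continuous src.
Proof. by have c1 := cont_pot_diff; have c2 := cont_kinked; rewrite /src; cont. Qed.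

(** Off [t0] the equation is [- kinked'' - l^2 kinked = pot_diff * kinked], and the factor [- rho]
    on the left piece makes value and slope antiperiodic, so the corner formula applies. *)
Lemma kinked_repr t : 0 <= t <= T ->
  kinked t = jump * green l (t - t0) + Green l src t.
Proof.
have t0T' : t0 <= T by exact: ltW.
have -> : jump = - rho * y t0 - y t0 by rewrite /jump; ring.
have lt_ev s : s < t0 -> \forall u \near s, - rho * x u = kinked u.
  move=> st; have : \forall u \near s, u < t0 by exact: lt_nbhsl.
  by apply: filterS => u /ltW ut; rewrite kinked_le.
have gt_ev s : t0 < s -> \forall u \near s, x u = kinked u.
  move=> st; have : \forall u \near s, t0 < u by exact: lt_nbhsr.
  by apply: filterS => u /ltW ut; rewrite kinked_ge.
apply: (@green_repr_kink R kinked (fun t => - rho * y t) y src l t0 t ln0 cl0) => //.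
- exact: cont_kinked.
- by cont.
- by apply/andP.
- move=> s /andP[s0 st]; have sT : 0 < s < T by rewrite s0 (lt_le_trans st).
  have dxs := dx sT; have : has_der (fun t => - rho * x t) s (- rho * y s).
    by apply: der_eq; [der|cbv beta; ring].
  exact: near_eq_is_derive (lt_ev _ st).
- move=> s /andP[s0 st]; have sT : 0 < s < T by rewrite s0 (lt_le_trans st).
  have dys := dy sT; apply: der_eq; first by der.
  by cbv beta; rewrite /src kinked_le ?ltW// potE lE; ring.
- move=> s /andP[s0 st]; have sT : 0 < s < T by rewrite (le_lt_trans t00).
  exact: near_eq_is_derive (gt_ev _ s0) (dx sT).
- move=> s /andP[s0 st]; have sT : 0 < s < T by rewrite (le_lt_trans t00).
  apply: der_eq (dy sT) _.
  by rewrite /src kinked_ge ?ltW// potE lE; ring.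
- by rewrite kinked_ge// kinked_le// xT; ring.
- by rewrite yT; ring.
Qed.

Lemma kinked_neq0 c : 0 <= c <= T -> x c != 0 -> kinked c != 0.
Proof.
move=> _ xc; have [ct|/ltW ct] := leP c t0; last by rewrite kinked_ge.
by rewrite kinked_le// mulf_neq0// oppr_eq0.
Qed.

(* Cauchy-Schwarz for the positive Green kernel between the source measure of
   [kinked] and [cos_plus * kinked]. *)
Lemma no_neg_multiplier_lt : l < 2^-1 ->
  e * (beta * Num.sqrt (hs_norm l (@cos_plus R))) < 1 ->
  0 < Num.sqrt (hs_norm l (@cos_plus R)) -> False.
Proof.
move=> l2; set k := Num.sqrt _ => ek k0.
have cp := @cont_cos_plus R; have cK := cont_kinked; have cpd := cont_pot_diff.
have cS := cont_src.
pose r t : R := cos_plus t * kinked t.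
have cr : continuous r by rewrite /r; cont.
have cGr := @cont_Green R l r cr; have cGs := @cont_Green R l src cS.
pose n := itg 0 T (fun t => cos_plus t * kinked t ^+ 2).
pose D := itg 0 T (fun t => r t * Green l r t).
have T0 := twopi_gt0 R; have pi0 := @pi_gt0 R.
have t0T2 : 0 <= t0 <= T by rewrite t00 ltW.
have n0 : 0 < n.
  have [||c /andP[c0 cpi] xc] := @nonzero_in 0 (pi / 2) (lexx _).
  - by rewrite divr_gt0.
  - by lra.
  have c0T : 0 < c < T by apply/andP; split; lra.
  apply: (itg_gt0 c0T); first by cont.
    by move=> t _; rewrite mulr_ge0 ?sqr_ge0 ?cos_plus_ge0.
  have cc : 0 < cos c by apply: cos_gt0_pihalf; apply/andP; split; lra.
  rewrite mulr_gt0 ?exprn_even_gt0//=.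
    by rewrite /cos_plus divr_gt0// addr_gt0// normr_gt0 gt_eqF.
  by apply: kinked_neq0 => //; case/andP: c0T => /ltW -> /ltW ->.
have kt0 : kinked t0 = 0 by rewrite kinked_ge.
have at_t0 : jump * green l 0 + Green l src t0 = 0.
  by have := kinked_repr t0T2; rewrite kt0 subrr.
have conv_t0 h : Green l h t0 = itg 0 T (fun t => h t * green l (t - t0)).
  by apply: itg_ext => t _; rewrite mulrC /green distrC.
(* The point mass contributes the value of [Green l h] at [t0], by evenness of [green]. *)
have pair h : continuous h -> itg 0 T (fun t => h t * kinked t) =
    jump * Green l h t0 + itg 0 T (fun t => h t * Green l src t).
  move=> ch; have cg : continuous (fun t => green l (t - t0)).
    by apply: (cont_comp (@cont_green R l)); cont.
  rewrite conv_t0 -itgZ -?itgD; [|by cont..].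
  by apply: itg_ext => t tT; rewrite kinked_repr//; ring.
have D_le : D <= k * n.
  have hk : hs_norm l (@cos_plus R) <= k ^+ 2.
    by rewrite sqr_sqrtr// hs_norm_ge0// => t _; exact: cos_plus_ge0.
  have := Green_form_bound cp cK (fun t _ => cos_plus_ge0 t) (ltW k0) hk.
  move=> /(le_trans (ler_norm _)); apply: le_trans.
  by rewrite le_eqVlt; apply/orP; left; apply/eqP/itg_ext => t _; rewrite mulrA.
have sK_le : itg 0 T (fun t => src t * kinked t) <= beta * e * n.
  rewrite /n -itgZ; last by cont.
  apply: itg_le; [by cont|by cont|] => t _.
  by rewrite /src -mulrA -expr2 mulrA ler_wpM2r ?sqr_ge0// pot_diff_le.
have rK : itg 0 T (fun t => r t * kinked t) = n.
  by apply: itg_ext => t _; rewrite /r; ring.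
(* Let [m = jump delta_{t0} + src], so that [G m = kinked], which vanishes at [t0]. Positivity on
   [k m - r] reads [0 <= k^2 (src, kinked) - 2 k (r, kinked) + (r, G r)], and the right-hand side is
   at most [k n (beta e k - 1) < 0]. *)
have := @green_positive R l l0 l2 (k * jump) (fun t => k * src t + -1 * r t) t0 _ t0T2.
have GE t : Green l (fun t => k * src t + -1 * r t) t = k * Green l src t - Green l r t.
  have cgt : continuous (fun s => green l (t - s)).
    by apply: (cont_comp (@cont_green R l)); cont.
  rewrite /Green -itgZ -?itgB; [|by cont..].
  by apply: itg_ext => s _; ring.
move=> /(_ _)/wrap [|pos]; first by cont.
move: pos; rewrite GE.
have -> : itg 0 T (fun s => (k * src s + -1 * r s) * Green l (fun t => k * src t + -1 * r t) s)
  = k ^+ 2 * itg 0 T (fun s => src s * Green l src s)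
    - k * itg 0 T (fun s => src s * Green l r s)
    - k * itg 0 T (fun s => r s * Green l src s) + D.
  have c1 : continuous (fun s => k ^+ 2 * (src s * Green l src s)) by cont.
  have c2 : continuous (fun s => k * (src s * Green l r s)) by cont.
  have c3 : continuous (fun s => k * (r s * Green l src s)) by cont.
  have c4 : continuous (fun s => r s * Green l r s) by cont.
  have c12 := contD c1 (contN c2); have c123 := contD c12 (contN c3).
  have d1 : continuous (fun s => src s * Green l src s) by cont.
  have d2 : continuous (fun s => src s * Green l r s) by cont.
  have d3 : continuous (fun s => r s * Green l src s) by cont.
  rewrite /D -(itgZ _ _ _ d1) -(itgZ _ _ _ d2) -(itgZ _ _ _ d3).
  rewrite -(itgB _ _ c1 c2) -(itgB _ _ c12 c3) -(itgD _ _ c123 c4).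
  by apply: itg_ext => s _; rewrite GE; ring.
rewrite (Green_sym cS cr).
have := pair _ cr; rewrite rK => pr.
have := pair _ cS => ps.
rewrite -[n]/n in pr.
set gr := Green l r t0 in pr *; set gs := Green l src t0 in at_t0 ps *.
set A := itg 0 T (fun t => src t * Green l src t) in ps *.
set B := itg 0 T (fun t => r t * Green l src t) in pr *.
have gsE : jump * green l 0 = - gs by lra.
have -> : (k * jump) ^+ 2 * green l 0 + 2 * (k * jump) * (k * gs - gr)
    + (k ^+ 2 * A - k * B - k * B + D) = k ^+ 2 * (jump * gs + A) - 2 * k * n + D.
  have -> : (k * jump) ^+ 2 * green l 0 = k ^+ 2 * jump * (jump * green l 0) by ring.
  by rewrite gsE pr; ring.
rewrite -ps => pos.
have {pos} : 0 <= k ^+ 2 * (beta * e * n) - 2 * k * n + k * n.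
  apply: (le_trans pos); apply: lerD => //; rewrite lerD2r.
  by rewrite ler_wpM2l ?sqr_ge0.
have -> : k ^+ 2 * (beta * e * n) - 2 * k * n + k * n = k * n * (e * (beta * k) - 1).
  by ring.
rewrite leNgt => /negP; apply.
by rewrite pmulr_rlt0 ?mulr_gt0// subr_lt0.
Qed.

End Kink.

(** * Jacobi's identity across the zeros of the Floquet solution *)

Lemma mvt_between (f df : R -> R) a t : continuous f ->
  (forall u, 0 < u < T -> has_der f u (df u)) -> 0 <= a <= T -> 0 <= t <= T ->
  exists2 c, `|c - a| <= `|t - a| & f t - f a = df c * (t - a).
Proof.
move=> cf dF /andP[a0 aT] /andP[t0 tT].
have D c d : 0 <= c -> d <= T -> forall u, u \in `]c, d[ -> is_derive u 1 f (df u).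
  by move=> c0 dT u; rewrite in_itv/= => /andP[cu ud]; apply: dF; apply/andP; split; lra.
have [at_|/ltW ta] := leP a t.
  have [c] := MVT_segment at_ (D _ _ a0 tT) (cont_within cf).
  rewrite in_itv/= => /andP[ac ct] ->; exists c => //.
  by rewrite !ger0_norm ?subr_ge0// lerD2r.
have [c] := MVT_segment ta (D _ _ t0 aT) (cont_within cf).
rewrite in_itv/= => /andP[tc ca] E; exists c.
  by rewrite !ler0_norm ?subr_le0// lerN2 lerD2r.
by rewrite -(opprB a t) mulrN -E opprB.
Qed.

Let psi_w w w1 t : R := w t * w1 t - w t ^+ 2 * y t / x t.

(** The zero of [x] is simple and [w] vanishes there too, so [w^2 y / x] is of size [|w|]: by the
    mean value theorem [w / x] is a quotient of derivatives. Near [a], [|y|] lies between [1/2] and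
    [3/2] of [|y a|], whence the factor [3]. *)
Lemma psi_w_bound (w w1 : R -> R) a : continuous w -> continuous w1 ->
  (forall t, 0 < t < T -> has_der w t (w1 t)) -> 0 <= a <= T ->
  x a = 0 -> w a = 0 -> exists2 K, 0 <= K &
  \forall t \near a, 0 <= t <= T -> `|psi_w w w1 t| <= K * `|w t|.
Proof.
move=> cw cw1 dw aT xa wa; have ya : y a <> 0 by exact: xy0.
have ya0 : 0 < `|y a| by rewrite normr_gt0; exact/eqP.
pose C := `|w1 a| + 1.
exists (C + 3 * C); first by rewrite /C !addr_ge0// mulr_ge0// addr_ge0.
have /cvgrPdist_lt/(_ _ (divr_gt0 ya0 (ltr0n _ 2)))/nbhs_ballP[d1 /= d10 yd] := @cy a.
have /cvgrPdist_lt/(_ _ ltr01)/nbhs_ballP[d2 /= d20 wd] := cw1 a.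
have near1 t : `|t - a| < d1 -> `|y a| / 2 <= `|y t| <= 3 / 2 * `|y a|.
  rewrite distrC => /yd/= yt; have E1 := ler_norm (y a - y t).
  have H1 := lerB_dist (y a) (y t); have H2 := lerB_dist (y t) (y a).
  by rewrite distrC in H2; apply/andP; split; lra.
have near2 t : `|t - a| < d2 -> `|w1 t| <= C.
  rewrite distrC => /wd/= wt; have H2 := lerB_dist (w1 t) (w1 a).
  by rewrite distrC in H2; rewrite /C; lra.
apply/nbhs_ballP; exists (Num.min d1 d2); first by rewrite /= lt_min d10.
move=> t; rewrite /ball/= distrC lt_min => /andP[ta1 ta2] tT.
have [s1 s1a] := mvt_between cx dx aT tT; rewrite xa subr0 => xE.
have [s2 s2a] := mvt_between cw dw aT tT; rewrite wa subr0 => wE.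
have /andP[yl _] := near1 _ (le_lt_trans s1a ta1).
have /andP[_ yu] := near1 _ ta1.
have w1l := near2 _ (le_lt_trans s2a ta2).
have w1u := near2 _ ta2.
rewrite /psi_w; have [tE|tE] := eqVneq t a.
  by rewrite tE wa mul0r expr0n/= !mul0r subrr normr0 mulr0.
have ta0 : 0 < `|t - a| by rewrite normr_gt0 subr_eq0.
have ys0 : 0 < `|y s1| by apply: lt_le_trans yl; rewrite divr_gt0.
apply: (le_trans (ler_normB _ _)); rewrite mulrDl; apply: lerD.
  by rewrite normrM mulrC ler_wpM2r.
have -> : w t ^+ 2 * y t / x t = (w t * y t / x t) * w t by ring.
rewrite normrM ler_wpM2r// !normrM normfV xE wE !normrM.
have -> : `|w1 s2| * `|t - a| * `|y t| / (`|y s1| * `|t - a|) = `|w1 s2| * `|y t| / `|y s1|.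
  by field; rewrite !gt_eqF.
rewrite ler_pdivrMr//.
have C0 : 0 <= C by rewrite /C addr_ge0.
apply: (@le_trans _ _ (C * (3 / 2 * `|y a|))); first by rewrite ler_pM.
have -> : C * (3 / 2 * `|y a|) = 3 * C * (`|y a| / 2) by field.
by rewrite ler_wpM2l// mulr_ge0.
Qed.

(** Integrating Jacobi's identity with [h = w] and denominator [x] leaves a square, the boundary
    terms at [0] and [T] being equal. Every zero of [x] on the closed period is [t0] or, when
    [t0 = 0], its copy [T], so [w] vanishes at all of them. [F] only has to dominate the integrand,
    which lets a lower bound of the potential be inserted. *)
Lemma jacobi_ge0 (w w1 w2 F : R -> R) t0 : 0 <= t0 < T -> x t0 = 0 -> w t0 = 0 ->
  continuous w -> continuous w1 -> continuous F ->
  (forall t, 0 < t < T -> has_der w t (w1 t)) ->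
  (forall t, 0 < t < T -> has_der w1 t (w2 t)) ->
  w T = - w 0 -> w1 T = - w1 0 ->
  (forall t, 0 < t < T -> - (w2 t + pot t * w t) * w t <= F t) ->
  0 <= itg 0 T F.
Proof.
move=> /andP[t00 t0T] xt0 wt0 cw cw1 cF dw dw1 wA w1A wF.
have T0 := twopi_gt0 R.
have [I [cI I0 dI]] := primitive cF.
have -> : itg 0 T F = I T - I 0.
  by apply: FTC => //; [exact: ltW|move=> t /andP[? _]; exact: dI].
rewrite I0 subr0.
have xnz t : 0 < t < T -> t != t0 -> x t != 0.
  move=> /andP[t_gt0 tT]; rewrite neq_lt => /orP[tt|tt]; apply/eqP => xt.
    exact: (zero_unique (ltW t_gt0) tt t0T xt xt0).
  exact: (zero_unique t00 tt tT xt0 xt).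
have xwz t : 0 <= t <= T -> x t = 0 -> w t = 0.
  move=> /andP[tge tle] xt; have [->//|tn] := eqVneq t t0.
  move: tge; rewrite le_eqVlt => /predU1P[tE|tge].
    have [t0E|t0p] := leP t0 0.
      by move: tn; rewrite -tE eq_le t00 t0E.
    have x00 : x 0 = 0 by move: xt; rewrite -tE.
    by case: (zero_unique (lexx 0) t0p t0T x00 xt0).
  move: tle; rewrite le_eqVlt => /predU1P[tE|tle]; last first.
    by move: (xnz t); rewrite tge tle => /(_ isT tn)/eqP.
  have x00 : x 0 = 0.
    by move: xt; rewrite tE xT => /eqP; rewrite mulf_eq0 (negPf rho0) => /eqP.
  have [t0E|t0p] := leP t0 0; last by case: (zero_unique (lexx 0) t0p t0T x00 xt0).
  have t0E0 : t0 = 0 by apply/le_anti; rewrite t0E t00.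
  by rewrite tE wA -t0E0 wt0 oppr0.
have : psi_w w w1 0 + I 0 <= psi_w w w1 T + I T.
  apply: (@nondecr_except R (fun t => psi_w w w1 t + I t)
    (fun t => (w1 t - w t * y t / x t) ^+ 2 + (w2 t + pot t * w t) * w t + F t) t0 0 T).
  - exact: ltW.
  - apply/subspace_continuousP => t tT.
    have tT' : 0 <= t <= T by move: tT; rewrite /= in_itv.
    suff H : psi_w w w1 u @[u --> within `[0, T]%classic (nbhs t)] --> psi_w w w1 t.
      by apply: cvgD; [exact: H|apply: cvg_within_filter; exact: cI].
    have [xt|xt] := eqVneq (x t) 0.
      have wt := xwz _ tT' xt.
      have [K K0 nK] := psi_w_bound cw cw1 dw tT' xt wt.
      have -> : psi_w w w1 t = 0.
        by rewrite /psi_w wt mul0r expr0n/= !mul0r subrr.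
      apply/cvgrPdist_lt => eps eps0; rewrite near_withinE.
      have K1 : 0 < K + 1 by rewrite ltr_wpDl.
      have /cvgrPdist_lt/(_ _ (divr_gt0 eps0 K1)) nw := cw t.
      near=> u => /=; rewrite in_itv/= => uT; rewrite sub0r normrN.
      apply: (@le_lt_trans _ _ (K * `|w u|)); first by move: uT; near: u.
      apply: (@le_lt_trans _ _ ((K + 1) * `|w u|)); first by rewrite ler_wpM2r// lerDl.
      rewrite mulrC -ltr_pdivlMr//.
      have -> : `|w u| = `|w t - w u| by rewrite wt sub0r normrN.
      by near: u.
    apply: cvg_within_filter; apply: (_ : {for t, continuous (psi_w w w1)}).
    apply: continuousB; first by apply: continuousM; [exact: cw|exact: cw1].
    apply: continuousM; last by apply: continuousV => //; exact: cx.
    by apply: (_ : continuous (fun t => w t ^+ 2 * y t)); cont.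
  - move=> t tT tn; have xt := xnz _ tT tn.
    have dIt : has_der I t (F t) by apply: dI; case/andP: tT.
    exact: derD (jacobi_der xt (dw _ tT) (dw1 _ tT) (dx tT) (dy tT)) dIt.
  - by move=> t tT _; have := wF t tT; have := sqr_ge0 (w1 t - w t * y t / x t); lra.
rewrite I0 addr0; have -> : psi_w w w1 T = psi_w w w1 0.
  rewrite /psi_w wA w1A xT yT.
  (* If [x 0 = 0], both quotients are [0] by the convention [0^-1 = 0], and only the products [w w1]
     remain. *)
  have [x0|x0] := eqVneq (x 0) 0.
    by rewrite x0 mulr0 invr0 !mulr0; ring.
  by field; rewrite rho0 x0.
by rewrite lerDl.
Unshelve. all: by end_near. Qed.

Lemma Green_lin a b (f g : R -> R) t : continuous f -> continuous g ->
  Green l (fun s => a * f s + b * g s) t = a * Green l f t + b * Green l g t.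
Proof.
move=> cf cg; have cgt : continuous (fun s => green l (t - s)).
  by apply: (cont_comp (@cont_green R l)); cont.
have c1 : continuous (fun s => green l (t - s) * f s) by cont.
have c2 : continuous (fun s => green l (t - s) * g s) by cont.
rewrite /Green -(itgZ a _ _ c1) -(itgZ b _ _ c2) -itgD; [|by cont..].
by apply: itg_ext => s _; ring.
Qed.

Section Neumann.
Variables (q : R -> R) (tau : R).
Hypothesis cq : continuous q.
Hypothesis q0 : forall t, 0 <= q t.
Hypothesis tau0 : 0 <= tau.
Hypothesis tau1 : tau < 1.
Hypothesis qtau : hs_norm l q <= tau ^+ 2.

(* Partial sums of the Neumann series of [(1 + G q)^-1 v]. *)
Fixpoint neumann v n : R -> R :=
  if n is m.+1 then fun t => v t - Green l (fun s => q s * neumann v m s) t else v.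

Lemma cont_neumann v n : continuous v -> continuous (neumann v n).
Proof.
move=> cv; elim: n => [|n ih] //=.
by apply: contD => //; apply: contN; apply: cont_Green; cont.
Qed.

Lemma neumann_lin a b (f g : R -> R) n t : continuous f -> continuous g ->
  neumann (fun s => a * f s + b * g s) n t = a * neumann f n t + b * neumann g n t.
Proof.
move=> cf cg; elim: n t => [|n ih] //= t.
have c1 := @cont_neumann _ n cf; have c2 := @cont_neumann _ n cg.
have -> : Green l (fun s => q s * neumann (fun s0 => a * f s0 + b * g s0) n s) t =
    Green l (fun s => a * (q s * neumann f n s) + b * (q s * neumann g n s)) t.
  by apply: itg_ext => s _; rewrite ih; ring.
by rewrite Green_lin; [ring|cont..].
Qed.

(** The difference of consecutive partial sums is [(- G q)^(n+1) v], and each application of [G q]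
    contracts the norm weighted by [q] by the factor [tau]. *)
Lemma neumann_diff v n : continuous v ->
  itg 0 T (fun t => q t * (neumann v n.+1 t - neumann v n t) ^+ 2) <=
  (tau ^+ 2) ^+ n.+1 * itg 0 T (fun t => q t * v t ^+ 2).
Proof.
move=> cv; have q0' t : 0 <= t <= T -> 0 <= q t by [].
have le_tau u : continuous u ->
    itg 0 T (fun t => q t * Green l (fun s => q s * u s) t ^+ 2) <=
    tau ^+ 2 * itg 0 T (fun t => q t * u t ^+ 2).
  move=> cu; apply: (le_trans (Green_hs_bound l cq cu q0')).
  rewrite ler_wpM2r//; apply: itg_ge0 => t _.
  by rewrite mulr_ge0 ?sqr_ge0.
elim: n => [|n ih].
  rewrite expr1; apply: le_trans (le_tau v cv).
  by rewrite le_eqVlt; apply/orP; left; apply/eqP/itg_ext => t _ /=; ring.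
have c1 := @cont_neumann _ n cv; have c2 := @cont_neumann _ n.+1 cv.
rewrite exprS -mulrA; apply: le_trans (ler_wpM2l (sqr_ge0 _) ih).
have cd : continuous (fun t => neumann v n.+1 t - neumann v n t).
  by apply: contD => //; apply: contN.
apply: le_trans (le_tau _ cd); rewrite le_eqVlt; apply/orP; left.
apply/eqP/itg_ext => t _; congr (_ * _).
have -> : Green l (fun s => q s * (neumann v n.+1 s - neumann v n s)) t =
    Green l (fun s => 1 * (q s * neumann v n.+1 s) + -1 * (q s * neumann v n s)) t.
  by apply: itg_ext => s _; ring.
rewrite Green_lin; [|by cont..].
have NE m : neumann v m.+1 t = v t - Green l (fun s => q s * neumann v m s) t by [].
by rewrite (NE n.+1) (NE n); ring.
Qed.

(* The quadratic form of [- d^2/dt^2 - l^2 + q] on [w = v - G(q u)] where [v]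
   belongs to the eigenvalue [1/4 - l^2] of [- d^2/dt^2 - l^2]. *)
Lemma neumann_form (v v1 u p r : R -> R) :
  antiper_sol 2^-1 (fun=> 0) v v1 -> continuous u ->
  antiper_sol l (fun t => q t * u t) p r ->
  itg 0 T (fun t => ((4^-1 - l ^+ 2) * v t - q t * u t + q t * (v t - p t)) * (v t - p t))
  <= (4^-1 - l ^+ 2) * itg 0 T (fun t => v t ^+ 2)
     + itg 0 T (fun t => q t * (v t - p t - u t) ^+ 2).
Proof.
move=> [cv cv1 dv dv1 [vA v1A]] cu sp; have [cp cr dp dr [pA rA]] := sp.
have cqu : continuous (fun t => q t * u t) by cont.
have pE t := green_repr (t := t) ln0 cl0 cqu sp.
have q0' t : 0 <= t <= T -> 0 <= q t by [].
set mu := 4^-1 - l ^+ 2.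
(* The Wronskian of [v - p] and [v] has equal end values, so [dW] integrates to zero; splitting it
   off trades [mu (v - p) v] for [mu v^2] up to terms in [q]. *)
pose W t := (v1 t - r t) * v t - (v t - p t) * v1 t.
pose dW t := mu * (v t - p t) * v t - mu * v t ^+ 2 + q t * u t * v t.
have Wint : itg 0 T dW = 0.
  have -> : itg 0 T dW = W T - W 0.
    apply: FTC; [exact: twopi_ge0|by rewrite /dW; cont|by rewrite /W; cont|].
    move=> t tT; have a1 := dv t tT; have a2 := dv1 t tT.
    have a3 := dp t tT; have a4 := dr t tT.
    by apply: der_eq; [rewrite /W; der|cbv beta; rewrite /dW /mu; field].
  by rewrite /W vA v1A pA rA; ring.
pose f1 t := v t ^+ 2; pose f2 t := q t * (v t - p t - u t) ^+ 2.
pose f3 t := q t * u t ^+ 2; pose f4 t := q t * (u t * p t).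
have c1 : continuous f1 by rewrite /f1; cont.
have c2 : continuous f2 by rewrite /f2; cont.
have c3 : continuous f3 by rewrite /f3; cont.
have c4 : continuous f4 by rewrite /f4; cont.
have cdW : continuous dW by rewrite /dW; cont.
have mc1 : continuous (fun t => mu * f1 t) by cont.
have c12 := contD mc1 c2; have c34 := contD c3 c4.
have -> : itg 0 T (fun t => (mu * v t - q t * u t + q t * (v t - p t)) * (v t - p t)) =
    mu * itg 0 T f1 + itg 0 T f2 - (itg 0 T f3 + itg 0 T f4) + itg 0 T dW.
  rewrite -(itgZ _ _ _ c1) -(itgD _ _ mc1 c2) -(itgD _ _ c3 c4) -(itgB _ _ c12 c34).
  rewrite -(itgD _ _ (contD c12 (contN c34)) cdW).
  by apply: itg_ext => t _; rewrite /f1 /f2 /f3 /f4 /dW; ring.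
(* What remains is [(q u, u) + (q u, G (q u)) >= (1 - tau) (q u, u) >= 0]. *)
rewrite Wint addr0 gerBl.
have := Green_form_bound cq cu q0' tau0 qtau.
have -> : itg 0 T (fun t => q t * (u t * Green l (fun s => q s * u s) t)) = itg 0 T f4.
  by apply: itg_ext => t tT; rewrite /f4 pE.
rewrite -/(itg 0 T f3) ler_norml => /andP[lo _].
have f30 : 0 <= itg 0 T f3.
  by apply: itg_ge0 => t _; rewrite /f3 mulr_ge0 ?sqr_ge0.
have : tau * itg 0 T f3 <= itg 0 T f3 by rewrite ler_piMl// ltW.
by rewrite -[itg 0 T (fun t => q t * u t ^+ 2)]/(itg 0 T f3) in lo; lra.
Qed.

End Neumann.

Lemma int_half_sq_gt0 a b : (a != 0) || (b != 0) ->
  0 < itg 0 T (fun t => (a * cos (t / 2) + b * sin (t / 2)) ^+ 2).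
Proof.
move=> ab; have pi0 := @pi_gt0 R.
have pos c : 0 < c < T -> a * cos (c / 2) + b * sin (c / 2) != 0 ->
    0 < itg 0 T (fun t => (a * cos (t / 2) + b * sin (t / 2)) ^+ 2).
  move=> cT vc; apply: (itg_gt0 cT); [by cont|by move=> t _; exact: sqr_ge0|].
  by rewrite exprn_even_gt0.
have [b0'|b0'] := eqVneq b 0.
  apply: (pos (pi / 2)); first by apply/andP; split; lra.
  move: ab; rewrite b0' eqxx orbF mul0r addr0 => a0; rewrite mulf_neq0// gt_eqF//.
  by apply: cos_gt0_pihalf; apply/andP; split; lra.
apply: (pos pi); first by apply/andP; split; lra.
by rewrite cos_pihalf sin_pihalf mulr0 add0r mulr1.
Qed.

(** No limit of the series is taken: for the partial sum of index [n.+1] the form is at most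
    [mu + (tau ^+ 2) ^+ n.+1 * c0] times the squared norm of [v], and the negative [mu] wins for
    large [n]. *)
Lemma no_neg_multiplier_gt : 2^-1 < l -> rho < 0 ->
  e * (1 + beta * Num.sqrt (hs_norm l (@cos_plus R))) < 1 -> False.
Proof.
move=> l2 rn; set k := Num.sqrt _ => ek.
have e1' : 0 < 1 - e by rewrite subr_gt0.
have k0 : 0 <= k by exact: sqrtr_ge0.
pose c0 : R := beta * (e / (1 - e)).
have c00 : 0 <= c0 by rewrite mulr_ge0 ?divr_ge0// ltW.
pose q t : R := c0 * cos_minus t.
have cm := @cont_cos_minus R; have cq : continuous q by rewrite /q; cont.
have q0 t : 0 <= q t by rewrite mulr_ge0 ?cos_minus_ge0.
have qc t : q t <= c0.
  rewrite /q ler_piMr// /cos_minus ler_pdivrMr//.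
  have := cos_max t; have := ler_norm (- cos t); rewrite normrN; lra.
pose tau : R := c0 * k.
have tau0 : 0 <= tau by rewrite mulr_ge0.
(* Clearing the denominator [1 - e], this is the hypothesis [e * (1 + beta * k) < 1]. *)
have tau1 : tau < 1.
  rewrite /tau /c0 -mulrA mulrAC mulrA ltr_pdivrMr// mul1r.
  by rewrite (_ : beta * (e * k) = e * (beta * k)); [lra|ring].
have qtau : hs_norm l q <= tau ^+ 2.
  have -> : tau ^+ 2 = c0 ^+ 2 * k ^+ 2 by rewrite /tau; ring.
  have -> : k ^+ 2 = hs_norm l (@cos_plus R).
    by rewrite sqr_sqrtr// hs_norm_ge0// => t _; exact: cos_plus_ge0.
  by rewrite -hs_norm_cos_minus -(hs_normZ l c0 cm).
have mu0 : 4^-1 - l ^+ 2 < 0.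
  have l2' := l2; have : 0 < (l - 2^-1) * (l + 2^-1) by rewrite mulr_gt0 ?subr_gt0// addr_gt0.
  by lra.
set mu := 4^-1 - l ^+ 2 in mu0.
have [n hn] : exists n, (tau ^+ 2) ^+ n.+1 * c0 < - mu.
  have t2 : `|tau ^+ 2| < 1 by rewrite ger0_norm ?sqr_ge0// expr_lt1.
  have d0 : 0 < - mu / (c0 + 1) by rewrite divr_gt0 ?oppr_gt0// ltr_wpDl.
  have /cvgrPdist_lt/(_ _ d0)[n _ hn] := cvg_expr t2.
  exists n; have := hn n.+1 (leqnSn n); rewrite /= sub0r normrN ger0_norm ?exprn_ge0 ?sqr_ge0//.
  rewrite ltr_pdivlMr ?ltr_wpDl//; apply: le_lt_trans.
  by rewrite ler_wpM2l ?exprn_ge0 ?sqr_ge0// lerDl.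
have [t0 t0T xt0] := neg_multiplier_zero rn.
have t0T' : 0 <= t0 <= T by case/andP: t0T => -> /ltW.
pose vc t : R := cos (t / 2); pose vs t : R := sin (t / 2).
have cvc : continuous vc by rewrite /vc; cont.
have cvs : continuous vs by rewrite /vs; cont.
(* Partial sums are linear in the starting function, so vanishing at [t0] is one linear condition on
   the two coefficients. *)
have [a [b [ab wt0]]] : exists a b, (a != 0) || (b != 0) /\
    a * neumann q vc n.+1 t0 + b * neumann q vs n.+1 t0 = 0.
  have [nc|nc] := eqVneq (neumann q vc n.+1 t0) 0.
    by exists 1, 0; rewrite oner_neq0 nc; split => //; ring.
  by exists (neumann q vs n.+1 t0), (- neumann q vc n.+1 t0); rewrite oppr_eq0 nc orbT;
    split => //; ring.
pose v t : R := a * vc t + b * vs t.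
pose v1 t : R := - a / 2 * sin (t / 2) + b / 2 * cos (t / 2).
have sv : antiper_sol 2^-1 (fun=> 0) v v1.
  split; [by rewrite /v; cont|by rewrite /v1; cont|move=> s _..|].
  - by apply: der_eq; [rewrite /v /vc /vs; der|cbv beta; rewrite /v1; field].
  - by apply: der_eq; [rewrite /v1; der|cbv beta; rewrite /v /vc /vs; field].
  - by rewrite /v /v1 /vc /vs twopi_half cospi sinpi !mul0r cos0 sin0; split; ring.
have [cv cv1 dv dv1 [vA v1A]] := sv.
pose u := neumann q v n.
have cu : continuous u by exact: cont_neumann.
have cqu : continuous (fun t => q t * u t) by cont.
have [p [r sp]] := antiper_solvable ln0 cl0 cqu.
have [cp cr dp dr [pA rA]] := sp.
have pE t := green_repr (t := t) ln0 cl0 cqu sp.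
pose w t := v t - p t.
have wE t : 0 <= t <= T -> w t = neumann q v n.+1 t by move=> tT; rewrite /w pE.
have F0 : 0 <= itg 0 T (fun t => (mu * v t - q t * u t + q t * (v t - p t)) * (v t - p t)).
  pose w1 t := v1 t - r t; pose w2 t := - l ^+ 2 * w t - mu * v t + q t * u t.
  have wt0' : w t0 = 0 by rewrite wE// neumann_lin.
  have cw : continuous w by rewrite /w; cont.
  have cw1 : continuous w1 by rewrite /w1; cont.
  have dw t : 0 < t < T -> has_der w t (w1 t).
    by move=> tT; have a1 := dv t tT; have a2 := dp t tT; rewrite /w /w1; der.
  have dw1 t : 0 < t < T -> has_der w1 t (w2 t).
    move=> tT; have a1 := dv1 t tT; have a2 := dr t tT.
    by apply: der_eq; [rewrite /w1; der|cbv beta; rewrite /w2 /w /mu; field].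
  have wA : w T = - w 0 by rewrite /w vA pA; ring.
  have w1A : w1 T = - w1 0 by rewrite /w1 v1A rA; ring.
  have cF : continuous (fun t => (mu * v t - q t * u t + q t * (v t - p t)) * (v t - p t)).
    by cont.
  apply: (jacobi_ge0 t0T xt0 wt0' cw cw1 cF dw dw1 wA w1A) => t _.
  rewrite -/(w t) potE -lE /w2.
  have := ler_wpM2r (sqr_ge0 (w t)) (pot_diff_ge t).
  by rewrite -/c0 -/(q t); lra.
have := neumann_form cq q0 tau0 tau1 qtau sv cu sp.
rewrite -/mu => F1.
have F2 : itg 0 T (fun t => q t * (v t - p t - u t) ^+ 2) <=
    (tau ^+ 2) ^+ n.+1 * itg 0 T (fun t => q t * v t ^+ 2).
  apply: le_trans (neumann_diff cq q0 qtau n cv).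
  by rewrite le_eqVlt; apply/orP; left; apply/eqP/itg_ext => t tT; rewrite -wE.
have F3 : itg 0 T (fun t => q t * v t ^+ 2) <= c0 * itg 0 T (fun t => v t ^+ 2).
  rewrite -itgZ; last by cont.
  by apply: itg_le; [cont|cont|move=> t _; rewrite ler_wpM2r ?sqr_ge0].
have V0 : 0 < itg 0 T (fun t => v t ^+ 2) by exact: int_half_sq_gt0.
have tn0 : 0 <= (tau ^+ 2) ^+ n.+1 by rewrite exprn_ge0 ?sqr_ge0.
have := ler_wpM2l tn0 F3; set V := itg 0 T (fun t => v t ^+ 2) in F1 F3 V0 *.
rewrite mulrA => F4.
have : ((tau ^+ 2) ^+ n.+1 * c0 + mu) * V < 0.
  by rewrite pmulr_llt0//; lra.
by move: F0; lra.
Qed.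

End Jacobi.

(** * The monodromy matrix *)

Section Monodromy.
Variable R : realType.
Implicit Types (a b c d t x y p q : R) (M : 'M[R]_2).
Local Notation T := (2 * pi : R).

Lemma cayley_hamilton2 M : M 0 0 * M 1 1 - M 0 1 * M 1 0 = 1 ->
  M * M = (M 0 0 + M 1 1) *: M - 1.
Proof.
move=> det1.
have E i j : (M * M) i j = M i 0 * M 0 j + M i 1 * M 1 j.
  rewrite [LHS]mxE big_ord_recl big_ord1; congr (_ * M _ _ + M _ _ * M _ _);
  exact/val_inj.
apply/matrixP => i j; rewrite E !mxE.
by case: (ord2P i) => ->; case: (ord2P j) => -> /=; lra.
Qed.

(** For [|tr| < 2] the conic is an ellipse: [2 |p q| <= p^2 + q^2] gives [(2 - |tr|) p^2 <= 2], and
    [|p| <= 1 + p^2]. *)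
Lemma ellipse_bound (tr p q : R) : `|tr| < 2 -> p ^+ 2 + tr * p * q + q ^+ 2 = 1 ->
  `|p| <= 1 + (2 - `|tr|)^-1 *+ 2.
Proof.
move=> tr2 E; set s := 2 - `|tr|; have s0 : 0 < s by rewrite subr_gt0.
have trpq : - (`|tr| * (`|p| * `|q|)) <= tr * p * q.
  by rewrite -!normrM lerNl -mulrA -normrN ler_norm.
have pq : 0 <= (`|p| - `|q|) ^+ 2 by exact: sqr_ge0.
have np : `|p| ^+ 2 = p ^+ 2 by rewrite real_normK ?num_real.
have nq : `|q| ^+ 2 = q ^+ 2 by rewrite real_normK ?num_real.
have key : s * `|p| ^+ 2 <= 2.
  have q0 := sqr_ge0 q; have t0 := normr_ge0 tr.
  have : `|tr| * (`|p| * `|q|) *+ 2 <= `|tr| * (`|p| ^+ 2 + `|q| ^+ 2).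
    by rewrite -mulrnAr ler_wpM2l//; lra.
  have : 0 <= s * `|q| ^+ 2 by rewrite mulr_ge0 ?sqr_ge0// ltW.
  by rewrite /s; lra.
have key2 : `|p| ^+ 2 <= s^-1 *+ 2.
  by rewrite -mulr_natr mulrC ler_pdivlMr// mulrC.
by have := sqr_ge0 (`|p| - 1); have := invr_ge0 s; rewrite (ltW s0); lra.
Qed.

(** By Cayley-Hamilton [M^j = p M + q], and [p^2 + tr p q + q^2] is the determinant of that matrix,
    hence [1]. *)
Lemma stable_of_trace M : M 0 0 * M 1 1 - M 0 1 * M 1 0 = 1 ->
  `|M 0 0 + M 1 1| < 2 -> linearly_stable M.
Proof.
move=> /cayley_hamilton2; set tr := M 0 0 + M 1 1 => MM tr2.
have pw j : exists p q : R, M ^+ j = p *: M + q *: (1 : 'M[R]_2) /\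
    p ^+ 2 + tr * p * q + q ^+ 2 = 1.
  elim: j => [|j [p [q [Mj pq]]]].
    by exists 0, 1; rewrite expr0 scale0r add0r scale1r; split=> //; ring.
  exists (tr * p + q), (- p); split; last by rewrite -pq; ring.
  rewrite exprSr Mj mulrDl -!scalerAl mul1r MM scalerBr scalerA scalerDl scaleNr.
  by rewrite [p * _]mulrC addrAC.
set c := 1 + (2 - `|tr|)^-1 *+ 2.
exists (c * (`|M| + `|1 : 'M[R]_2|)) => j.
have [p [q [-> pq]]] := pw j.
rewrite mulrDr (le_trans (ler_normD _ _))// !normrZ lerD// ler_wpM2r//.
- exact: ellipse_bound pq.
- by apply: (@ellipse_bound tr q p) => //; rewrite -pq; ring.
Qed.

Lemma real_eigenvector a b c d : a * d - b * c = 1 -> 2 <= `|a + d| ->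
  exists rho u v, [/\ rho != 0, (u != 0) || (v != 0),
    a * u + b * v = rho * u & c * u + d * v = rho * v].
Proof.
move=> det1 tr2; set tr := a + d.
pose rho := (tr + Num.sqrt (tr ^+ 2 - 4)) / 2.
have charp : rho ^+ 2 = tr * rho - 1.
  have : Num.sqrt (tr ^+ 2 - 4) ^+ 2 = tr ^+ 2 - 4.
    rewrite sqr_sqrtr// -real_normK ?num_real// subr_ge0.
    have -> : 4 = 2 ^+ 2 :> R by ring.
    by rewrite ler_pXn2r// nnegrE.
  by rewrite /rho; set s := Num.sqrt _ => s2; lra.
have rho0 : rho != 0.
  apply/eqP => r0; move: charp; rewrite r0 expr0n mulr0 sub0r => /eqP.
  by rewrite eq_sym oppr_eq0 oner_eq0.
exists rho; clearbody rho; rewrite /tr in charp.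
have [b0|b0] := eqVneq b 0; last first.
  by exists b, (rho - a); split; rewrite ?b0//; lra.
have [c0|c0] := eqVneq c 0; last first.
  by exists (rho - d), c; split; rewrite ?c0 ?orbT//; lra.
have : (rho - a) * (rho - d) == 0 by apply/eqP; rewrite b0 in det1; lra.
rewrite mulf_eq0 => /orP[] /eqP r.
  by exists 1, 0; split; rewrite ?oner_eq0 ?b0 ?c0//; lra.
by exists 0, 1; split; rewrite ?oner_eq0 ?orbT ?b0 ?c0//; lra.
Qed.

Lemma derivative0_cst f t : continuous f ->
  (forall s, 0 < s < T -> has_der f s 0) -> 0 <= t <= T -> f t = f 0.
Proof.
move=> cf df /andP[t0 tT]; have : itg 0 t (fun=> 0) = f t - f 0.
  apply: FTC => //; first exact: cont_cst.
  by move=> s /andP[s0 st]; apply: df; rewrite s0 (lt_le_trans st).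
by rewrite itg_cst// mul0r => /esym/eqP; rewrite subr_eq0 => /eqP.
Qed.

Variables (beta e : R) (gamma : R -> 'M[R]_2).
Hypothesis hgamma : is_fundamental_solution beta e gamma.

(** A column has the form [(x', x)], hence [y] in row [0] and [x] in row [1]. *)
Lemma fundamental_solution_col j : exists x y : R -> R,
  [/\ continuous x, continuous y,
      forall t, 0 <= t <= T -> y t = gamma t 0 j /\ x t = gamma t 1 j,
      forall t, 0 < t < T -> has_der x t (y t) &
      forall t, 0 < t < T -> has_der y t (- pot beta e t * x t)].
Proof.
have [_ cg dg] := hgamma.
have [y [cy yE]] := extend_cont (cg 0 j).
have [x [cx xE]] := extend_cont (cg 1 j).
have ext (f g : R -> R) (t l : R) : (forall t, 0 <= t <= T -> g t = f t) -> 0 < t < T ->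
    is_derive t 1 f l -> has_der g t l.
  move=> gf tT; apply: near_eq_is_derive.
  have : \forall s \near t, s \in `]0, T[ by apply: near_in_itvoo; rewrite in_itv.
  apply: filterS => s; rewrite in_itv/= => /andP[s0 sT].
  by rewrite gf// (ltW s0) ltW.
have JBg t : 0 < t < T -> ((J R *m B beta e t *m gamma t) 0 j = - pot beta e t * x t) *
    ((J R *m B beta e t *m gamma t) 1 j = y t).
  move=> /andP[t0 tT]; have tT' : 0 <= t <= T by rewrite !ltW.
  rewrite -mulmxA /J /B !mx2_mul xE// yE// /pot /ecc.
  by split; ring.
exists x, y; split=> // t tT.
- by rewrite yE// xE.
- by rewrite -(JBg t tT).2; exact: (ext _ _ _ _ xE tT (dg t 1 j tT)).
- by rewrite -(JBg t tT).1; exact: (ext _ _ _ _ yE tT (dg t 0 j tT)).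
Qed.

(** The trace is exactly [2] here, where the trace criterion is silent. In a rotating frame the
    solution is constant, and the frame returns after [2 pi]. *)
Lemma monodromy_beta0 : beta = 0 -> gamma T = 1%:M.
Proof.
move=> b0; have [g0 _ _] := hgamma.
suff : forall j, gamma T 0 j = gamma 0 0 j /\ gamma T 1 j = gamma 0 1 j.
  move=> H; rewrite -g0; apply/matrixP => i j.
  by have [] := H j; case: (ord2P i) => ->.
move=> j; have [x [y [cx cy E dx dy]]] := fundamental_solution_col j.
have T0 := twopi_ge0 R.
have [<- <-] := E 0 ltac:(by rewrite lexx).
have [<- <-] := E T ltac:(by rewrite lexx andbT).
have P1 t : pot beta e t = 1 by rewrite /pot b0 mul0r subr0.
have c1 : continuous (fun t => y t * cos t + x t * sin t) by cont.
have c2 : continuous (fun t => x t * cos t - y t * sin t) by cont.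
have TT : 0 <= T <= T by rewrite lexx andbT.
have h1 := derivative0_cst c1 _ TT; have h2 := derivative0_cst c2 _ TT.
have cT : cos T = 1 :> R by rewrite mulr_natl cos2pi.
have sT : sin T = 0 :> R by rewrite mulr_natl sin2pi.
move: h1 h2; rewrite cT sT cos0 sin0 !mulr1 !mulr0 !addr0 !subr0; split.
  apply: h1 => s sT'; have d1 := dx s sT'; have d2 := dy s sT'.
  by apply: der_eq; [der|rewrite P1; ring].
apply: h2 => s sT'; have d1 := dx s sT'; have d2 := dy s sT'.
by apply: der_eq; [der|rewrite P1; ring].
Qed.

(** The Wronskian gives determinant [1], so a trace of modulus at least [2] yields a real
    eigenvector [(u, v)]; that combination of the columns is the Floquet solution. *)
Lemma monodromy_dichotomy : linearly_stable (gamma T) \/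
  exists (x y : R -> R) rho, [/\ continuous x /\ continuous y,
      forall t, 0 < t < T -> has_der x t (y t),
      forall t, 0 < t < T -> has_der y t (- pot beta e t * x t),
      forall t, 0 <= t <= T -> x t = 0 -> y t <> 0 &
      [/\ rho != 0, x T = rho * x 0 & y T = rho * y 0]].
Proof.
have [g0 _ _] := hgamma.
have [x1 [y1 [cx1 cy1 E1 dx1 dy1]]] := fundamental_solution_col 0.
have [x2 [y2 [cx2 cy2 E2 dx2 dy2]]] := fundamental_solution_col 1.
have T0 := twopi_ge0 R.
have t00 : 0 <= (0 : R) <= T by rewrite lexx.
have tTT : 0 <= T <= T by rewrite lexx andbT.
have [y10 x10] := E1 0 t00; have [y20 x20] := E2 0 t00.
rewrite g0 !mxE/= in y10 x10 y20 x20.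
have [yT1 xT1] := E1 T tTT; have [yT2 xT2] := E2 T tTT.
have wronskian t : 0 <= t <= T -> y1 t * x2 t - y2 t * x1 t = 1.
  move=> tT; have c : continuous (fun t => y1 t * x2 t - y2 t * x1 t) by cont.
  rewrite (derivative0_cst c _ tT); first by rewrite y10 x10 y20 x20; ring.
  move=> s sT; have d1 := dx1 s sT; have d2 := dy1 s sT.
  have d3 := dx2 s sT; have d4 := dy2 s sT.
  by apply: der_eq; [der|cbv beta; ring].
have det1 := wronskian T tTT; rewrite yT1 xT1 yT2 xT2 in det1.
have [tr|tr] := ltP `|gamma T 0 0 + gamma T 1 1| 2.
  by left; apply: stable_of_trace.
right; have [rho [u [v [rho0 uv eu ev]]]] := real_eigenvector det1 tr.
exists (fun t => x1 t * u + x2 t * v), (fun t => y1 t * u + y2 t * v), rho.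
split=> [|t tT|t tT|t tT xt yt|].
- by split; cont.
- have d1 := dx1 t tT; have d2 := dx2 t tT.
  by apply: der_eq; [der|cbv beta; ring].
- have d1 := dy1 t tT; have d2 := dy2 t tT.
  by apply: der_eq; [der|cbv beta; ring].
- have W := wronskian t tT; cbv beta in xt, yt.
  have u0 : u = 0.
    rewrite -[LHS]mul1r -W.
    transitivity (x2 t * (y1 t * u + y2 t * v) - y2 t * (x1 t * u + x2 t * v)); first by ring.
    by rewrite xt yt; ring.
  have v0 : v = 0.
    rewrite -[LHS]mul1r -W.
    transitivity (y1 t * (x1 t * u + x2 t * v) - x1 t * (y1 t * u + y2 t * v)); first by ring.
    by rewrite xt yt; ring.
  by move: uv; rewrite u0 v0 eqxx.
- rewrite xT1 xT2 yT1 yT2 x10 x20 y10 y20; split=> //.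
    by rewrite ev; ring.
  by rewrite eu; ring.
Qed.

End Monodromy.

Theorem theorem1p4 (R : realType) (beta e : R) (gamma : R -> 'M[R]_2)
  (hbeta0 : 0 <= beta) (hbeta1 : beta < 1) (hbeta34 : beta <> 3 / 4)
  (he0 : 0 <= e) (he1 : e < 1)
  (hgamma : is_fundamental_solution beta e gamma)
  (hcond : (beta < 3 / 4 /\ e < 1 / (1 + Num.sqrt (f_minus1 beta))) \/
           (3 / 4 < beta /\ e < 1 / Num.sqrt (f_minus1 beta))) :
  linearly_stable (gamma (2 * pi)).
Proof.
move: hbeta0; rewrite le_eqVlt => /predU1P[b0|b0].
  by rewrite (monodromy_beta0 hgamma (esym b0)); exists `|1%:M : 'M[R]_2| => j; rewrite expr1n.
have [//|[x [y [rho [[cx cy] dx dy xy0 [rho0 xT yT]]]]]] := monodromy_dichotomy hgamma.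
exfalso.
pose l := Num.sqrt (1 - beta).
have lE : l ^+ 2 = 1 - beta by rewrite sqr_sqrtr// subr_ge0 ltW.
have l0 : 0 < l by rewrite sqrtr_gt0 subr_gt0.
clearbody l.
have l1 : l <= 1 by rewrite -(@ler_pXn2r _ 2) ?nnegrE ?ler01 ?(ltW l0)// expr1n; lra.
have half2 : (2^-1 : R) ^+ 2 = 4^-1 by field.
have l12 : l != 2^-1.
  by apply/eqP => lh; apply: hbeta34; rewrite lh half2 in lE; lra.
have hneg : rho < 0.
  rewrite lt_neqAle rho0 leNgt; apply/negP.
  exact: (no_pos_multiplier b0 hbeta1 he0 he1 cx cy dx dy xy0 rho0 xT yT).
have hs0 : 0 <= hs_norm l (@cos_plus R).
  by apply: hs_norm_ge0 => t _; exact: cos_plus_ge0.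
set k := Num.sqrt (hs_norm l (@cos_plus R)).
have fE : Num.sqrt (f_minus1 beta) = beta * k.
  by rewrite (f_minus1E lE l0 l1 l12) sqrtrM ?sqr_ge0// sqrtr_sqr gtr0_norm.
have k0 : 0 <= k by exact: sqrtr_ge0.
rewrite fE in hcond.
case: hcond => -[b34 ecnd].
  have lgt : 2^-1 < l.
    by rewrite -(@ltr_pXn2r _ 2) ?nnegrE ?invr_ge0 ?ler0n ?(ltW l0)// half2; lra.
  apply: (no_neg_multiplier_gt b0 hbeta1 he0 he1 cx cy dx dy xy0 rho0 xT yT lE l0 l12 lgt hneg).
  by rewrite -ltr_pdivlMr// ltr_pwDl// mulr_ge0// ltW.
have llt : l < 2^-1.
  by rewrite -(@ltr_pXn2r _ 2) ?nnegrE ?invr_ge0 ?ler0n ?(ltW l0)// half2; lra.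
have [t0 /andP[t00 t0T] xt0] := neg_multiplier_zero cx rho0 xT hneg.
(* For [k = 0] the quotient [1 / 0] is [0] by convention, and the condition on [e] would read
   [e < 0]. *)
have kpos : 0 < k.
  rewrite lt_neqAle k0 andbT; apply/eqP => kz.
  by move: ecnd; rewrite -kz mulr0 invr0 mulr0 ltNge he0.
apply: (no_neg_multiplier_lt b0 he0 he1 cx cy dx dy xy0 rho0 xT yT lE l0 l12 t00 t0T xt0 llt) => //.
by rewrite -ltr_pdivlMr// mulr_gt0.
Qed.
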